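(* Let $\{T(t)\}_{t\in\mathbb{R}}$ be a Schrödinger group on $L^2(\mathbb{R})$ with $T(t)\not\equiv I$ (i.e. $T(t)\neq I$ for some $t$, where $I$ is the identity operator), and let $\alpha\in\mathbb{R}\setminus\{0\}$. Then the following are equivalent: (i) $\{T(t)\}_{t\in\mathbb{R}}$ is of order $\alpha$; (ii) $T(t)=T(1)_{t^{1/\alpha}}$ for all $t>0$; (iii) $T(t)=T(1)_{t^{1/\alpha}}$ for some $t>0$, $t\neq 1$.
   Context: $L^2(\mathbb{R})$ is the space of complex-valued Lebesgue square-integrable functions on $\mathbb{R}$ modulo a.e. equality, with inner product $\langle f,g\rangle=\int_{\mathbb{R}} f\overline{g}\,dx$, and $\mathscr{L}(L^2(\mathbb{R}))$ is the space of bounded linear operators on it. The Fourier transform is the unitary one, $\hat f(\xi)=\frac{1}{\sqrt{2\pi}}\int_{\mathbb{R}} f(x)e^{-i\xi x}\,dx$ (extended to $L^2$ as usual). For $\lambda\in\mathbb{R}\setminus\{0\}$ and $a\in\mathbb{R}$, set $\delta_\lambda f(x)=\frac{1}{|\lambda|}f(x/\lambda)$ and $\tau_a f(x)=f(x-a)$. For $T\in\mathscr{L}(L^2(\mathbb{R}))$ and $\lambda\in\mathbb{R}\setminus\{0\}$, set $T_\lambda=\delta_\lambda\,T\,\delta_{\lambda^{-1}}$; in particular $T(1)_\lambda=\delta_\lambda T(1)\delta_{\lambda^{-1}}$. For $R>1$, $L^2_R(\mathbb{R})=\{f\in L^2(\mathbb{R}): \hat f(\xi)=0 \text{ for a.e.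 }\xi\text{ with }|\xi|<R^{-1}\text{ or }|\xi|>R\}$. Definitions for $T\in\mathscr{L}(L^2(\mathbb{R}))$: - $T$ is semistable if there exist constants $a,b>0$ such that $T^2=T_a$ and $T^3=T_b$. - $T$ is translation-invariant if $\tau_{-a}T\tau_a=T$ for all $a\in\mathbb{R}$. - $T$ is symmetric if $T_{-1}=T$. - $T$ is locally uniformly continuous (LUC) under dilation if for every $R>1$ the map $\lambda\mapsto T_\lambda|_{L^2_R(\mathbb{R})}$, from $(0,\infty)$ to the bounded operators $L^2_R(\mathbb{R})\to L^2(\mathbb{R})$, is continuous with respect to the operator norm. A family $\{T(t)\in\mathscr{L}(L^2(\mathbb{R}))\}_{t\in\mathbb{R}}$ is an operator group if $T(0)=I$ and $T(t_1+t_2)=T(t_1)T(t_2)$ for all $t_1,t_2\in\mathbb{R}$. It is weakly measurable if for all $f,g\in L^2(\mathbb{R})$ the function $t\mapsto\langle T(t)f,g\rangle$ is Lebesgue measurable on $\mathbb{R}$. Schrödinger operator: suppose a unitary operator $T$ satisfies $\widehat{Tf}(\xi)=e^{i\beta|\xi|^{\alpha}}\hat f(\xi)$ for all $f\in L^2(\mathbb{R})$, for some $\alpha\in\mathbb{R}\setminus\{0\}$ and $\beta\in\mathbb{R}$. Define $\alpha(T)=0$ if $T=I$ and $\alpha(T)=\alpha$ if $T\neq I$ (in the latter case $\alpha,\beta$ are uniquely determined by $T$). Then $T$ is called a Schrödinger operator of order $\alpha(T)$. Schrödinger group: a weakly measurable operator group $\{T(t)\}_{t\in\mathbb{R}}$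 of unitary operators on $L^2(\mathbb{R})$ such that each $T(t)$ is semistable, translation-invariant, symmetric, and LUC under dilation. (Each such $T(t)$ is a Schrödinger operator.) The order of the group is defined to be the order $\alpha(T(1))$ of $T(1)$. *)

(* Defs.v *)
From HB Require Import structures.
From mathcomp Require Import all_boot all_order all_algebra.
From mathcomp Require Import generic_quotient ring_quotient complex.
From mathcomp Require Import all_classical all_reals all_analysis.
From mathcomp Require Import measurable_realfun.

Set Implicit Arguments.
Unset Strict Implicit.
Unset Printing Implicit Defensive.

Import Order.TTheory GRing.Theory Num.Theory.
Import numFieldNormedType.Exports.
Import ComplexField.

Local Open Scope classical_set_scope.
Local Open Scope ring_scope.
Local Open Scope complex_scope.

Notation leb R := (@lebesgue_measure R).
Notation modulus f := (fun x => Normc.normc (f x)).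

Section SquareIntegrable.
Context {R : realType}.
Implicit Types f g : R -> R[i].

Definition measurable_complex f : Prop :=
  measurable_fun [set: R] (fun x => complex.Re (f x)) /\
  measurable_fun [set: R] (fun x => complex.Im (f x)).

Definition L2fun : {pred R -> R[i]} :=
  mem [set f | measurable_complex f /\ finite_norm (leb R) 2%:E (modulus f)].

Lemma measurable_modulus f :
  measurable_complex f -> measurable_fun [set: R] (modulus f).
Proof.
move=> [mr mi].
rewrite (_ : modulus f = (fun y : R => Num.sqrt y) \o
  (fun x => complex.Re (f x) ^+ 2 + complex.Im (f x) ^+ 2)); last first.
  by apply/funext => x /=; case: (f x).
apply: measurableT_comp.
  by apply: continuous_measurable_fun; exact: sqrt_continuous.
by apply: measurable_funD; apply: measurable_funX.
Qed.

Lemma finite_norm_le (u v : R -> R) :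
  measurable_fun [set: R] u -> measurable_fun [set: R] v ->
  (forall x, 0 <= u x <= v x) ->
  finite_norm (leb R) 2%:E v -> finite_norm (leb R) 2%:E u.
Proof.
move=> mu mv uv; rewrite /finite_norm; apply: le_lt_trans; rewrite unlock /=.
have mp (w : R -> R) : measurable_fun [set: R] w ->
    measurable_fun [set: R] (fun x => (`|(w x)%:E| `^ 2)%E).
  move=> mw; apply/measurable_EFinP.
  by apply: (measurableT_comp (measurable_powR _)) => //; exact: measurableT_comp.
have ip (w : R -> R) : (0 <= \int[leb R]_x (`|(w x)%:E| `^ 2))%E.
  by apply: integral_ge0 => x _; exact: poweR_ge0.
apply: gt0_ler_poweR; rewrite ?in_itv/= ?leey ?ip//.
apply: ge0_le_integral => //; do ?exact: mp.
move=> x _; have /andP[u0 uvx] := uv x.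
rewrite lee_fin; apply: ge0_ler_powR; rewrite ?nnegrE ?normr_ge0//.
by rewrite !ger0_norm// (le_trans u0).
Qed.

Lemma Lfun_modulus f : f \in L2fun -> modulus f \in Lfun (leb R) 2%:E.
Proof.
rewrite inE => -[mf ff]; rewrite inE; apply/andP; split; rewrite inE//=.
exact: measurable_modulus.
Qed.

Lemma normc_ge0 (z : R[i]) : 0 <= Normc.normc z.
Proof. by case: z => a b; exact: sqrtr_ge0. Qed.

Lemma normc_linear_le (a u v : R[i]) :
  Normc.normc (a * u + v) <= Normc.normc a * Normc.normc u + Normc.normc v.
Proof.
have := ler_normD (a * u) v; rewrite normrM.
by rewrite /Num.norm /= -rmorphM -rmorphD /= lecR.
Qed.

Lemma Re_linear (a u v : R[i]) : complex.Re (a * u + v) =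
  complex.Re a * complex.Re u - complex.Im a * complex.Im u + complex.Re v.
Proof. by case: a u v => ? ? [? ?] [? ?]. Qed.

Lemma Im_linear (a u v : R[i]) : complex.Im (a * u + v) =
  complex.Re a * complex.Im u + complex.Im a * complex.Re u + complex.Im v.
Proof. by case: a u v => ? ? [? ?] [? ?]. Qed.

Lemma L2fun_submod_closed : submod_closed L2fun.
Proof.
split.
  rewrite inE; split; first by split; exact: measurable_cst.
  rewrite (_ : modulus _ = cst 0); first by apply: finite_norm_cst0; rewrite lee1n.
  by apply/funext => x /=; rewrite expr0n addr0 sqrtr0.
move=> a f g L2f L2g.
have Lu : Normc.normc a *: (modulus f : R -> R) + modulus g \in Lfun (leb R) 2%:E.
  have [_ H] := Lfun_submod_closed (leb R) (lee1n 2).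
  have := H (Normc.normc a) _ _ (Lfun_modulus L2f) (Lfun_modulus L2g).
  by [].
have mu : measurable_fun [set: R] (Normc.normc a *: (modulus f : R -> R) + modulus g).
  by move: Lu; rewrite inE => /andP[/[!inE]].
move: L2f L2g; rewrite !inE => -[[mfr mfi] _] [[mgr mgi] _].
have mh : measurable_complex (a *: f + g).
  split.
    rewrite (_ : (fun x => _) = fun x => complex.Re a * complex.Re (f x) -
      complex.Im a * complex.Im (f x) + complex.Re (g x)).
      apply: measurable_funD => //; apply: measurable_funB; exact: measurable_funM.
    by apply/funext => x; exact: Re_linear.
  rewrite (_ : (fun x => _) = fun x => complex.Re a * complex.Im (f x) +
    complex.Im a * complex.Re (f x) + complex.Im (g x)).
    by apply: measurable_funD => //; apply: measurable_funD; exact: measurable_funM.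
  by apply/funext => x; exact: Im_linear.
split=> //; apply: (finite_norm_le _ mu); first exact: measurable_modulus.
  by move=> x; rewrite normc_ge0; exact: normc_linear_le.
by move: Lu; rewrite inE => /andP[_ /[!inE]].
Qed.

HB.instance Definition _ :=
  GRing.isSubmodClosed.Build R[i] (R -> R[i]) L2fun L2fun_submod_closed.

End SquareIntegrable.

Section L2space.
Context (R : realType).

(* [sqint] is the space of square-integrable functions, [L2] its quotient by
   the functions vanishing almost everywhere. Representatives are Borel
   measurable, which loses no class: a Lebesgue measurable function is almost
   everywhere equal to a Borel one. *)
Record sqint := SqInt { sqint_val :> R -> R[i]; _ : sqint_val \in L2fun }.

HB.instance Definition _ := [isSub for sqint_val].
HB.instance Definition _ := [Choice of sqint by <:].
HB.instance Definition _ := [SubChoice_isSubLmodule of sqint by <:].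

Definition null_sqint : {pred sqint} :=
  mem [set f : sqint | {ae leb R, forall x, f x = 0}].

Lemma null_sqint_submod_closed : submod_closed null_sqint.
Proof.
split; first by rewrite inE /=; exact: aeW.
move=> a f g; rewrite !inE /= => f0 g0.
have F := ae_filter_ringOfSetsType (leb R).
apply: (@filterS2 _ _ F _ _ _ _ f0 g0) => x fx gx.
by rewrite -[LHS]/(a * f x + g x) fx gx mulr0 addr0.
Qed.

HB.instance Definition _ :=
  GRing.isSubmodClosed.Build R[i] sqint null_sqint null_sqint_submod_closed.

Definition L2 : Type := Quotient.quot null_sqint.
HB.instance Definition _ := GRing.Zmodule.on L2.
HB.instance Definition _ := EqQuotient.on L2.

Definition L2scale (a : R[i]) : L2 -> L2 := lift_op1 L2 ( *:%R a).

Local Open Scope quotient_scope.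

Lemma pi_L2D (f g : sqint) : \pi_L2 (f + g) = \pi_L2 f + \pi_L2 g.
Proof. exact: Quotient.pi_add. Qed.

Lemma pi_L2scale a (f : sqint) : L2scale a (\pi_L2 f) = \pi_L2 (a *: f).
Proof.
unlock L2scale; apply/eqP; rewrite -Quotient.idealrBE -scalerBr.
by apply: rpredZ; rewrite Quotient.idealrBE reprK.
Qed.

Lemma L2scaleA a b (f : L2) : L2scale a (L2scale b f) = L2scale (a * b) f.
Proof. by rewrite -[f]reprK !pi_L2scale scalerA. Qed.

Lemma L2scale1 : left_id 1 L2scale.
Proof. by move=> f; rewrite -[f]reprK pi_L2scale scale1r. Qed.

Lemma L2scaleDr : right_distributive L2scale +%R.
Proof.
move=> a f g; rewrite -[f]reprK -[g]reprK.
by rewrite -pi_L2D !pi_L2scale scalerDr pi_L2D.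
Qed.

Lemma L2scaleDl (f : L2) : {morph L2scale^~ f : a b / a + b}.
Proof.
by move=> a b; rewrite -[f]reprK !pi_L2scale scalerDl pi_L2D.
Qed.

HB.instance Definition _ := GRing.Zmodule_isLmodule.Build R[i] L2
  L2scaleA L2scale1 L2scaleDr L2scaleDl.

Definition L2val (f : L2) : R -> R[i] := sqint_val (repr f).

(* The class of f, with default 0 when f is not square integrable. *)
Definition L2class (f : R -> R[i]) : L2 := \pi_L2 (insubd (0 : sqint) f).

Lemma L2valK (f : L2) : L2class (L2val f) = f.
Proof. by rewrite /L2class /L2val -[RHS]reprK valKd. Qed.

Lemma L2class_ae (f : R -> R[i]) :
  f \in L2fun -> {ae leb R, forall x, L2val (L2class f) x = f x}.
Proof.
move=> L2f.
have : repr (L2class f) - insubd (0 : sqint) f \in null_sqint.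
  by rewrite Quotient.idealrBE reprK.
rewrite inE /=; have F := ae_filter_ringOfSetsType (leb R).
apply: filterS => x /eqP.
rewrite -[X in X == _]/(L2val (L2class f) x - \val (insubd (0 : sqint) f) x).
by rewrite insubdK// subr_eq0 => /eqP.
Qed.

End L2space.
Coercion L2val : L2 >-> Funclass.

Section Operators.
Context {R : realType}.
Local Notation L2 := (L2 R).
Implicit Types (f g : L2) (A : L2 -> L2) (T : R -> L2 -> L2).

Definition cintegral (D : set R) (u : R -> R[i]) : R[i] :=
  (\int[leb R]_(x in D) complex.Re (u x))%R +i*
  (\int[leb R]_(x in D) complex.Im (u x))%R.

Definition L2norm f : R := fine (Lnorm (leb R) 2%:E (EFin \o modulus f)).

Definition L2inner f g : R[i] := cintegral setT (fun x => f x * (g x)^*).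

Definition expi (theta : R) : R[i] := cos theta +i* sin theta.

Definition fourier_trunc (n : nat) (u : R -> R[i]) (xi : R) : R[i] :=
  (Num.sqrt (2 * pi))^-1%:C *
  cintegral `[- n%:R, n%:R] (fun x => u x * expi (- (xi * x))).

(* The extension to L^2 is taken as the limit in mean of the integrals over
   [-n, n]; by Plancherel's theorem this limit exists for every f and is
   unique, so the default value of [xget] is never reached. *)
Definition is_fourier f g : Prop :=
  (\int[leb R]_xi ((Normc.normc (fourier_trunc n f xi - g xi)) ^+ 2)%:E)%E
    @[n --> \oo] --> 0%E.

Definition fourier f : L2 := xget 0 [set g | is_fourier f g].

(* Dilation: for lambda <> 0 the dilated function is square integrable, so the
   default value of [L2class] is not reached; the value at 0 is irrelevant. *)
Definition dilate (lambda : R) f : L2 :=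
  L2class (fun x => (`|lambda|^-1)%:C * f (x / lambda)).

Definition translate (a : R) f : L2 := L2class (fun x => f (x - a)).

Definition bounded_operator A : Prop :=
  linear A /\ exists M : R, forall f, L2norm (A f) <= M * L2norm f.

Definition dilate_op A (lambda : R) : L2 -> L2 :=
  dilate lambda \o A \o dilate lambda^-1.

Definition band_limited (r : R) : set L2 :=
  [set f | {ae leb R, forall xi, `|xi| < r^-1 \/ r < `|xi| ->
    fourier f xi = 0}].

Definition opnorm_on (V : set L2) A : \bar R :=
  ereal_sup [set (L2norm (A f))%:E | f in [set f | V f /\ L2norm f <= 1]].

Definition semistable A : Prop := exists a b : R,
  [/\ 0 < a, 0 < b, A \o A = dilate_op A a & A \o A \o A = dilate_op A b].

Definition translation_invariant A : Prop :=
  forall a : R, translate (- a) \o A \o translate a = A.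

Definition symmetric_op A : Prop := dilate_op A (-1) = A.

Definition LUC_under_dilation A : Prop :=
  forall r : R, 1 < r -> forall l0 : R, 0 < l0 ->
    opnorm_on (band_limited r) (dilate_op A l \- dilate_op A l0)
      @[l --> l0] --> 0%E.

Definition unitary A : Prop :=
  [/\ bounded_operator A,
      forall g, exists f, A f = g &
      forall f g, L2inner (A f) (A g) = L2inner f g].

Definition operator_group T : Prop :=
  [/\ forall t, bounded_operator (T t),
      T 0 = id &
      forall t1 t2, T (t1 + t2) = T t1 \o T t2].

(* Measurability with respect to the completed (Lebesgue) sigma-algebra. *)
Definition lebesgue_measurable_complex (u : R -> R[i]) : Prop :=
  let L := g_sigma_algebraType (completed_algebra_gen (leb R)) in
  measurable_fun [set: L] (fun t : L => complex.Re (u t)) /\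
  measurable_fun [set: L] (fun t : L => complex.Im (u t)).

Definition weakly_measurable T : Prop :=
  forall f g, lebesgue_measurable_complex (fun t => L2inner (T t f) g).

Definition has_phase A (alpha beta : R) : Prop :=
  forall f, {ae leb R, forall xi,
    fourier (A f) xi = expi (beta * `|xi| `^ alpha) * fourier f xi}.

(* [schrodinger_operator A a]: A is a Schroedinger operator and alpha(A) = a. *)
Definition schrodinger_operator A (a : R) : Prop :=
  unitary A /\ exists alpha beta : R,
    [/\ alpha != 0, has_phase A alpha beta &
        a = if `[< A = id >] then 0 else alpha].

Definition schrodinger_group T : Prop :=
  [/\ operator_group T,
      weakly_measurable T &
      forall t, [/\ unitary (T t), semistable (T t),
        translation_invariant (T t), symmetric_op (T t) &
        LUC_under_dilation (T t)]].

Definition group_of_order T (alpha : R) : Prop :=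
  schrodinger_operator (T 1) alpha.

End Operators.

(* Main.v *)
(* A unitary translation-invariant operator is a Fourier multiplier by some m with
   |m| = 1. Continuity under dilations makes m agree almost everywhere, for xi > 0,
   with a function of t = ln xi which is uniformly continuous on bounded sets; it
   lifts to exp (i theta t) with theta continuous. Semistability reads
   theta (t + ln a) = 2 theta t and theta (t + ln b) = 3 theta t modulo 2 pi, and
   since ln 2 and ln 3 are incommensurable this forces theta t = beta exp (alpha t)
   after adding a constant, that is m xi = exp (i beta |xi|^alpha).
   In the group, the products T(s) T(t) must be of the same form, so all the
   nontrivial T(t) share one exponent alpha0, and T(t) has phase
   beta(t) |xi|^alpha0 with beta additive; weak measurability makes beta measurable,
   hence beta(t) = t beta(1) with beta(1) != 0. The dilate of T(1) by t^(1/alpha)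
   has phase t^(alpha0/alpha) beta(1) |xi|^alpha0, so it equals T(t) if and only if
   t^(alpha0/alpha) = t, i.e. alpha0 = alpha unless t = 1. *)

From HB Require Import structures.
Require Import Defs.
From mathcomp Require Import all_boot all_order all_algebra complex.
From mathcomp Require Import all_classical all_reals all_analysis.
From mathcomp Require Import measurable_realfun.
From mathcomp Require Import ring lra.

Set Implicit Arguments.
Unset Strict Implicit.
Unset Printing Implicit Defensive.

Import Order.TTheory GRing.Theory Num.Theory.
Import numFieldNormedType.Exports.

Local Open Scope classical_set_scope.
Local Open Scope ring_scope.
Local Open Scope complex_scope.

(** [fourier] is only a chosen limit in mean, so Plancherel's theorem has to be proved before
    multipliers make sense. It rests on Abel summation with exp (- s |xi|), whose transform is the
    Poisson kernel. Pairing with indicators of intervals, whose Poisson integrals are differences of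
    arctangents, gives injectivity on L1 and unitarity on L2. For a single operator the obstacle is
    null sets: the estimate of m (l xi) - m xi holds off a set depending on l, and there are
    uncountably many l. It is transferred to the Lebesgue points of m, a fixed set of full measure.
    Equations modulo 2 pi become exact because two continuous lifts differ by a constant. The
    constant for a is absorbed into theta; the one for b then vanishes because the two substitutions
    commute. In the group, inner products show only a circle-valued function of beta (t). Testing
    near the frequency where |xi|^alpha0 = 1 / (k + 1) gives sin (beta (t) / (k + 1)); multiplied by
    k + 1 it tends to beta (t), so no branch of the argument is chosen. *)

Local Notation rL1 f := ((leb _).-integrable [set: _] (EFin \o f)).
Local Notation Re := complex.Re.
Local Notation Im := complex.Im.
Local Notation normc := (@Normc.normc _).

(** * Integrals of real and complex functions *)

Section RealIntegrals.
Context {R : realType}.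
Local Notation mu := (leb R).
Implicit Types f g p q : R -> R.

Lemma L1_measurable f : rL1 f -> measurable_fun [set: R] f.
Proof. by move=> /(measurable_int mu) /measurable_EFinP. Qed.

Lemma L1_le f g : measurable_fun [set: R] f -> (forall x, `|f x| <= g x) ->
  rL1 g -> rL1 f.
Proof.
move=> mf fg; apply: le_integrable => //; first exact/measurable_EFinP.
by move=> x _ /=; rewrite lee_fin (le_trans (fg x))// ler_norm.
Qed.

Lemma L1D f g : rL1 f -> rL1 g -> rL1 (fun x => f x + g x).
Proof. by move=> f1 g1; apply: (integrableD _ f1 g1). Qed.

Lemma L1N f : rL1 f -> rL1 (fun x => - f x).
Proof. by move=> f1; apply: (integrableN f1). Qed.

Lemma L1B f g : rL1 f -> rL1 g -> rL1 (fun x => f x - g x).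
Proof. by move=> f1 g1; apply: L1D => //; exact: L1N. Qed.

Lemma L1Z (k : R) f : rL1 f -> rL1 (fun x => k * f x).
Proof. by move=> f1; apply: (integrableZl _ k f1). Qed.

Lemma L1_norm f : rL1 f -> rL1 (fun x => `|f x|).
Proof. by move=> f1; apply: (integrable_norm f1). Qed.

Lemma L1M_bounded f g (M : R) : rL1 f -> measurable_fun [set: R] g ->
  (forall x, `|g x| <= M) -> rL1 (fun x => f x * g x).
Proof.
move=> f1 mg gM; apply: (@L1_le _ (fun x => M * `|f x|)).
- by apply: measurable_funM => //; exact: L1_measurable.
- by move=> x; rewrite normrM mulrC ler_wpM2r.
- by apply: L1Z; exact: L1_norm.
Qed.

Lemma ae_imp (P Q : R -> Prop) : (forall x, P x -> Q x) ->
  {ae mu, forall x, P x} -> {ae mu, forall x, Q x}.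
Proof.
by move=> PQ; apply: (@filterS _ _ (ae_filter_ringOfSetsType mu) P Q PQ).
Qed.

Lemma ae_imp2 (P Q S : R -> Prop) : (forall x, P x -> Q x -> S x) ->
  {ae mu, forall x, P x} -> {ae mu, forall x, Q x} -> {ae mu, forall x, S x}.
Proof.
by move=> PQ; apply: (@filterS2 _ _ (ae_filter_ringOfSetsType mu) P Q S PQ).
Qed.

Lemma ae_imp3 (P Q S U : R -> Prop) : (forall x, P x -> Q x -> S x -> U x) ->
  {ae mu, forall x, P x} -> {ae mu, forall x, Q x} -> {ae mu, forall x, S x} ->
  {ae mu, forall x, U x}.
Proof.
by move=> PQ; apply: (@filterS3 _ _ (ae_filter_ringOfSetsType mu) P Q S U PQ).
Qed.

Lemma Rint_dominated (f_ : nat -> R -> R) f g :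
  (forall n, measurable_fun [set: R] (f_ n)) -> measurable_fun [set: R] f ->
  {ae mu, forall x, f_ n x @[n --> \oo] --> f x} -> rL1 g ->
  (forall n x, `|f_ n x| <= g x) ->
  \int[mu]_x f_ n x @[n --> \oo] --> \int[mu]_x f x.
Proof.
move=> mf_ mf cv g1 le.
have mE n := (measurable_EFinP _ _).2 (mf_ n).
have mE' := (measurable_EFinP _ _).2 mf.
have cvE : {ae mu, forall x, [set: R] x -> (f_ n x)%:E @[n --> \oo] --> (f x)%:E}.
  by apply: ae_imp cv => x h _; apply: cvg_EFin => //; exact: nearW.
have leE : {ae mu, forall x, forall n, [set: R] x -> (`|(f_ n x)%:E| <= (g x)%:E)%E}.
  by apply: aeW => x n _; rewrite lee_fin.
have [i1 _ cvi] := @dominated_convergence _ _ _ mu _ measurableT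
  (fun n => EFin \o f_ n) (EFin \o f) (EFin \o g) mE mE' cvE g1 leE.
apply: fine_cvg.
rewrite /Rintegral fineK //; exact: integrable_fin_num.
Qed.

Lemma Rint_ae f g : measurable_fun [set: R] f -> measurable_fun [set: R] g ->
  {ae mu, forall x, f x = g x} -> \int[mu]_x f x = \int[mu]_x g x.
Proof.
move=> mf mg fg; congr fine; apply: ae_eq_integral => //; do ?exact/measurable_EFinP.
by apply: ae_imp fg => x /= ->.
Qed.

(** * Fubini's theorem against a bounded kernel *)

Section kernel.
Variables (p q : R -> R) (k : R * R -> R).
Hypotheses (p1 : rL1 p) (q1 : rL1 q).
Hypothesis mk : measurable_fun [set: R * R] k.
Hypothesis k1 : forall z, `|k z| <= 1.

Let mpq : measurable_fun [set: R * R] (fun z => p z.1 * (q z.2 * k z)).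
Proof.
apply: measurable_funM; first by apply: measurableT_comp => //; exact: L1_measurable.
by apply: measurable_funM => //; apply: measurableT_comp => //; exact: L1_measurable.
Qed.

Let ipq : (mu \x mu)%E.-integrable [set: R * R] (EFin \o (fun z => p z.1 * (q z.2 * k z))).
Proof.
apply/(integrable12ltyP mu mu _).2; first exact/measurable_EFinP.
apply: (@le_lt_trans _ _ (\int[mu]_x \int[mu]_y (`|p x|%:E * `|q y|%:E))%E).
  apply: ge0_le_integral => //.
  - by move=> x _; exact: integral_ge0.
  - apply: (@measurable_fun_fubini_tonelli_F _ _ _ _ _ mu
      (fun z => `|(p z.1 * (q z.2 * k z))%:E|)%E) => //.
    by apply/measurable_EFinP; exact: measurableT_comp.
  - apply: (@measurable_fun_fubini_tonelli_F _ _ _ _ _ mu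
      (fun z => `|p z.1|%:E * `|q z.2|%:E)%E) => //.
    apply/measurable_EFinP; apply: measurable_funM; apply: measurableT_comp => //;
      apply: measurableT_comp => //; exact: L1_measurable.
  move=> x _; apply: ge0_le_integral => //.
  - apply/measurable_EFinP; apply: measurableT_comp => //.
    by apply: (measurableT_comp mpq) => //; exact: measurable_pair1.
  - apply/measurable_EFinP; apply: measurable_funM => //.
    by apply: measurableT_comp => //; exact: L1_measurable.
  - move=> y _; rewrite lee_fin !normrM ler_wpM2l//.
    by rewrite -[leRHS]mulr1 ler_wpM2l.
under eq_integral => x _.
  rewrite ge0_integralZl//; last first.
    by apply/measurable_EFinP; apply: measurableT_comp => //; exact: L1_measurable.
  over.
rewrite ge0_integralZr//; last first.
- by apply: integral_ge0.
- by apply/measurable_EFinP; apply: measurableT_comp => //; exact: L1_measurable.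
have /integrableP[_] := p1; have /integrableP[_] := q1 => /= hq hp.
by rewrite lte_mul_pinfty// ?integral_ge0// ge0_fin_numE// integral_ge0.
Qed.

(** The integrand is dominated by |p x| |q y|. With cos (x y) or sin (x y) for [k], this is the
    source of the multiplication formula for the Fourier transform. *)
Lemma Rint_fubini_kernel :
  \int[mu]_x (p x * \int[mu]_y (q y * k (x, y))) =
  \int[mu]_y (q y * \int[mu]_x (p x * k (x, y))).
Proof.
have mk1 x : measurable_fun [set: R] (fun y => k (x, y)).
  by apply: (measurableT_comp mk); exact: measurable_pair1.
have mk2 y : measurable_fun [set: R] (fun x => k (x, y)).
  by apply: (measurableT_comp mk); exact: measurable_pair2.
have H := Fubini ipq.
rewrite /Rintegral; congr fine; transitivity (\int[mu]_x \int[mu]_y (p x * (q y * k (x, y)))%:E)%E.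
  apply: eq_integral => x _; rewrite EFinM fineK.
    rewrite -integralZl//; first exact: L1M_bounded q1 (mk1 x) (fun y => k1 (x, y)).
  by apply: integrable_fin_num => //; exact: L1M_bounded q1 (mk1 x) (fun y => k1 (x, y)).
rewrite [LHS]H; apply: eq_integral => y _; rewrite EFinM fineK.
  rewrite -integralZl//; first by apply: eq_integral => x _; rewrite -EFinM /= mulrCA.
  exact: L1M_bounded p1 (mk2 y) (fun x => k1 (x, y)).
by apply: integrable_fin_num => //; exact: L1M_bounded p1 (mk2 y) (fun x => k1 (x, y)).
Qed.

Lemma measurable_Rint_kernel :
  measurable_fun [set: R] (fun x => \int[mu]_y (q y * k (x, y))).
Proof.
pose h z := (q z.2 * k z)%:E.
have mh : measurable_fun [set: R * R] h.
  apply/measurable_EFinP; apply: measurable_funM => //.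
  by apply: measurableT_comp => //; exact: L1_measurable.
(* The measurability part of Tonelli's theorem concerns nonnegative functions, hence the splitting
   into positive and negative parts. *)
rewrite (_ : (fun x => _) = fine \o (fun x =>
    \int[mu]_y (h^\+ (x, y)) - \int[mu]_y (h^\- (x, y)))%E); last first.
  apply/funext => x; rewrite /Rintegral integralE /=; congr (fine (_ - _)%E); by apply: eq_integral => y _; rewrite ?funeposE ?funenegE.
apply: (measurableT_comp (@fine_measurable R setT measurableT)); apply: emeasurable_funB.
  by apply: (measurable_fun_fubini_tonelli_F (m2 := mu) h^\+%E) => //; exact: measurable_funepos.
by apply: (measurable_fun_fubini_tonelli_F (m2 := mu) h^\-%E) => //; exact: measurable_funeneg.
Qed.

End kernel.

(** * Affine changes of variable *)

Section affine.
Variables (a b : R).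
Hypothesis a0 : a != 0.
Let phi : R -> measurableTypeR R := fun x => a * x + b.

Let mphi : measurable_fun [set: measurableTypeR R] phi.
Proof. by apply: measurable_funD => //; exact: measurable_funM. Qed.

Let nu : {measure set (measurableTypeR R) -> \bar R} :=
  measure_function_pushforward__canonical__measure_function_Measure mu mphi.

Lemma measurable_affine_preimage (A : set R) :
  measurable A -> measurable ((fun x => a * x + b) @^-1` A).
Proof. by move=> mA; rewrite -[X in measurable X]setTI; exact: mphi. Qed.

(** Both sides are measures in A, so uniqueness of Lebesgue measure reduces the claim to intervals
    ]c, d]. Their preimages are intervals, with the ends exchanged when a < 0. *)
Lemma leb_affine (A : set R) : measurable A ->
  mu A = (`|a|%:E * mu ((fun x => (a * x + b)%R) @^-1` A))%E.
Proof.
move=> mA.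
have a0' : (0 <= `|a|)%R by [].
rewrite (@lebesgue_measure_unique _
   (mscale (NngNum a0') nu))//.
move=> _ [[c d]] _ <-.
rewrite -[RHS]/(`|a|%:E * mu (phi @^-1` `]c, d]))%E.
rewrite lebesgue_measure_itv/= lte_fin.
have [an|ap] := ltP a 0.
  rewrite [X in mu X](_ : _ = `[(d - b) / a, (c - b) / a[%classic); last first.
    apply/seteqP; split => x; rewrite /phi /= !in_itv/= => /andP[h1 h2]; apply/andP; split.
    - by rewrite ler_ndivrMr// mulrC; lra.
    - by rewrite ltr_ndivlMr// mulrC; lra.
    - by move: h2; rewrite ltr_ndivlMr// mulrC; lra.
    - by move: h1; rewrite ler_ndivrMr// mulrC; lra.
  rewrite lebesgue_measure_itv/= lte_fin ltr_ndivrMr//.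
  have -> : ((c - b) / a * a < d - b) = (c < d) by rewrite mulfVK//; lra.
  case: ifP => cd; last by rewrite mule0.
  rewrite -!EFinB -EFinM ltr0_norm//; congr EFin; field; lra.
have {}ap : 0 < a by rewrite lt_neqAle eq_sym a0.
rewrite [X in mu X](_ : _ = `](c - b) / a, (d - b) / a]%classic); last first.
  apply/seteqP; split => x; rewrite /phi /= !in_itv/= => /andP[h1 h2]; apply/andP; split.
  - by rewrite ltr_pdivrMr// mulrC; lra.
  - by rewrite ler_pdivlMr// mulrC; lra.
  - by move: h1; rewrite ltr_pdivrMr// mulrC; lra.
  - by move: h2; rewrite ler_pdivlMr// mulrC; lra.
rewrite lebesgue_measure_itv/= lte_fin ltr_pdivrMr//.
have -> : (c - b < (d - b) / a * a) = (c < d) by rewrite mulfVK//; lra.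
case: ifP => cd; last by rewrite mule0.
rewrite -!EFinB -EFinM gtr0_norm//; congr EFin; field; lra.
Qed.

Lemma ge0_integral_affine (f : R -> \bar R) : measurable_fun [set: R] f ->
  (forall x, (0 <= f x)%E) ->
  (\int[mu]_x f x = `|a|%:E * \int[mu]_x f (a * x + b)%R)%E.
Proof.
move=> mf f0.
have a0' : (0 <= `|a|)%R by [].
transitivity (\int[mscale (NngNum a0') nu]_x f x)%E.
  by apply: eq_measure_integral => A mA _; exact: leb_affine.
rewrite (ge0_integral_mscale _ measurableT)//.
by congr (_ * _)%E; rewrite (ge0_integral_pushforward mphi).
Qed.

Lemma ae_affine (P : R -> Prop) :
  {ae mu, forall x, P x} -> {ae mu, forall x, P (a * x + b)}.
Proof.
move=> [N [mN N0 PN]]; exists ((fun x => a * x + b) @^-1` N); split.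
- exact: measurable_affine_preimage.
- apply/eqP; move/eqP: N0; rewrite leb_affine// mule_eq0 => /predU1P[|//].
  by move=> /eqP; rewrite eqe normr_eq0 (negbTE a0).
- by move=> x /=; exact: PN.
Qed.

Lemma measurable_affine (f : R -> R) : measurable_fun [set: R] f ->
  measurable_fun [set: R] (fun x => f (a * x + b)).
Proof. by move=> mf; apply: (measurableT_comp mf). Qed.

Lemma L1_affine f : rL1 f -> rL1 (fun x => f (a * x + b)).
Proof.
move=> /integrableP[mf fi]; have mf' := (measurable_EFinP _ _).1 mf.
apply/integrableP; split.
  by apply/measurable_EFinP; exact: measurable_affine.
move: fi; rewrite ge0_integral_affine//; last exact: measurableT_comp.
rewrite !ltey; apply: contra => /eqP /= ->.
by rewrite gt0_muley// lte_fin normr_gt0.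
Qed.

Lemma Rint_affine f : rL1 f ->
  \int[mu]_x f x = `|a| * \int[mu]_x f (a * x + b).
Proof.
move=> f1; have f1' := L1_affine f1.
have mf : measurable_fun [set: R] (EFin \o f) by exact: measurable_int f1.
rewrite /Rintegral -[X in X * _]/(fine `|a|%:E) -fineM//; last exact: integrable_fin_num.
congr fine; rewrite integralE [in RHS]integralE.
rewrite muleBr//; last first.
  rewrite fin_num_adde_defr//; exact: integrable_pos_fin_num.
congr (_ - _)%E.
  rewrite (@ge0_integral_affine (EFin \o f)^\+%E)//; last exact: measurable_funepos.
  by congr (_ * _)%E; apply: eq_integral => x _; rewrite !funeposE.
rewrite (@ge0_integral_affine (EFin \o f)^\-%E)//; last exact: measurable_funeneg.
by congr (_ * _)%E; apply: eq_integral => x _; rewrite !funenegE.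
Qed.

End affine.

(** * Lebesgue points *)

Section averages.
Lemma locally_integrable_itv f (a b : R) : locally_integrable [set: R] f ->
  mu.-integrable `[a, b] (EFin \o f).
Proof.
move=> [mf _ fK]; apply/integrableP; split.
  by apply/measurable_EFinP; exact: measurable_funTS.
by apply: fK => //; exact: segment_compact.
Qed.

Lemma bounded_locally_integrable f (M : R) : measurable_fun [set: R] f ->
  (forall x, `|f x| <= M) -> locally_integrable [set: R] f.
Proof.
move=> mf fM; split=> //; first exact: openT.
move=> K _ cK.
have mK : measurable K by exact: compact_measurable.
apply: (@le_lt_trans _ _ (\int[mu]_(x in K) M%:E)%E).
  apply: ge0_le_integral => //; first by apply/measurable_EFinP; apply: measurable_funTS; exact: measurableT_comp.
  by move=> x _; rewrite lee_fin.
rewrite integral_cst//.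
have M0 : 0 <= M by apply: le_trans (fM 0).
by rewrite lte_mul_pinfty// ?lee_fin// compact_finite_measure.
Qed.

Lemma L1_locally_integrable f : rL1 f -> locally_integrable [set: R] f.
Proof.
move=> f1; split; [exact: L1_measurable|exact: openT|].
move=> K _ cK; have /integrableP[mf] := f1; apply: le_lt_trans.
apply: ge0_subset_integral => //; first exact: compact_measurable.
by apply/measurable_EFinP; apply: measurableT_comp => //; exact: L1_measurable.
Qed.

(** Open balls are replaced by closed intervals, whose ends are null, and the absolute value moves
    outside the integral. Multiplied by the length 2 * r, the bound can be combined with changes of
    variable without dividing. *)
Lemma lebesgue_pt_average f x : locally_integrable [set: R] f -> lebesgue_pt f x ->
  forall e, 0 < e -> exists2 d, 0 < d & forall r, 0 < r < d ->
    `|\int[mu]_(y in `[x - r, x + r]) f y - 2 * r * f x| <= 2 * r * e.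
Proof.
move=> fl /fine_cvgP[[d1 /= d10 fin1]] /cvgrPdist_le/= cv e e0.
have [d2 /= d20 H2] := cv _ e0.
exists (Num.min d1 d2); first by rewrite lt_min d10.
move=> r /andP[r0]; rewrite lt_min => /andP[rd1 rd2].
have rr1 : `|0 - r| < d1 by rewrite sub0r normrN gtr0_norm.
have rr2 : `|0 - r| < d2 by rewrite sub0r normrN gtr0_norm.
have := H2 r rr2 r0; have := fin1 r rr1 r0.
have fi := locally_integrable_itv (x - r) (x + r) fl.
have fio : mu.-integrable `]x - r, x + r[ (EFin \o f).
  by apply: integrableS fi => //; exact: subset_itv_oo_cc.
have ci : mu.-integrable `]x - r, x + r[ (EFin \o (fun=> f x)).
  apply: measurable_bounded_integrable => //.
    by rewrite /= lebesgue_measure_itv/= lte_fin; case: ifP => _; rewrite ltry.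
  by exists `|f x|; split => // M fM y _ /=; exact: ltW.
rewrite /davg /iavg ball_itv.
set I := (X in (_ * X)%E).
have mI : mu `]x - r, x + r[%classic = (2 * r)%:E.
  rewrite lebesgue_measure_itv/= lte_fin ifT; last by lra.
  by rewrite -EFinB; congr EFin; lra.
have r2 : 2 * r != 0 by lra.
rewrite mI inver (negbTE r2) => Ifin le.
have Iint : I = (\int[mu]_(y in `]x - r, x + r[) `|f y - f x|)%:E.
  rewrite /Rintegral /I fineK//.
  apply: integrable_fin_num => //.
  by apply: integrable_norm; apply: (integrableB _ fio ci).
move: le; rewrite Iint -EFinM /= sub0r normrN => le.
rewrite -Rintegral_itv_obnd_cbnd; last first.
  by apply: integrableS fi => //; exact: subset_itv_oc_cc.
rewrite -Rintegral_itv_bndo_bndc//.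
have -> : 2 * r * f x = \int[mu]_(y in `]x - r, x + r[) (fun=> f x) y.
  by rewrite Rintegral_cst//= mI /= mulrC.
rewrite -RintegralB//.
apply: le_trans (le_normr_Rintegral _ (integrableB _ fio ci)) _ => //.
rewrite -ler_pdivrMl; last by lra.
by apply: le_trans le; exact: ler_norm.
Qed.

(** At a Lebesgue point the value is the limit of averages over intervals, all of which vanish. *)
Lemma ae0_of_intervals f : locally_integrable [set: R] f ->
  (forall a b, a < b -> \int[mu]_(x in `[a, b]) f x = 0) ->
  {ae mu, forall x, f x = 0}.
Proof.
move=> fl f0; apply: ae_imp (lebesgue_differentiation fl) => x fx.
apply/eqP; rewrite -normr_eq0 eq_le normr_ge0 andbT.
apply/ler_addgt0Pr => e e0; rewrite add0r.
have [d d0 /(_ (d / 2))] := lebesgue_pt_average fl fx e0.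
have d20 : 0 < d / 2 by rewrite divr_gt0.
rewrite d20 f0; last by lra.
rewrite sub0r normrN normrM ger0_norm; last by lra.
by rewrite ler_pM2l; [apply; lra|lra].
Qed.

End averages.
End RealIntegrals.

(** * Complex-valued integrals *)

Section ComplexIntegrals.
Context {R : realType}.
Local Notation mu := (leb R).
Implicit Types (u v w : R -> R[i]) (z : R[i]).

Lemma cplx_ext z (z' : R[i]) : Re z = Re z' -> Im z = Im z' -> z = z'.
Proof. by case: z z' => [a b] [c d] /= -> ->. Qed.

Lemma cReM z (z' : R[i]) : Re (z * z') = Re z * Re z' - Im z * Im z'.
Proof. by case: z z' => [a b] [c d]. Qed.
Lemma cImM z (z' : R[i]) : Im (z * z') = Re z * Im z' + Im z * Re z'.
Proof. by case: z z' => [a b] [c d]. Qed.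
Lemma cReD z (z' : R[i]) : Re (z + z') = Re z + Re z'.
Proof. by case: z z' => [a b] [c d]. Qed.
Lemma cImD z (z' : R[i]) : Im (z + z') = Im z + Im z'.
Proof. by case: z z' => [a b] [c d]. Qed.
Lemma cReN z : Re (- z) = - Re z. Proof. by case: z. Qed.
Lemma cImN z : Im (- z) = - Im z. Proof. by case: z. Qed.
Lemma cReJ z : Re (conjc z) = Re z. Proof. by case: z. Qed.
Lemma cImJ z : Im (conjc z) = - Im z. Proof. by case: z. Qed.
Lemma cReC (x : R) : Re x%:C = x. Proof. by []. Qed.
Lemma cImC (x : R) : Im x%:C = 0. Proof. by []. Qed.
Lemma Re_expi (t : R) : Re (expi t) = cos t. Proof. by []. Qed.
Lemma Im_expi (t : R) : Im (expi t) = sin t. Proof. by []. Qed.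
Definition ReImE := (cReM, cImM, cReD, cImD, cReN, cImN, cReJ, cImJ).
Definition ReImV := (cReC, cImC, Re_expi, Im_expi).

Lemma sqr_normcE z : normc z ^+ 2 = Re z ^+ 2 + Im z ^+ 2.
Proof. by case: z => a b /=; rewrite sqr_sqrtr// addr_ge0 ?sqr_ge0. Qed.

Lemma normc_Re z : `|Re z| <= normc z.
Proof.
rewrite -(ler_pXn2r (n := 2)) ?nnegrE ?normc_ge0 ?normr_ge0//.
by rewrite sqr_normcE real_normK ?num_real// lerDl sqr_ge0.
Qed.

Lemma normc_Im z : `|Im z| <= normc z.
Proof.
rewrite -(ler_pXn2r (n := 2)) ?nnegrE ?normc_ge0 ?normr_ge0//.
by rewrite sqr_normcE real_normK ?num_real// lerDr sqr_ge0.
Qed.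

Lemma normc_ReIm z : normc z <= `|Re z| + `|Im z|.
Proof.
rewrite -(ler_pXn2r (n := 2)) ?nnegrE ?normc_ge0 ?addr_ge0 ?normr_ge0//.
rewrite sqr_normcE sqrrD !real_normK ?num_real// lerD2r.
by rewrite lerDl mulrn_wge0 // mulr_ge0.
Qed.

Lemma cnormJ z : normc (conjc z) = normc z.
Proof. by case: z => a b /=; rewrite sqrrN. Qed.

Lemma normc_expi (t : R) : normc (expi t) = 1.
Proof. by rewrite /= cos2Dsin2 sqrtr1. Qed.

Lemma normc_real (x : R) : normc x%:C = `|x|.
Proof. by rewrite /= expr0n addr0 sqrtr_sqr. Qed.

Lemma cnormM z (z' : R[i]) : normc (z * z') = normc z * normc z'.
Proof. exact: Normc.normcM. Qed.

Lemma cnormN z : normc (- z) = normc z.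
Proof. by case: z => a b /=; rewrite !sqrrN. Qed.

Lemma normcD_le z (z' : R[i]) : normc (z + z') <= normc z + normc z'.
Proof. exact: le_normcD. Qed.

Lemma normc_sqr_real z : (z * conjc z) = (normc z ^+ 2)%:C.
Proof. by rewrite sqr_normcE; apply: cplx_ext; rewrite !ReImE !ReImV; ring. Qed.

Lemma cJM z (z' : R[i]) : conjc (z * z') = conjc z * conjc z'.
Proof. exact: (rmorphM conjc). Qed.
Lemma cJD z (z' : R[i]) : conjc (z + z') = conjc z + conjc z'.
Proof. exact: (rmorphD conjc). Qed.
Lemma cJB z (z' : R[i]) : conjc (z - z') = conjc z - conjc z'.
Proof. exact: (rmorphB conjc). Qed.
Lemma cJK z : conjc (conjc z) = z.
Proof. exact: conjcK. Qed.

Lemma normc0_eq0 z : normc z = 0 -> z = 0.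
Proof. exact: Normc.eq0_normc. Qed.

Lemma expiD (s t : R) : expi (s + t) = expi s * expi t.
Proof. by apply: cplx_ext; rewrite !ReImE !ReImV ?cosD ?sinD; ring. Qed.

Lemma expiN (t : R) : expi (- t) = conjc (expi t).
Proof. by apply: cplx_ext; rewrite !ReImE !ReImV ?cosN ?sinN. Qed.

Lemma expi0 : expi 0 = 1 :> R[i].
Proof. by rewrite /expi cos0 sin0. Qed.

Lemma mcpx_M u v : measurable_complex u -> measurable_complex v ->
  measurable_complex (fun x => u x * v x).
Proof.
move=> [ur ui] [vr vi]; split.
  under eq_fun do rewrite cReM.
  by apply: measurable_funB; exact: measurable_funM.
under eq_fun do rewrite cImM.
by apply: measurable_funD; exact: measurable_funM.
Qed.

Lemma mcpx_B u v : measurable_complex u -> measurable_complex v ->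
  measurable_complex (fun x => u x - v x).
Proof.
move=> [ur ui] [vr vi]; split.
  under eq_fun do rewrite cReD cReN.
  exact: measurable_funB.
under eq_fun do rewrite cImD cImN.
exact: measurable_funB.
Qed.

Lemma mcpx_J u : measurable_complex u -> measurable_complex (fun x => conjc (u x)).
Proof.
move=> [ur ui]; split.
  by under eq_fun do rewrite cReJ.
under eq_fun do rewrite cImJ.
exact: measurableT_comp.
Qed.

Lemma mcpx_cst z : measurable_complex (fun _ : R => z).
Proof. by split; exact: measurable_cst. Qed.

Lemma mcpx_real (f : R -> R) : measurable_fun [set: R] f ->
  measurable_complex (fun x => (f x)%:C).
Proof. by move=> mf; split => //=; exact: measurable_cst. Qed.

Lemma mcpx_expi (f : R -> R) : measurable_fun [set: R] f ->
  measurable_complex (fun x => expi (f x)).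
Proof.
move=> mf; split => /=.
  apply: (measurableT_comp (f := @cos R)) => //.
  by apply: continuous_measurable_fun; exact: continuous_cos.
apply: (measurableT_comp (f := @sin R)) => //.
by apply: continuous_measurable_fun; exact: continuous_sin.
Qed.

Definition cL1 u := rL1 (fun x => Re (u x)) /\ rL1 (fun x => Im (u x)).

Definition cint u : R[i] := cintegral setT u.

Lemma Re_cint u : Re (cint u) = \int[mu]_x Re (u x).
Proof. by []. Qed.
Lemma Im_cint u : Im (cint u) = \int[mu]_x Im (u x).
Proof. by []. Qed.

Lemma cL1_mcpx u : cL1 u -> measurable_complex u.
Proof. by move=> [u1 u2]; split; exact: L1_measurable. Qed.

Lemma cL1_le u (g : R -> R) : measurable_complex u ->
  (forall x, normc (u x) <= g x) -> rL1 g -> cL1 u.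
Proof.
move=> [mr mi] ug g1; split; apply: L1_le g1 => // x.
  exact: le_trans (normc_Re _) (ug x).
exact: le_trans (normc_Im _) (ug x).
Qed.

Lemma L1_modulus u : cL1 u -> rL1 (modulus u).
Proof.
move=> /[dup] /cL1_mcpx mu' [u1 u2].
apply: (@L1_le _ _ (fun x => `|Re (u x)| + `|Im (u x)|)).
- exact: measurable_modulus.
- by move=> x; rewrite ger0_norm ?normc_ge0// normc_ReIm.
- by apply: L1D; exact: L1_norm.
Qed.

Lemma cL1M_bounded u v (M : R) : cL1 u -> measurable_complex v ->
  (forall x, normc (v x) <= M) -> cL1 (fun x => u x * v x).
Proof.
move=> u1 mv vM; apply: (@cL1_le _ (fun x => M * normc (u x))).
- by apply: mcpx_M => //; exact: cL1_mcpx.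
- by move=> x; rewrite cnormM mulrC ler_wpM2r// normc_ge0.
- by apply: L1Z; exact: L1_modulus.
Qed.

Lemma cL1D u v : cL1 u -> cL1 v -> cL1 (fun x => u x + v x).
Proof.
move=> [u1 u2] [v1 v2]; split.
  under eq_fun do rewrite cReD.
  exact: L1D.
under eq_fun do rewrite cImD.
exact: L1D.
Qed.

Lemma cL1Z z u : cL1 u -> cL1 (fun x => z * u x).
Proof.
move=> u1; under eq_fun do rewrite mulrC.
apply: (@cL1M_bounded _ _ (normc z)) => //; exact: mcpx_cst.
Qed.

Lemma cL1J u : cL1 u -> cL1 (fun x => conjc (u x)).
Proof.
move=> [u1 u2]; split.
  by under eq_fun do rewrite cReJ.
by under eq_fun do rewrite cImJ; exact: L1N.
Qed.

Lemma cL1_real (f : R -> R) : rL1 f -> cL1 (fun x => (f x)%:C).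
Proof. by move=> f1; split => //=; exact: integrable0. Qed.

Lemma cintD u v : cL1 u -> cL1 v -> cint (fun x => u x + v x) = cint u + cint v.
Proof.
move=> [u1 u2] [v1 v2]; apply: cplx_ext; rewrite !ReImE !(Re_cint, Im_cint).
  by rewrite -RintegralD//; apply: eq_Rintegral => x _; rewrite cReD.
by rewrite -RintegralD//; apply: eq_Rintegral => x _; rewrite cImD.
Qed.

Lemma cintZ z u : cL1 u -> cint (fun x => z * u x) = z * cint u.
Proof.
move=> [u1 u2]; apply: cplx_ext; rewrite !ReImE !(Re_cint, Im_cint).
  rewrite -!RintegralZl//; rewrite -RintegralB//; [|exact: L1Z..].
  by apply: eq_Rintegral => x _; rewrite cReM.
rewrite -!RintegralZl//; rewrite -RintegralD//; [|exact: L1Z..].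
by apply: eq_Rintegral => x _; rewrite cImM.
Qed.

Lemma cintJ u : cL1 u -> cint (fun x => conjc (u x)) = conjc (cint u).
Proof.
move=> [u1 u2]; apply: cplx_ext; rewrite !ReImE !(Re_cint, Im_cint).
  by apply: eq_Rintegral => x _; rewrite cReJ.
rewrite -mulN1r -RintegralZl//.
by apply: eq_Rintegral => x _; rewrite cImJ mulN1r.
Qed.

Lemma cint_real (f : R -> R) : cint (fun x => (f x)%:C) = (\int[mu]_x f x)%:C.
Proof.
apply: cplx_ext; rewrite !(Re_cint, Im_cint)//=.
by rewrite /Rintegral (eq_integral (cst 0%E)) ?integral0.
Qed.

(** Multiplying by the conjugate of w = [cint u] turns the integral into the real number |w|^2, and
    the real part of conj w * u is at most |w| |u|. *)
Lemma normc_cint u : cL1 u -> normc (cint u) <= \int[mu]_x normc (u x).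
Proof.
move=> u1; have [->|z0] := eqVneq (cint u) 0.
  by rewrite Normc.normc0; apply: Rintegral_ge0 => x _; exact: normc_ge0.
have n0 : 0 < normc (cint u).
  by rewrite lt_neqAle normc_ge0 andbT eq_sym; apply: contraNneq z0 => /normc0_eq0 ->.
rewrite -(ler_pM2l n0) -expr2.
have -> : normc (cint u) ^+ 2 = Re (cint (fun x => conjc (cint u) * u x)).
  by rewrite cintZ// mulrC normc_sqr_real.
rewrite Re_cint -RintegralZl//; last exact: L1_modulus.
apply: le_Rintegral => //.
- by have [] := cL1Z (conjc (cint u)) u1.
- by apply: L1Z; exact: L1_modulus.
- move=> x _; apply: le_trans (ler_norm _) _; apply: le_trans (normc_Re _) _.
  by rewrite cnormM cnormJ.
Qed.

Lemma cint_ae u v : measurable_complex u -> measurable_complex v ->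
  {ae mu, forall x, u x = v x} -> cint u = cint v.
Proof.
move=> [ur ui] [vr vi] uv; apply: cplx_ext; rewrite !(Re_cint, Im_cint).
  by apply: Rint_ae => //; apply: ae_imp uv => x ->.
by apply: Rint_ae => //; apply: ae_imp uv => x ->.
Qed.

Lemma cint_dominated (u_ : nat -> R -> R[i]) u (g : R -> R) :
  (forall n, measurable_complex (u_ n)) -> measurable_complex u ->
  {ae mu, forall x, normc (u_ n x - u x) @[n --> \oo] --> 0} -> rL1 g ->
  (forall n x, normc (u_ n x) <= g x) ->
  Re (cint (u_ n)) @[n --> \oo] --> Re (cint u) /\
  Im (cint (u_ n)) @[n --> \oo] --> Im (cint u).
Proof.
move=> mu_ [mr mi] cv g1 le; split.
  apply: (@Rint_dominated _ (fun n x => Re (u_ n x)) _ g) => //.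
  - by move=> n; case: (mu_ n).
  - apply: ae_imp cv => x cv; apply/cvgrPdist_le => e e0.
    move/cvgrPdist_le: cv => /(_ e e0); apply: filterS => n.
    rewrite sub0r normrN distrC; apply: le_trans.
    rewrite -cReN -cReD; apply: le_trans (normc_Re _) _; exact: ler_norm.
  - by move=> n x; exact: le_trans (normc_Re _) (le n x).
apply: (@Rint_dominated _ (fun n x => Im (u_ n x)) _ g) => //.
- by move=> n; case: (mu_ n).
- apply: ae_imp cv => x cv; apply/cvgrPdist_le => e e0.
  move/cvgrPdist_le: cv => /(_ e e0); apply: filterS => n.
  rewrite sub0r normrN distrC; apply: le_trans.
  rewrite -cImN -cImD; apply: le_trans (normc_Im _) _; exact: ler_norm.
- by move=> n x; exact: le_trans (normc_Im _) (le n x).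
Qed.

End ComplexIntegrals.

(** * The Fourier transform on L1 *)

Section Kernels.
Context {R : realType}.
Local Notation mu := (leb R).

Section lambda_derivatives.
Variables (x : R).
Implicit Types (f g : R -> R) (a b c : R).

Lemma deriv_cst c : is_derive x (1 : R) (fun=> c) (0 : R).
Proof. exact: is_derive_cst. Qed.

Lemma deriv_id : is_derive x (1 : R) (fun y => y) (1 : R).
Proof. exact: is_derive_id. Qed.

Lemma derivD f g a b : is_derive x 1 f a -> is_derive x 1 g b ->
  is_derive x 1 (fun y => f y + g y) (a + b).
Proof. by move=> df dg; apply: (is_deriveD (f := f) (g := g)). Qed.

Lemma derivN f a : is_derive x 1 f a -> is_derive x 1 (fun y => - f y) (- a).
Proof. by move=> df; apply: (is_deriveN (f := f)). Qed.

Lemma derivM f g a b : is_derive x 1 f a -> is_derive x 1 g b ->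
  is_derive x 1 (fun y => f y * g y) (a * g x + f x * b).
Proof.
move=> df dg; apply: (is_derive_eq (is_deriveM df dg)).
by rewrite addrC; congr (_ + _); exact: mulrC.
Qed.

Lemma derivZ c f a : is_derive x 1 f a -> is_derive x 1 (fun y => c * f y) (c * a).
Proof.
move=> df; apply: (is_derive_eq (derivM (deriv_cst c) df)).
by rewrite mul0r add0r.
Qed.

Lemma deriv_comp f g a b : is_derive (g x) 1 f a -> is_derive x 1 g b ->
  is_derive x 1 (fun y => f (g y)) (a * b).
Proof. by move=> df dg; apply: (is_derive1_comp (f := f) (g := g)). Qed.

End lambda_derivatives.

Lemma is_derive_continuous (F f : R -> R) :
  (forall x : R, is_derive x (1 : R) F (f x)) -> continuous F.
Proof.
move=> dF x; apply: differentiable_continuous; apply/derivable1_diffP.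
by have [] := dF x.
Qed.

Lemma Rint_FTC (f F : R -> R) (a b : R) : a < b -> continuous f ->
  (forall x : R, is_derive x (1 : R) F (f x)) ->
  \int[mu]_(x in `[a, b]) f x = F b - F a.
Proof.
move=> ab cf dF; have cF := is_derive_continuous dF.
rewrite /Rintegral (continuous_FTC2 (F := F))//.
- exact: continuous_subspaceT.
- split; first by move=> x _; have [] := dF x.
  + by apply: cvg_at_right_filter; exact: cF.
  + by apply: cvg_at_left_filter; exact: cF.
- by move=> x _; rewrite derive1E; exact: derive_val.
Qed.

(** Evenness reduces the integral to [0, +oo[, where f may be replaced by g: for exp (- s |x|), the
    expression without absolute value is the one with a primitive differentiable on the whole
    line. *)
Lemma integral_even_FTC (f g F : R -> R) (l : R) :
  (forall x, 0 <= f x) -> continuous f -> (forall x, f (- x) = f x) ->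
  (forall x, 0 <= x -> f x = g x) ->
  (forall x : R, is_derive x (1 : R) F (g x)) -> F x @[x --> +oo] --> l ->
  (\int[mu]_x (f x)%:E = (2 * (l - F 0))%:E)%E.
Proof.
move=> f0 cf ev fg dF Fl; have cF := is_derive_continuous dF.
rewrite ge0_symfun_integralT//; last by move=> x /=; rewrite ev.
rewrite -set_itvcy (ge0_continuous_FTC2y (F := F) (l := l))//.
- exact: continuous_subspaceT.
- by apply: cvg_at_right_filter; exact: cF.
- move=> x; rewrite in_itv/= andbT => x0.
  by rewrite derive1E fg ?(ltW x0)//; exact: derive_val.
Qed.

(** The Abel summation factor and its unnormalised Fourier transform, which is 2 pi times the
    Poisson kernel. Their primitives are elementary: an exponential on each half-line, and an
    arctangent. *)
Definition expabs (s x : R) : R := expR (- (s * `|x|)).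
Definition poisson (s x : R) : R := 2 * s / (s ^+ 2 + x ^+ 2).

Section fixed_s.
Variable s : R.
Hypothesis s0 : 0 < s.

Lemma expabs_ge0 x : 0 <= expabs s x. Proof. exact: expR_ge0. Qed.
Lemma expabs_gt0 x : 0 < expabs s x. Proof. exact: expR_gt0. Qed.
Lemma expabs_le1 x : expabs s x <= 1.
Proof. by rewrite -expR0 ler_expR oppr_le0 mulr_ge0// ltW. Qed.

Lemma continuous_expabs : continuous (expabs s).
Proof.
move=> x; rewrite /expabs; apply: continuous_comp; last exact: continuous_expR.
by apply: cvgN; apply: cvgM; [exact: cvg_cst|exact: norm_continuous].
Qed.

Lemma measurable_expabs : measurable_fun [set: R] (expabs s).
Proof. by apply: continuous_measurable_fun; exact: continuous_expabs. Qed.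

Lemma cvg_expR_scale : expR (- (s * x)) @[x --> +oo] --> 0.
Proof.
have H : (s * x) @[x --> +oo] --> +oo by apply: gt0_cvgMry => //; exact: cvg_id.
exact: (cvg_comp _ _ H (@cvgr_expR R)).
Qed.

Let dexpR (x : R) : is_derive x (1 : R) (fun x => expR (- (s * x))) (expR (- (s * x)) * - (s * 1)).
Proof. exact: deriv_comp (is_derive_expR _) (derivN (derivZ s (deriv_id x))). Qed.

Let dprimitive (x : R) :
  is_derive x (1 : R) (fun x => - expR (- (s * x)) / s) (expR (- (s * x))).
Proof.
apply: (is_derive_eq (derivM (derivN (dexpR x)) (deriv_cst x s^-1))).
by rewrite mulr0 addr0 mulr1 mulrN opprK mulfK// gt_eqF.
Qed.

Let cvg_primitive : (- expR (- (s * x)) / s) @[x --> +oo] --> 0.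
Proof.
rewrite [X in _ --> X](_ : 0 = - 0 / s); last by rewrite oppr0 mul0r.
by apply: cvgM; [apply: cvgN; exact: cvg_expR_scale|exact: cvg_cst].
Qed.

Lemma integral_expabs : (\int[mu]_x (expabs s x)%:E = (2 / s)%:E)%E.
Proof.
have ev (x : R) : expabs s (- x) = expabs s x by rewrite /expabs normrN.
have fg (x : R) : 0 <= x -> expabs s x = expR (- (s * x)).
  by move=> x0; rewrite /expabs ger0_norm.
rewrite (integral_even_FTC expabs_ge0 continuous_expabs ev fg dprimitive cvg_primitive).
by rewrite mulr0 oppr0 expR0 sub0r mulNr opprK mul1r.
Qed.

Lemma L1_expabs : rL1 (expabs s).
Proof.
apply/integrableP; split; first by apply/measurable_EFinP; exact: measurable_expabs.
under eq_integral do rewrite /= ger0_norm ?expabs_ge0//.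
by rewrite integral_expabs ltry.
Qed.

Lemma poisson_ge0 x : 0 <= poisson s x.
Proof. by rewrite divr_ge0// ?mulr_ge0// ?addr_ge0 ?sqr_ge0// ltW. Qed.

Lemma poisson_den x : 0 < s ^+ 2 + x ^+ 2.
Proof. by rewrite ltr_pwDl ?sqr_ge0// exprn_gt0. Qed.

Lemma continuous_poisson : continuous (poisson s).
Proof.
move=> x; apply: cvgM; first exact: cvg_cst.
apply: cvgV; first by rewrite gt_eqF// poisson_den.
by apply: cvgD; [exact: cvg_cst|exact: exprn_continuous].
Qed.

Lemma is_derive_atan_scale (c x : R) :
  is_derive x 1 (fun y => 2 * atan ((y - c) / s)) (poisson s (x - c)).
Proof.
have d1 := derivM (derivD (deriv_id x) (deriv_cst x (- c))) (deriv_cst x s^-1).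
have d2 := derivZ 2 (deriv_comp (is_derive1_atan _) d1).
apply: (is_derive_eq d2); rewrite /poisson mulr0 !addr0 mul1r.
have := poisson_den (x - c); have := s0; move=> sp dp.
field; lra.
Qed.

Lemma integral_poisson : (\int[mu]_x (poisson s x)%:E = (2 * pi)%:E)%E.
Proof.
have ev (x : R) : poisson s (- x) = poisson s x by rewrite /poisson sqrrN.
have dF (x : R) : is_derive x (1 : R) (fun y => 2 * atan ((y - 0) / s)) (poisson s x).
  by have := is_derive_atan_scale 0 x; rewrite subr0.
have cv : (2 * atan ((x - 0) / s)) @[x --> +oo] --> pi.
  rewrite [X in _ --> X](_ : pi = 2 * (pi / 2)); last by field.
  apply: cvgM; first exact: cvg_cst.
  under eq_fun do rewrite subr0 mulrC.
  have H : (s^-1 * x) @[x --> +oo] --> +oo.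
    by apply: gt0_cvgMry; [rewrite invr_gt0|exact: cvg_id].
  exact: (cvg_comp _ _ H (@cvgy_atan R)).
rewrite (integral_even_FTC poisson_ge0 continuous_poisson ev (fun x _ => erefl) dF cv).
by rewrite subr0 mul0r atan0 mulr0 subr0.
Qed.

Lemma poisson_le x : poisson s x <= 2 / s.
Proof.
rewrite /poisson ler_pdivrMr ?poisson_den//.
have -> : 2 / s * (s ^+ 2 + x ^+ 2) = 2 * s + 2 / s * x ^+ 2.
  by field; rewrite gt_eqF.
by rewrite lerDl mulr_ge0 ?sqr_ge0// divr_ge0// ltW.
Qed.

Lemma Rint_poisson (a b x : R) : a < b ->
  \int[mu]_(y in `[a, b]) poisson s (y - x) =
  2 * atan ((b - x) / s) - 2 * atan ((a - x) / s).
Proof.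
move=> ab; have dF y := is_derive_atan_scale x y.
rewrite (@Rint_FTC (fun y => poisson s (y - x)) _ _ _ ab _ dF)//.
move=> y; apply: (@continuous_comp _ _ _ (fun y => y - x) (poisson s)).
  by apply: cvgB; [exact: cvg_id|exact: cvg_cst].
exact: continuous_poisson.
Qed.

Lemma continuous_cosM (y : R) : continuous (fun x : R => cos (y * x)).
Proof.
move=> x; apply: (@continuous_comp _ _ _ (fun x => y * x) cos).
  by apply: cvgM; [exact: cvg_cst|exact: cvg_id].
exact: continuous_cos.
Qed.

Lemma continuous_sinM (y : R) : continuous (fun x : R => sin (y * x)).
Proof.
move=> x; apply: (@continuous_comp _ _ _ (fun x => y * x) sin).
  by apply: cvgM; [exact: cvg_cst|exact: cvg_id].
exact: continuous_sin.
Qed.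

Lemma cos_abs_le1 (x : R) : `|cos x| <= 1.
Proof. by rewrite ler_norml cos_geN1 cos_le1. Qed.

Lemma sin_abs_le1 (x : R) : `|sin x| <= 1.
Proof. by rewrite ler_norml sin_geN1 sin_le1. Qed.

Lemma ae_neq (c : R) : {ae mu, forall x, x != c}.
Proof.
exists [set c]; split => //; first exact: lebesgue_measure_set1.
by move=> x /= /negP; rewrite negbK => /eqP.
Qed.

Section cosine.
Variable y : R.
(** Real part of exp ((- s + i y) x) / (- s + i y). *)
Let G (x : R) : R := expR (- (s * x)) * (y * sin (y * x) - s * cos (y * x)) / (s ^+ 2 + y ^+ 2).

Let dG (x : R) : is_derive x (1 : R) G (expR (- (s * x)) * cos (y * x)).
Proof.
have dsin := deriv_comp (is_derive_sin _) (derivZ y (deriv_id x)).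
have dcos := deriv_comp (is_derive_cos _) (derivZ y (deriv_id x)).
have d2 := derivD (derivZ y dsin) (derivN (derivZ s dcos)).
apply: (is_derive_eq (derivM (derivM (dexpR x) d2) (deriv_cst x (s ^+ 2 + y ^+ 2)^-1))).
by have := poisson_den y => h; field; rewrite gt_eqF.
Qed.

Let cvg_G : G x @[x --> +oo] --> 0.
Proof.
have D0 := poisson_den y; have ys : 0 < `|y| + s by rewrite ltr_wpDl.
apply/cvgr0Pnorm_le => e e0.
have /cvgr0Pnorm_le /(_ (e * (s ^+ 2 + y ^+ 2) / (`|y| + s))) := cvg_expR_scale.
rewrite divr_gt0 ?mulr_gt0// => /(_ isT); apply: filterS => x.
rewrite ger0_norm ?expR_ge0// ler_pdivlMr// => H.
rewrite /G normrM normfV (gtr0_norm D0) ler_pdivrMr// normrM ger0_norm ?expR_ge0//.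
apply: le_trans H; rewrite ler_wpM2l ?expR_ge0//.
apply: le_trans (ler_normB _ _) _; rewrite !normrM (gtr0_norm s0); apply: lerD.
  by rewrite -[leRHS]mulr1 ler_wpM2l// sin_abs_le1.
by rewrite -[leRHS]mulr1 ler_wpM2l ?(ltW s0)// cos_abs_le1.
Qed.

(* [1 + cos] is nonnegative, so that the fundamental theorem of calculus on
   [0, +oo[ applies. *)
Lemma Rint_expabs_cos : \int[mu]_x (expabs s x * cos (y * x)) = poisson s y.
Proof.
pose f (x : R) := expabs s x + expabs s x * cos (y * x).
have /(congr1 fine) : (\int[mu]_x (f x)%:E = (2 * (0 - (- expR (- (s * 0)) / s + G 0)))%:E)%E.
  apply: (@integral_even_FTC f
    (fun x => expR (- (s * x)) + expR (- (s * x)) * cos (y * x))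
    (fun x => - expR (- (s * x)) / s + G x) 0) => [x||x|x x0|x|].
  - by have := expabs_ge0 x; have := cos_geN1 (y * x); rewrite /f; nra.
  - move=> x; apply: cvgD; first exact: continuous_expabs.
    by apply: cvgM; [exact: continuous_expabs|exact: continuous_cosM].
  - by rewrite /f /expabs normrN mulrN cosN.
  - by rewrite /f /expabs ger0_norm.
  - exact: derivD (dprimitive x) (dG x).
  - by rewrite -[X in _ --> X]addr0; apply: cvgD.
have gL1 : rL1 (fun x => expabs s x * cos (y * x)).
  apply: (L1M_bounded (M := 1) L1_expabs); last by move=> x; exact: cos_abs_le1.
  by apply: continuous_measurable_fun; exact: continuous_cosM.
have E0 : \int[mu]_x expabs s x = 2 / s by rewrite /Rintegral integral_expabs.
rewrite -[LHS]/(Rintegral mu setT f) RintegralD ?E0//; last exact: L1_expabs.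
rewrite /G !mulr0 oppr0 expR0 sin0 cos0 !mulr0 !mulr1 mul1r sub0r /poisson.
by have := poisson_den y; move=> dp /= E; apply: (addrI (2 / s)); rewrite E; field; rewrite !gt_eqF.
Qed.

Lemma Rint_expabs_sin : \int[mu]_x (expabs s x * sin (y * x)) = 0.
Proof.
have L : rL1 (fun x => expabs s x * sin (y * x)).
  apply: (L1M_bounded (M := 1) L1_expabs); last by move=> x; exact: sin_abs_le1.
  by apply: continuous_measurable_fun; exact: continuous_sinM.
have N1 : (-1 : R) != 0 by rewrite oppr_eq0 oner_eq0.
have := @Rint_affine _ (-1) 0 N1 _ L; rewrite normrN normr1 mul1r.
move=> H; suff : (\int[mu]_x (expabs s x * sin (y * x))) +
    (\int[mu]_x (expabs s x * sin (y * x))) = 0 by lra.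
rewrite [X in X + _]H -RintegralD//; last exact: (@L1_affine _ _ 0 N1 _ L).
rewrite (@eq_Rintegral _ _ _ _ _ (cst 0)); first by rewrite /Rintegral integral0.
move=> x _; rewrite addr0 /expabs mulN1r normrN mulrN sinN mulrN.
by rewrite addNr.
Qed.

End cosine.
End fixed_s.
End Kernels.

(** * The multiplication formula and damped Parseval identity *)

Section FourierL1.
Context {R : realType}.
Local Notation mu := (leb R).
Implicit Types (u v w f h : R -> R[i]) (z : R[i]).

(** Unnormalised; the factor [cc] is restored when passing to L2. *)
Definition FT u (xi : R) : R[i] := cint (fun x => u x * expi (- (xi * x))).

Lemma measurable_mulr (xi : R) : measurable_fun [set: R] (fun x : R => xi * x).
Proof. exact: measurable_funM. Qed.

Lemma mcpx_expiM (xi : R) : measurable_complex (fun x : R => expi (xi * x)).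
Proof. by apply: mcpx_expi; exact: measurable_mulr. Qed.

Lemma mcpx_expiMN (xi : R) : measurable_complex (fun x : R => expi (- (xi * x))).
Proof. by apply: mcpx_expi; apply: measurableT_comp => //; exact: measurable_mulr. Qed.

Lemma cL1_expi u (xi : R) : cL1 u -> cL1 (fun x => u x * expi (- (xi * x))).
Proof.
move=> u1; apply: (cL1M_bounded (M := 1)) => //; first exact: mcpx_expiMN.
by move=> x; rewrite normc_expi.
Qed.

Lemma FT_bound u xi : cL1 u -> normc (FT u xi) <= \int[mu]_x normc (u x).
Proof.
move=> u1; apply: le_trans (normc_cint (cL1_expi xi u1)) _.
by rewrite le_eqVlt; apply/orP; left; apply/eqP; apply: eq_Rintegral => x _; rewrite cnormM normc_expi mulr1.
Qed.

Section kernel_transform.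
Implicit Types (p q : R -> R).
Variable phi : R -> R.
Hypotheses (cphi : continuous phi) (phi1 : forall x, `|phi x| <= 1).

(** The cosine or the sine transform, according to [phi]; treating both at once keeps Fubini's
    theorem real-valued. *)
Definition ktransform (p : R -> R) (xi : R) := \int[mu]_x (p x * phi (xi * x)).

Let mk : measurable_fun [set: R * R] (fun t => phi (t.1 * t.2)).
Proof.
apply: (measurableT_comp (f := phi)); last exact: measurable_funM.
exact: continuous_measurable_fun.
Qed.

Lemma L1_kernel (p : R -> R) xi : rL1 p -> rL1 (fun x => p x * phi (xi * x)).
Proof.
move=> p1; apply: (L1M_bounded (M := 1)) => //.
by apply: measurableT_comp; [exact: continuous_measurable_fun|exact: measurable_mulr].
Qed.

Lemma measurable_ktransform p : rL1 p -> measurable_fun [set: R] (ktransform p).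
Proof. by move=> p1; exact: (measurable_Rint_kernel p1 mk). Qed.

Lemma ktransformM_L1 p q : rL1 p -> rL1 q -> rL1 (fun x => ktransform p x * q x).
Proof.
move=> p1 q1; under eq_fun do rewrite mulrC.
apply: (L1M_bounded (M := \int[mu]_x `|p x|)) => //; first exact: measurable_ktransform.
move=> xi; apply: le_trans (le_normr_Rintegral _ (L1_kernel xi p1)) _ => //.
apply: le_Rintegral => //; [by apply: L1_norm; exact: L1_kernel|exact: L1_norm|].
by move=> x _; rewrite normrM -[leRHS]mulr1 ler_wpM2l.
Qed.

Lemma ktransform_sym p q : rL1 p -> rL1 q ->
  \int[mu]_x (ktransform p x * q x) = \int[mu]_x (p x * ktransform q x).
Proof.
move=> p1 q1; have := Rint_fubini_kernel p1 q1 mk (fun t => phi1 _).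
rewrite /= => ->; apply: eq_Rintegral => x _; rewrite mulrC; congr (_ * _).
by apply: eq_Rintegral => y _; rewrite [y * x]mulrC.
Qed.

End kernel_transform.

Local Notation C := (ktransform cos).
Local Notation S := (ktransform sin).
Let L1c := L1_kernel (@continuous_cos R) (@cos_abs_le1 R).
Let L1s := L1_kernel (@continuous_sin R) (@sin_abs_le1 R).
Let mC := measurable_ktransform (@continuous_cos R).
Let mS := measurable_ktransform (@continuous_sin R).

Lemma Re_FT u xi : cL1 u ->
  Re (FT u xi) = C (fun x => Re (u x)) xi + S (fun x => Im (u x)) xi.
Proof.
move=> [u1 u2]; rewrite Re_cint -RintegralD//; [|exact: L1c|exact: L1s].
by apply: eq_Rintegral => x _; rewrite cReM Re_expi Im_expi cosN sinN mulrN opprK.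
Qed.

Lemma Im_FT u xi : cL1 u ->
  Im (FT u xi) = C (fun x => Im (u x)) xi - S (fun x => Re (u x)) xi.
Proof.
move=> [u1 u2]; rewrite Im_cint -RintegralB//; [|exact: L1c|exact: L1s].
by apply: eq_Rintegral => x _; rewrite cImM Re_expi Im_expi cosN sinN mulrN addrC.
Qed.

Lemma FT_mcpx u : cL1 u -> measurable_complex (FT u).
Proof.
move=> u1; have [ur ui] := u1; split.
  rewrite (_ : (fun x => _) = fun xi => C (fun x => Re (u x)) xi + S (fun x => Im (u x)) xi).
    apply: measurable_funD; first exact: mC ur.
    exact: mS ui.
  by apply/funext => xi; exact: Re_FT.
rewrite (_ : (fun x => _) = fun xi => C (fun x => Im (u x)) xi - S (fun x => Re (u x)) xi).
  apply: measurable_funB; first exact: mC ui.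
  exact: mS ur.
by apply/funext => xi; exact: Im_FT.
Qed.

Lemma FT_L1M f h : cL1 f -> cL1 h -> cL1 (fun xi => FT f xi * h xi).
Proof.
move=> f1 h1; under eq_fun do rewrite mulrC.
apply: (cL1M_bounded (M := \int[mu]_x normc (f x))) => //; first exact: FT_mcpx.
by move=> x; exact: FT_bound.
Qed.

(** Written with cosine and sine transforms, the real part is a sum of four terms, to each of which
    [ktransform_sym] applies. *)
Let FT_mult_Re f h : cL1 f -> cL1 h ->
  Re (cint (fun xi => FT f xi * h xi)) = Re (cint (fun x => f x * FT h x)).
Proof.
move=> f1 h1; have [fr fi] := f1; have [hr hi] := h1.
pose f_r x := Re (f x); pose f_i x := Im (f x).
pose h_r x := Re (h x); pose h_i x := Im (h x).
have CL1M p q : rL1 p -> rL1 q -> rL1 (fun x => C p x * q x).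
  by apply: ktransformM_L1; [exact: continuous_cos|exact: cos_abs_le1].
have SL1M p q : rL1 p -> rL1 q -> rL1 (fun x => S p x * q x).
  by apply: ktransformM_L1; [exact: continuous_sin|exact: sin_abs_le1].
have CL1M' p q : rL1 p -> rL1 q -> rL1 (fun x => p x * C q x).
  by move=> p1 q1; under eq_fun do rewrite mulrC; exact: CL1M.
have SL1M' p q : rL1 p -> rL1 q -> rL1 (fun x => p x * S q x).
  by move=> p1 q1; under eq_fun do rewrite mulrC; exact: SL1M.
have Csym := ktransform_sym (@continuous_cos R) (@cos_abs_le1 R).
have Ssym := ktransform_sym (@continuous_sin R) (@sin_abs_le1 R).
rewrite !Re_cint; transitivity (\int[mu]_x (C f_r x * h_r x + S f_i x * h_r x
    - (C f_i x * h_i x - S f_r x * h_i x))).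
  apply: eq_Rintegral => x _; rewrite cReM Re_FT// Im_FT//.
  by rewrite mulrDl mulrBl.
rewrite RintegralB//; [|by apply: L1D; auto|by apply: L1B; auto].
rewrite RintegralD//; [|by auto|by auto].
rewrite RintegralB//; [|by auto|by auto].
rewrite !Csym// !Ssym//.
rewrite -RintegralD//; [|by auto|by auto].
rewrite -RintegralB//; [|by auto|by auto].
rewrite -RintegralB//; [|by apply: L1D; auto|by apply: L1B; auto].
apply: eq_Rintegral => x _; rewrite cReM Re_FT// Im_FT//.
by rewrite /f_r /f_i /h_r /h_i; ring.
Qed.

Lemma FT_mult f h : cL1 f -> cL1 h ->
  cint (fun xi => FT f xi * h xi) = cint (fun x => f x * FT h x).
Proof.
move=> f1 h1; apply: cplx_ext; first exact: FT_mult_Re.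
(* Since Im z = Re (- i z), the imaginary part is the real part for - i h in place of h. *)
pose j : R[i] := 0 +i* (-1).
have ImE z : Im z = Re (j * z) by rewrite cReM /=; ring.
have jh1 := cL1Z j h1.
rewrite !ImE -!cintZ; [|by under eq_fun do rewrite mulrC; exact: FT_L1M|exact: FT_L1M].
rewrite (_ : (fun xi => _) = fun xi => FT f xi * (j * h xi)); last first.
  by apply/funext => xi; rewrite mulrCA.
rewrite FT_mult_Re//; congr (Re (cint _)); apply/funext => x.
rewrite [RHS]mulrCA; congr (_ * _); rewrite /FT -cintZ; last exact: cL1_expi.
by congr cint; apply/funext => t; rewrite mulrA.
Qed.

Section fixed_s.
Variable s : R.
Hypothesis s0 : 0 < s.

Lemma cL1_expabs_expi x : cL1 (fun xi => (expabs s xi)%:C * expi (x * xi)).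
Proof.
apply: (cL1M_bounded (M := 1)); first by apply: cL1_real; exact: L1_expabs.
  exact: mcpx_expiM.
by move=> xi; rewrite normc_expi.
Qed.

Lemma FT_expabs x y :
  FT (fun xi => (expabs s xi)%:C * expi (x * xi)) y = (poisson s (y - x))%:C.
Proof.
have E xi : (expabs s xi)%:C * expi (x * xi) * expi (- (y * xi)) =
    (expabs s xi)%:C * expi (- ((y - x) * xi)).
  by rewrite -mulrA -expiD; congr (_ * expi _); ring.
apply: cplx_ext; rewrite !(Re_cint, Im_cint).
  rewrite cReC -Rint_expabs_cos//; apply: eq_Rintegral => xi _.
  by rewrite E cReM !ReImV cosN; ring.
rewrite cImC -[RHS]oppr0 -(@Rint_expabs_sin _ s s0 (y - x)) -mulN1r -RintegralZl//; last first.
  by apply: L1s; exact: L1_expabs.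
by apply: eq_Rintegral => xi _; rewrite E cImM !ReImV sinN; ring.
Qed.

(** Conjugation turns the inverse transform into a forward one, so that [FT] alone suffices. The
    multiplication formula then moves the transform onto the damped exponential, where it is a
    Poisson kernel. *)
Lemma FT_conj_expabs f x : cL1 f ->
  FT (fun xi => conjc (FT f xi) * (expabs s xi)%:C) x =
  conjc (cint (fun y => f y * (poisson s (y - x))%:C)).
Proof.
move=> f1.
have -> : cint (fun y => f y * (poisson s (y - x))%:C) =
    cint (fun y => f y * FT (fun xi => (expabs s xi)%:C * expi (x * xi)) y).
  by congr cint; apply/funext => y; rewrite FT_expabs.
rewrite -FT_mult//; last exact: cL1_expabs_expi.
rewrite -cintJ; last by apply: FT_L1M => //; exact: cL1_expabs_expi.
congr cint; apply/funext => xi.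
by rewrite expiN; apply: cplx_ext; rewrite !ReImE !ReImV; ring.
Qed.

Lemma cL1_conj_expabs f : cL1 f ->
  cL1 (fun xi => conjc (FT f xi) * (expabs s xi)%:C).
Proof.
move=> f1; under eq_fun do rewrite mulrC.
apply: (cL1M_bounded (M := \int[mu]_x normc (f x))).
- by apply: cL1_real; exact: L1_expabs.
- by apply: mcpx_J; exact: FT_mcpx.
- by move=> x; rewrite cnormJ; exact: FT_bound.
Qed.

(** An Abel-regularised Parseval identity: the damping on the Fourier side becomes Poisson smoothing
    of h. Letting s tend to 0 gives both inversion and Plancherel's inequality. *)
Lemma FT_poisson f h : cL1 f -> cL1 h ->
  cint (fun xi => FT f xi * (conjc (FT h xi) * (expabs s xi)%:C)) =
  cint (fun x => f x * conjc (cint (fun y => h y * (poisson s (y - x))%:C))).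
Proof.
move=> f1 h1; rewrite (FT_mult f1 (cL1_conj_expabs h1)).
by congr cint; apply/funext => x; rewrite FT_conj_expabs.
Qed.

End fixed_s.
End FourierL1.

(** * Abel inversion, injectivity and Plancherel's inequality *)

Section FourierInversion.
Context {R : realType}.
Local Notation mu := (leb R).
Implicit Types (u v w f h : R -> R[i]) (z : R[i]).

Definition chi (a b x : R) : R[i] := (\1_(`[a, b]%classic) x)%:C.

Lemma cL1_chi a b : cL1 (chi a b).
Proof. by apply: cL1_real; exact: integrable_indic_itv. Qed.

Lemma Rint_indic (f : R -> R) a b :
  \int[mu]_x (f x * \1_(`[a, b]%classic) x) = \int[mu]_(x in `[a, b]) f x.
Proof.
rewrite [RHS]Rintegral_mkcond; apply: eq_Rintegral => x _.
by rewrite indicE patchE; case: (x \in _); rewrite ?mulr1 ?mulr0.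
Qed.

(** The damping parameters: positive from n = 0 on, and tending to 0. *)
Definition natinv (n : nat) : R := n.+1%:R^-1.

Lemma natinv_gt0 n : 0 < natinv n.
Proof. by rewrite invr_gt0 ltr0n. Qed.

Lemma cvg_natM (c : R) : 0 < c -> (c * n.+1%:R : R) @[n --> \oo] --> +oo.
Proof.
move=> c0; apply/cvgryPge => A.
exists (Num.truncn `|A / c|) => // n /= An.
rewrite mulrC -ler_pdivrMr//.
apply: le_trans (ler_norm _) _; apply: ltW; apply: lt_le_trans (truncnS_gt _) _.
by rewrite ler_nat ltnS.
Qed.

Lemma cvg_atan_pos (c : R) : 0 < c -> atan (c / natinv n) @[n --> \oo] --> pi / 2.
Proof.
move=> c0; under eq_fun do rewrite invrK.
exact: (cvg_comp _ _ (cvg_natM c0) (@cvgy_atan R)).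
Qed.

Lemma cvg_atan_neg (c : R) : c < 0 -> atan (c / natinv n) @[n --> \oo] --> - (pi / 2).
Proof.
move=> c0; rewrite (_ : (fun n => _) = (fun n => - atan ((- c) / natinv n))); last first.
  by apply/funext => n; rewrite mulNr atanN opprK.
by apply: cvgN; apply: cvg_atan_pos; rewrite oppr_gt0.
Qed.

(** The integral of [poisson] over [a, b], centred at x: a smooth version of 2 pi times the
    indicator. *)
Definition smooth_indic (a b : R) (n : nat) (x : R) : R :=
  2 * atan ((b - x) / natinv n) - 2 * atan ((a - x) / natinv n).

Lemma cvgM2 (u_ : nat -> R) (l : R) :
  u_ n @[n --> \oo] --> l -> (2 * u_ n) @[n --> \oo] --> 2 * l.
Proof. by move=> ul; apply: cvgM => //; exact: cvg_cst. Qed.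

(** Each arctangent tends to pi / 2 with the sign of its argument. At an endpoint one of them is 0
    and the limit is only half of 2 pi, hence the exclusion of a and b. *)
Lemma cvg_smooth_indic (a b x : R) : a < b -> x != a -> x != b ->
  smooth_indic a b n x @[n --> \oo] --> 2 * pi * \1_(`[a, b]%classic) x.
Proof.
move=> ab xa xb.
rewrite indicE; case: (boolP (x \in _)) => [/set_mem/=|/negP xab].
  rewrite in_itv/= => /andP[ax xb'].
  have ax' : a - x < 0 by rewrite subr_lt0 lt_neqAle eq_sym xa.
  have bx' : 0 < b - x by rewrite subr_gt0 lt_neqAle xb.
  rewrite [X in _ --> X](_ : _ = 2 * (pi / 2) - 2 * (- (pi / 2))); last by field.
  by apply: cvgB; apply: cvgM2; [exact: cvg_atan_pos|exact: cvg_atan_neg].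
rewrite mulr0.
have [ax|xa'] := ltP a x.
  have bx' : b - x < 0.
    rewrite subr_lt0 ltNge; apply/negP => xb'; apply: xab.
    by rewrite inE/= in_itv/= xb' (ltW ax).
  have ax' : a - x < 0 by rewrite subr_lt0.
  rewrite [X in _ --> X](_ : _ = 2 * (- (pi / 2)) - 2 * (- (pi / 2))); last by ring.
  by apply: cvgB; apply: cvgM2; exact: cvg_atan_neg.
have ax' : 0 < a - x by rewrite subr_gt0 lt_neqAle xa.
have bx' : 0 < b - x by rewrite subr_gt0 (le_lt_trans _ ab).
rewrite [X in _ --> X](_ : _ = 2 * (pi / 2) - 2 * (pi / 2)); last by ring.
by apply: cvgB; apply: cvgM2; exact: cvg_atan_pos.
Qed.

Lemma atan_abs_le (x : R) : `|atan x| <= pi / 2.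
Proof. by rewrite ler_norml !ltW ?atan_gtNpi2 ?atan_ltpi2. Qed.

Lemma smooth_indic_le a b n x : `|smooth_indic a b n x| <= 2 * pi.
Proof.
apply: le_trans (ler_normB _ _) _; rewrite !normrM !(@ger0_norm _ 2)//.
have := atan_abs_le ((b - x) / natinv n); have := atan_abs_le ((a - x) / natinv n).
lra.
Qed.

Lemma measurable_smooth_indic a b n : measurable_fun [set: R] (smooth_indic a b n).
Proof.
have H c : measurable_fun [set: R] (fun x : R => 2 * atan ((c - x) / natinv n)).
  apply: measurable_funM => //; apply: measurableT_comp.
    by apply: continuous_measurable_fun; exact: continuous_atan.
  by apply: measurable_funM => //; exact: measurable_funB.
exact: measurable_funB.
Qed.

Lemma FT_chi_smooth f a b n : cL1 f -> a < b ->
  cint (fun xi => FT f xi * (conjc (FT (chi a b) xi) * (expabs (natinv n) xi)%:C)) =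
  cint (fun x => f x * (smooth_indic a b n x)%:C).
Proof.
move=> f1 ab; have s0 := natinv_gt0 n.
rewrite FT_poisson//; last exact: cL1_chi.
congr cint; apply/funext => x; congr (_ * _).
rewrite (_ : (fun y => _) =
    (fun y => (poisson (natinv n) (y - x) * \1_(`[a, b]%classic) y)%:C)); last first.
  by apply/funext => y; rewrite /chi -rmorphM mulrC.
by rewrite cint_real Rint_indic Rint_poisson// conjc_real.
Qed.

(** The damped pairing is the integral of f against [smooth_indic], which is bounded by 2 pi, so
    dominated convergence applies. Thus the transform determines all integrals of f over
    intervals. *)
Lemma cvg_FT_chi f a b : cL1 f -> a < b ->
  let J n := cint (fun xi => FT f xi *
    (conjc (FT (chi a b) xi) * (expabs (natinv n) xi)%:C)) in
  Re (J n) @[n --> \oo] --> 2 * pi * (\int[mu]_(x in `[a, b]) Re (f x)) /\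
  Im (J n) @[n --> \oo] --> 2 * pi * (\int[mu]_(x in `[a, b]) Im (f x)).
Proof.
move=> f1 ab J.
have mf := cL1_mcpx f1.
have m1 : measurable_fun [set: R] (\1_(`[a, b]%classic) : R -> R) by exact: measurable_indic.
pose u_ n x := f x * (smooth_indic a b n x)%:C.
pose u x := f x * (2 * pi * \1_(`[a, b]%classic) x)%:C.
have -> : J = fun n => cint (u_ n) by apply/funext => n; exact: FT_chi_smooth.
have [r1 r2] : Re (cint (u_ n)) @[n --> \oo] --> Re (cint u) /\
    Im (cint (u_ n)) @[n --> \oo] --> Im (cint u).
  apply: (@cint_dominated _ u_ u (fun x => 2 * pi * normc (f x))).
  - by move=> n; apply: mcpx_M => //; apply: mcpx_real; exact: measurable_smooth_indic.
  - by apply: mcpx_M => //; apply: mcpx_real; exact: measurable_funM.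
  - apply: ae_imp2 (ae_neq a) (ae_neq b) => x xa xb.
    apply/cvgr0Pnorm_le => e e0.
    have /cvgrPdist_le := cvg_smooth_indic ab xa xb.
    (* The added 1 covers the points where f vanishes. *)
    move=> /(_ (e / (normc (f x) + 1))); rewrite divr_gt0 ?ltr_wpDl ?normc_ge0//.
    move=> /(_ isT); apply: filterS => n.
    rewrite ler_pdivlMr ?ltr_wpDl ?normc_ge0// => H.
    rewrite ger0_norm ?normc_ge0// /u_ /u -mulrBr -rmorphB cnormM normc_real.
    rewrite distrC mulrC; apply: le_trans H.
    by rewrite ler_wpM2l// lerDl.
  - by apply: L1Z; exact: L1_modulus.
  - move=> n x; rewrite cnormM normc_real mulrC ler_wpM2r ?normc_ge0//.
    exact: smooth_indic_le.
have [fr fi] := f1.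
have E (g : R -> R) : rL1 g -> \int[mu]_x (g x * (2 * pi * \1_(`[a, b]%classic) x)) =
    2 * pi * \int[mu]_(x in `[a, b]) g x.
  move=> g1; rewrite -Rint_indic -RintegralZl//.
    by apply: eq_Rintegral => x _; ring.
  apply: (L1M_bounded (M := 1)) => // x.
  by rewrite indicE; case: (_ \in _); rewrite ?normr1 ?normr0.
split.
  rewrite -E//; have -> : \int[mu]_x (Re (f x) * (2 * pi * \1_(`[a, b]%classic) x)) = Re (cint u).
    by rewrite Re_cint; apply: eq_Rintegral => x _; rewrite cReM !ReImV mulr0 subr0.
  exact: r1.
rewrite -E//; have -> : \int[mu]_x (Im (f x) * (2 * pi * \1_(`[a, b]%classic) x)) = Im (cint u).
  by rewrite Im_cint; apply: eq_Rintegral => x _; rewrite cImM !ReImV mulr0 add0r.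
exact: r2.
Qed.

Lemma cae0_of_intervals u : cL1 u ->
  (forall a b, a < b -> \int[mu]_(x in `[a, b]) Re (u x) = 0) ->
  (forall a b, a < b -> \int[mu]_(x in `[a, b]) Im (u x) = 0) ->
  {ae mu, forall x, u x = 0}.
Proof.
move=> [ur ui] hr hi.
have := ae0_of_intervals (L1_locally_integrable ur) hr.
have := ae0_of_intervals (L1_locally_integrable ui) hi.
by apply: ae_imp2 => x ix rx; apply: cplx_ext.
Qed.

(** By [cvg_FT_chi] the integrals of u over all intervals are limits of zero sequences. *)
Lemma FT_eq0 u : cL1 u -> (forall xi, FT u xi = 0) -> {ae mu, forall x, u x = 0}.
Proof.
move=> u1 u0.
have H a b : a < b -> 2 * pi * (\int[mu]_(x in `[a, b]) Re (u x)) = 0 /\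
    2 * pi * (\int[mu]_(x in `[a, b]) Im (u x)) = 0.
  move=> ab; have [] := cvg_FT_chi u1 ab.
  rewrite (_ : (fun n => Re _) = cst 0); last first.
    apply/funext => n; rewrite (_ : (fun xi => _) = (fun=> 0%:C)).
      by rewrite cint_real /= /Rintegral integral0.
    by apply/funext => xi; rewrite u0 mul0r.
  rewrite (_ : (fun n => Im _) = cst 0); last first.
    apply/funext => n; rewrite (_ : (fun xi => _) = (fun=> 0%:C)) ?cint_real//.
    by apply/funext => xi; rewrite u0 mul0r.
  by move=> c1 c2; split; apply/esym; [apply: (cvg_unique _ (cvg_cst _) c1)
    | apply: (cvg_unique _ (cvg_cst _) c2)].
have pi2 : 2 * pi != 0 :> R by rewrite mulf_neq0// gt_eqF// pi_gt0.
by apply: cae0_of_intervals => // a b ab; have [h1 h2] := H _ _ ab;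
  apply: (mulfI pi2); rewrite mulr0.
Qed.

Lemma fatou_le (g_ : nat -> R -> R) (g : R -> R) (M : \bar R) :
  (forall n, measurable_fun [set: R] (g_ n)) -> measurable_fun [set: R] g ->
  (forall n x, 0 <= g_ n x) ->
  {ae mu, forall x, g_ n x @[n --> \oo] --> g x} ->
  (forall n, (\int[mu]_x (g_ n x)%:E <= M)%E) ->
  (\int[mu]_x (g x)%:E <= M)%E.
Proof.
move=> mg_ mg g0 cv le.
have mE n : measurable_fun [set: R] (EFin \o g_ n) by exact/measurable_EFinP.
have pos n x : [set: R] x -> (0 <= (EFin \o g_ n) x)%E by move=> _; rewrite lee_fin.
have F := fatou mu measurableT mE pos.
apply: (@le_trans _ _ (\int[mu]_x limn_einf (fun n => (g_ n x)%:E))%E).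
  rewrite le_eqVlt; apply/orP; left; apply/eqP; apply: ae_eq_integral => //.
  - exact/measurable_EFinP.
  (* The liminf is measurable as the opposite of the limsup of the opposites. *)
  - rewrite (_ : (fun x => _) = (-%E \o (fun x => limn_esup (fun n => - (g_ n x)%:E)))%E); last first.
      by apply/funext => x /=; rewrite -limn_einfN; congr limn_einf; apply/funext => n /=; rewrite opprK.
    apply: (measurableT_comp (@oppe_measurable _ _)).
    apply: (measurable_fun_limn_esup (f := fun n x => (- (g_ n x)%:E)%E)) => n.
    exact: (measurableT_comp (@oppe_measurable _ _) (mE n)).
  - apply: ae_imp cv => x cv _.
    have cvE : (g_ n x)%:E @[n --> \oo] --> (g x)%:E by apply: cvg_EFin => //; exact: nearW.
    by rewrite is_cvg_limn_einfE; [exact/esym/cvg_lim|apply/cvg_ex; eexists; exact: cvE].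
apply: le_trans F _.
rewrite limn_einf_lim; apply: lime_le; first exact: is_cvg_einfs.
apply: nearW => n; apply: le_trans (le n).
by apply: ereal_inf_lbound; exists n => /=.
Qed.

(** The squared L2 norm with extended values: it makes sense before f is known to be square
    integrable. *)
Definition N2 f : \bar R := (\int[mu]_x (normc (f x) ^+ 2)%:E)%E.

Lemma measurable_N2 f : measurable_complex f ->
  measurable_fun [set: R] (fun x => normc (f x) ^+ 2).
Proof. by move=> mf; apply: measurable_funX; exact: measurable_modulus. Qed.

Lemma N2_ge0 f : (0 <= N2 f)%E.
Proof. by apply: integral_ge0 => x _; rewrite lee_fin sqr_ge0. Qed.

Lemma integral_poisson_shift s x : 0 < s ->
  (\int[mu]_y (poisson s (y - x))%:E = (2 * pi)%:E)%E.
Proof.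
move=> s0; rewrite -(integral_poisson s0).
rewrite (@ge0_integral_affine _ 1 (- x) _ (fun y => (poisson s y)%:E))//.
- by rewrite normr1 mul1e; apply: eq_integral => y _; rewrite mul1r.
- apply/measurable_EFinP; apply: continuous_measurable_fun; exact: continuous_poisson.
- by move=> y; rewrite lee_fin poisson_ge0.
Qed.

(* Schur's test: AM-GM for |f x| |f y|, then Tonelli. *)
Lemma poisson_bilinear_le f s : cL1 f -> 0 < s ->
  (\int[mu]_x (normc (f x) * normc (cint (fun y => f y * (poisson s (y - x))%:C)))%:E
  <= (2 * pi)%:E * N2 f)%E.
Proof.
move=> f1 s0; have mf := cL1_mcpx f1; have mm := measurable_modulus mf.
have cp := continuous_poisson s0.
have mp x : measurable_fun [set: R] (fun y => poisson s (y - x)).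
  by apply: (measurableT_comp (continuous_measurable_fun cp)); exact: measurable_funB.
have mpE x : measurable_fun [set: R] (fun y => (poisson s (y - x))%:E).
  by apply/measurable_EFinP; exact: mp.
have mp2 : measurable_fun [set: R * R] (fun z : R * R => poisson s (z.2 - z.1)).
  by apply: (measurableT_comp (continuous_measurable_fun cp)); exact: measurable_funB.
pose a x := normc (f x) ^+ 2 / 2.
have ma : measurable_fun [set: R] a.
  by apply: measurable_funM => //; exact: measurable_N2.
have a0 x : 0 <= a x by rewrite divr_ge0 ?sqr_ge0.
have p0 x y : 0 <= poisson s (y - x) by exact: poisson_ge0.
pose K1 (z : R * R) : \bar R := (a z.1 * poisson s (z.2 - z.1))%:E.
pose K2 (z : R * R) : \bar R := (a z.2 * poisson s (z.2 - z.1))%:E.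
have mK1 : measurable_fun [set: R * R] K1.
  by apply/measurable_EFinP; apply: measurable_funM => //; exact: (measurableT_comp ma).
have mK2 : measurable_fun [set: R * R] K2.
  by apply/measurable_EFinP; apply: measurable_funM => //; exact: (measurableT_comp ma).
have K10 (t : R * R) : (0 <= K1 t)%E by rewrite lee_fin mulr_ge0.
have K20 (t : R * R) : (0 <= K2 t)%E by rewrite lee_fin mulr_ge0.
have mK1x x : measurable_fun [set: R] (fun y => K1 (x, y)).
  by apply: (measurableT_comp mK1); exact: measurable_pair1.
have mK2x x : measurable_fun [set: R] (fun y => K2 (x, y)).
  by apply: (measurableT_comp mK2); exact: measurable_pair1.
have mF1 : measurable_fun [set: R] (fun x => \int[mu]_y K1 (x, y))%E.
  exact: (measurable_fun_fubini_tonelli_F (m2 := mu) K1).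
have mF2 : measurable_fun [set: R] (fun x => \int[mu]_y K2 (x, y))%E.
  exact: (measurable_fun_fubini_tonelli_F (m2 := mu) K2).
have mQ : measurable_fun [set: R]
    (fun x => normc (cint (fun y => f y * (poisson s (y - x))%:C))).
  rewrite (_ : (fun x => _) = modulus (FT (fun xi => conjc (FT f xi) * (expabs s xi)%:C))).
    by apply: measurable_modulus; apply: FT_mcpx; exact: cL1_conj_expabs.
  by apply/funext => x; rewrite FT_conj_expabs// cnormJ.
have mpK x : cL1 (fun y => f y * (poisson s (y - x))%:C).
  apply: (cL1M_bounded (M := 2 / s)) => //; first exact: mcpx_real.
  by move=> y; rewrite normc_real ger0_norm// poisson_le.
apply: (@le_trans _ _ (\int[mu]_x (\int[mu]_y K1 (x, y) + \int[mu]_y K2 (x, y)))%E).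
  apply: ge0_le_integral => //.
  - by move=> x _; rewrite lee_fin mulr_ge0 ?normc_ge0.
  - by apply/measurable_EFinP; exact: measurable_funM.
  - exact: emeasurable_funD.
  - move=> x _; rewrite -ge0_integralD//; [|exact: mK1x|exact: mK2x].
    apply: (@le_trans _ _ (normc (f x) * \int[mu]_y normc (f y * (poisson s (y - x))%:C))%:E).
      by rewrite lee_fin ler_wpM2l ?normc_ge0// normc_cint.
    have Lm := L1_modulus (mpK x).
    rewrite -RintegralZl// /Rintegral fineK; last first.
      by apply: integrable_fin_num => //; exact: L1Z.
    apply: ge0_le_integral => //.
    + by move=> y _; rewrite lee_fin mulr_ge0 ?normc_ge0.
    + apply/measurable_EFinP; apply: measurable_funM => //; exact: L1_measurable Lm.
    + exact: (emeasurable_funD (mK1x x) (mK2x x)).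
    + move=> y _; rewrite -EFinD lee_fin /= -mulrDl cnormM normc_real ger0_norm// mulrA.
      have amgm (u v : R) : u * v <= u ^+ 2 / 2 + v ^+ 2 / 2.
        by have := sqr_ge0 (u - v); nra.
      rewrite ler_wpM2r// /a; exact: amgm.
have F10 x : [set: R] x -> (0 <= \int[mu]_y K1 (x, y))%E by move=> _; exact: integral_ge0.
have F20 x : [set: R] x -> (0 <= \int[mu]_y K2 (x, y))%E by move=> _; exact: integral_ge0.
have -> := ge0_integralD mu measurableT F10 mF1 F20 mF2.
have I1 : (\int[mu]_x \int[mu]_y K1 (x, y) = (2 * pi)%:E * \int[mu]_x (a x)%:E)%E.
  rewrite -ge0_integralZl//; last 3 first.
  - exact/measurable_EFinP.
  - by move=> x _; rewrite lee_fin.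
  - by rewrite lee_fin mulr_ge0// pi_ge0.
  apply: eq_integral => x _; rewrite /K1 /=.
  under eq_integral do rewrite EFinM.
  rewrite ge0_integralZl//; [|exact: mpE|by move=> t _; rewrite lee_fin|by rewrite lee_fin].
  by rewrite integral_poisson_shift// muleC.
(* After Tonelli, evenness of [poisson] identifies this double integral with the previous one. *)
have I2 : (\int[mu]_x \int[mu]_y K2 (x, y) = (2 * pi)%:E * \int[mu]_x (a x)%:E)%E.
  rewrite (fubini_tonelli (m1 := mu) (m2 := mu) K2)//.
  rewrite -I1; apply: eq_integral => y _; apply: eq_integral => x _.
  by rewrite /K1 /K2 /poisson /= -opprB sqrrN.
rewrite I1 I2 -ge0_muleDr; last 2 first.
- by apply: integral_ge0 => x _; rewrite lee_fin.
- by apply: integral_ge0 => x _; rewrite lee_fin.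
rewrite -ge0_integralD//; last 4 first.
- by move=> x _; rewrite lee_fin.
- exact/measurable_EFinP.
- by move=> x _; rewrite lee_fin.
- exact/measurable_EFinP.
rewrite le_eqVlt; apply/orP; left; apply/eqP; congr (_ * _)%E.
by apply: eq_integral => x _; rewrite -EFinD /a -splitr.
Qed.

Lemma cvg_expabs_natinv (x : R) : expabs (natinv n) x @[n --> \oo] --> (1 : R).
Proof.
have H : (- (natinv n * `|x|)) @[n --> \oo] --> (0 : R).
  rewrite -[X in _ --> X]oppr0 -(mul0r `|x|); apply: cvgN.
  apply: cvgM; last exact: cvg_cst.
  exact: cvg_harmonic.
rewrite -[X in _ --> X]expR0.
exact: (cvg_comp _ _ H (@continuous_expR R 0)).
Qed.

(* Plancherel's inequality, by Abel summation of the left-hand side and Fatou. *)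
Lemma N2_FT_le f : cL1 f -> (N2 (FT f) <= (2 * pi)%:E * N2 f)%E.
Proof.
move=> f1; have mF := FT_mcpx f1.
pose M := \int[mu]_x normc (f x).
have FM xi : normc (FT f xi) <= M by exact: FT_bound.
apply: (@fatou_le (fun n xi => normc (FT f xi) ^+ 2 * expabs (natinv n) xi)).
- move=> n; apply: measurable_funM; first exact: measurable_N2.
  exact: measurable_expabs.
- exact: measurable_N2.
- by move=> n x; rewrite mulr_ge0 ?sqr_ge0 ?expabs_ge0.
- apply: aeW => x; rewrite -[X in _ --> X]mulr1; apply: cvgM; first exact: cvg_cst.
  exact: cvg_expabs_natinv.
move=> n; have s0 := natinv_gt0 n.
have L : rL1 (fun xi => normc (FT f xi) ^+ 2 * expabs (natinv n) xi).
  apply: (L1_le (g := fun xi => M ^+ 2 * expabs (natinv n) xi)).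
  - by apply: measurable_funM; [exact: measurable_N2|exact: measurable_expabs].
  - move=> x; rewrite ger0_norm; last by rewrite mulr_ge0 ?sqr_ge0 ?expabs_ge0.
    rewrite ler_wpM2r ?expabs_ge0// lerXn2r ?nnegrE ?normc_ge0//.
    by apply: le_trans (FM x); exact: normc_ge0.
  - by apply: L1Z; exact: L1_expabs.
have -> : (\int[mu]_x (normc (FT f x) ^+ 2 * expabs (natinv n) x)%:E)%E =
    (Re (cint (fun xi => FT f xi * (conjc (FT f xi) * (expabs (natinv n) xi)%:C))))%:E.
  rewrite (_ : (fun xi => _) =
     fun xi => (normc (FT f xi) ^+ 2 * expabs (natinv n) xi)%:C); last first.
    by apply/funext => xi; rewrite mulrA normc_sqr_real -rmorphM.
  rewrite cint_real cReC /Rintegral fineK//.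
  exact: integrable_fin_num.
have Lc : cL1 (fun x => f x * conjc (cint (fun y => f y * (poisson (natinv n) (y - x))%:C))).
  under eq_fun do rewrite -FT_conj_expabs// mulrC.
  by apply: FT_L1M => //; exact: cL1_conj_expabs.
rewrite FT_poisson//.
apply: le_trans _ (poisson_bilinear_le f1 s0).
apply: (@le_trans _ _ (\int[mu]_x normc (f x * conjc (cint (fun y => f y * (poisson (natinv n) (y - x))%:C))))%:E).
  rewrite lee_fin; apply: le_trans (ler_norm _) _; apply: le_trans (normc_Re _) _.
  exact: normc_cint.
rewrite /Rintegral fineK; last by apply: integrable_fin_num => //; exact: L1_modulus.
rewrite le_eqVlt; apply/orP; left; apply/eqP; apply: eq_integral => x _.
by rewrite cnormM cnormJ.
Qed.

End FourierInversion.

(** * Plancherel's theorem *)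

Section L2Functions.
Context {R : realType}.
Local Notation mu := (leb R).
Implicit Types (u v w h : R -> R[i]) (z : R[i]).

Lemma Lnorm2_modulus u :
  Lnorm mu 2%:E (EFin \o modulus u) = ((N2 u) `^ 2^-1)%E.
Proof.
rewrite unlock /=; congr (_ `^ _)%E; apply: eq_integral => x _.
by rewrite ger0_norm ?normc_ge0// powR_mulrn ?normc_ge0.
Qed.

Lemma L2funP u : (u \in L2fun) <-> measurable_complex u /\ (N2 u < +oo)%E.
Proof.
rewrite inE /L2fun/= /finite_norm Lnorm2_modulus.
have H : ((N2 u) `^ 2^-1 < +oo)%E <-> (N2 u < +oo)%E.
  have := N2_ge0 u; case: (N2 u) => [r _|_|]; last by [].
    by rewrite poweR_EFin !ltry.
  by rewrite poweRyr ?invr_eq0 ?pnatr_eq0.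
split => -[mf n2]; split => //; exact/H.
Qed.

Lemma L2fun_mcpx u : u \in L2fun -> measurable_complex u.
Proof. by move=> /L2funP[]. Qed.

Lemma N2_le u v : measurable_complex u -> measurable_complex v ->
  (forall x, normc (u x) <= normc (v x)) -> (N2 u <= N2 v)%E.
Proof.
move=> mu' mv uv; apply: ge0_le_integral => //.
- by move=> x _; rewrite lee_fin sqr_ge0.
- by apply/measurable_EFinP; exact: measurable_N2.
- by apply/measurable_EFinP; exact: measurable_N2.
- by move=> x _; rewrite lee_fin lerXn2r ?nnegrE ?normc_ge0.
Qed.

Lemma N2_ae u v : measurable_complex u -> measurable_complex v ->
  {ae mu, forall x, u x = v x} -> N2 u = N2 v.
Proof.
move=> mu' mv uv; apply: ae_eq_integral => //.
- by apply/measurable_EFinP; exact: measurable_N2.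
- by apply/measurable_EFinP; exact: measurable_N2.
- by apply: ae_imp uv => x ->.
Qed.

Lemma L1_sqr u : u \in L2fun -> rL1 (fun x => normc (u x) ^+ 2).
Proof.
move=> /L2funP[mf n2]; apply/integrableP; split.
  by apply/measurable_EFinP; exact: measurable_N2.
apply: le_lt_trans n2; rewrite le_eqVlt; apply/orP; left; apply/eqP.
by apply: eq_integral => x _ /=; rewrite ger0_norm ?sqr_ge0.
Qed.

Lemma N2_fin u : u \in L2fun -> N2 u = (\int[mu]_x (normc (u x) ^+ 2))%:E.
Proof.
move=> u2; rewrite /Rintegral fineK//; apply: integrable_fin_num => //.
exact: L1_sqr.
Qed.

Lemma L2M_L1 u v : u \in L2fun -> v \in L2fun -> cL1 (fun x => u x * conjc (v x)).
Proof.
move=> u2 v2; have mu' := L2fun_mcpx u2; have mv := L2fun_mcpx v2.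
apply: (cL1_le (g := fun x => normc (u x) ^+ 2 + normc (v x) ^+ 2)).
- by apply: mcpx_M => //; exact: mcpx_J.
- move=> x; rewrite cnormM cnormJ.
  have amgm (a b : R) : a * b <= a ^+ 2 + b ^+ 2.
    have := sqr_ge0 (a - b); have := sqr_ge0 a; have := sqr_ge0 b; nra.
  exact: amgm.
- by apply: L1D; exact: L1_sqr.
Qed.

Lemma L2_of_le u v : measurable_complex u -> v \in L2fun ->
  (forall x, normc (u x) <= normc (v x)) -> u \in L2fun.
Proof.
move=> mu' v2 uv; apply/L2funP; split=> //.
have [mv n2] := (L2funP v).1 v2; apply: le_lt_trans n2; exact: N2_le.
Qed.

Lemma L2_J u : u \in L2fun -> (fun x => conjc (u x)) \in L2fun.
Proof.
move=> u2; apply: (L2_of_le _ u2); first by apply: mcpx_J; exact: L2fun_mcpx.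
by move=> x; rewrite cnormJ.
Qed.

Lemma L2_unimod u v : u \in L2fun -> measurable_complex v ->
  (forall x, normc (v x) <= 1) -> (fun x => v x * u x) \in L2fun.
Proof.
move=> u2 mv v1; apply: (L2_of_le _ u2); first by apply: mcpx_M => //; exact: L2fun_mcpx.
by move=> x; rewrite cnormM ler_piMl// normc_ge0.
Qed.

Definition ctrunc (n : nat) u : R -> R[i] := fun x => u x * chi (- n%:R) n%:R x.

Lemma normc_chi_le1 (a b x : R) : normc (chi a b x) <= 1.
Proof.
by rewrite /chi normc_real indicE; case: (_ \in _); rewrite ?normr1 ?normr0.
Qed.

Lemma mcpx_chi (a b : R) : measurable_complex (chi a b).
Proof. by apply: mcpx_real; exact: measurable_indic. Qed.

Lemma ctrunc_L2 n u : u \in L2fun -> ctrunc n u \in L2fun.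
Proof.
move=> u2; rewrite /ctrunc (_ : (fun x => _) = fun x => chi (- n%:R) n%:R x * u x).
  by apply: L2_unimod => //; [exact: mcpx_chi|move=> x; exact: normc_chi_le1].
by apply/funext => x; rewrite mulrC.
Qed.

Lemma chi_L2 (a b : R) : chi a b \in L2fun.
Proof.
apply/L2funP; split; first exact: mcpx_chi.
have /integrableP[_] := @integrable_indic_itv R a b true false.
apply: le_lt_trans; rewrite le_eqVlt; apply/orP; left; apply/eqP.
apply: eq_integral => x _; rewrite /chi normc_real /= indicE.
by case: (_ \in _); rewrite ?normr1 ?normr0 ?expr1n ?expr0n.
Qed.

Lemma ctrunc_L1 n u : u \in L2fun -> cL1 (ctrunc n u).
Proof.
move=> u2; have := L2M_L1 u2 (chi_L2 (- n%:R) n%:R).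
by under eq_fun do rewrite /chi conjc_real -/(chi _ _ _).
Qed.

Lemma cvg_ctrunc u : u \in L2fun ->
  \int[mu]_x (normc (u x - ctrunc n u x) ^+ 2) @[n --> \oo] --> (0 : R).
Proof.
move=> u2; have mu' := L2fun_mcpx u2.
rewrite [X in _ --> X](_ : 0 = \int[mu]_x (cst 0 x)); last by rewrite /Rintegral integral0.
apply: (@Rint_dominated _ (fun n x => normc (u x - ctrunc n u x) ^+ 2) _
   (fun x => normc (u x) ^+ 2)) => //.
- move=> n; apply: measurable_N2; apply: mcpx_B => //.
  by apply: L2fun_mcpx; exact: ctrunc_L2.
- apply: aeW => x; apply: cvg_near_cst.
  exists (Num.truncn `|x|).+1 => // n /= xn.
  rewrite /ctrunc /chi indicE mem_set ?mulr1 ?subrr ?Normc.normc0 ?expr0n//=.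
  rewrite in_itv/= -ler_norml; apply: ltW; apply: lt_le_trans (truncnS_gt _) _.
  by rewrite ler_nat.
- exact: L1_sqr.
- move=> n x; rewrite ger0_norm ?sqr_ge0// lerXn2r ?nnegrE ?normc_ge0//.
  rewrite /ctrunc /chi indicE; case: (_ \in _); rewrite ?mulr1 ?subrr ?mulr0 ?subr0//.
  by rewrite Normc.normc0 normc_ge0.
Qed.

End L2Functions.

(** * L2 as an inner product space *)

Section L2Space.
Local Open Scope quotient_scope.
Context {R : realType}.
Local Notation mu := (leb R).
Local Notation L2 := (L2 R).
Implicit Types (f g h : L2) (z : R[i]).

Lemma L2valP f : L2val f \in L2fun.
Proof. exact: (valP (repr f)). Qed.

Lemma L2_mcpx f : measurable_complex f.
Proof. exact: L2fun_mcpx (L2valP f). Qed.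

Lemma L2_pi_ae (u : sqint R) : {ae mu, forall x, L2val (\pi_L2 u) x = u x}.
Proof.
have : repr (\pi_L2 u : L2) - u \in @null_sqint R by rewrite Quotient.idealrBE reprK.
rewrite inE /=; apply: ae_imp => x /eqP.
by rewrite -[X in X == _]/(L2val (\pi_L2 u) x - u x) subr_eq0 => /eqP.
Qed.

Lemma L2_eq f g : {ae mu, forall x, f x = g x} -> f = g.
Proof.
move=> fg; rewrite -[f]reprK -[g]reprK; apply/eqP; rewrite -Quotient.idealrBE inE /=.
apply: ae_imp fg => x fg.
by rewrite -[LHS]/(L2val f x - L2val g x) fg subrr.
Qed.

Lemma L2addE f g : {ae mu, forall x, L2val (f + g) x = f x + g x}.
Proof.
have -> : f + g = \pi_L2 (repr f + repr g) by rewrite pi_L2D !reprK.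
exact: L2_pi_ae.
Qed.

Lemma L2scaleE z f : {ae mu, forall x, L2val (z *: f) x = z * f x}.
Proof.
have -> : z *: f = \pi_L2 (z *: repr f).
  by rewrite -pi_L2scale reprK.
exact: L2_pi_ae.
Qed.

Lemma L2oppE f : {ae mu, forall x, L2val (- f) x = - f x}.
Proof. by rewrite -scaleN1r; apply: ae_imp (L2scaleE (-1) f) => x ->; rewrite mulN1r. Qed.

Lemma L2subE f g : {ae mu, forall x, L2val (f - g) x = f x - g x}.
Proof. by apply: ae_imp2 (L2addE f (- g)) (L2oppE g) => x -> ->. Qed.

Lemma L2zeroE : {ae mu, forall x, L2val (0 : L2) x = 0}.
Proof. by rewrite -(scale0r (0 : L2)); apply: ae_imp (L2scaleE 0 0) => x ->; rewrite mul0r. Qed.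

Definition nsq f : R := \int[mu]_x (normc (f x) ^+ 2).

Lemma nsq_ge0 f : 0 <= nsq f.
Proof. by apply: Rintegral_ge0 => x _; exact: sqr_ge0. Qed.

Lemma N2_nsq f : N2 f = (nsq f)%:E.
Proof. exact/N2_fin/L2valP. Qed.

Lemma L2normE f : L2norm f = Num.sqrt (nsq f).
Proof.
rewrite /L2norm Lnorm2_modulus N2_nsq /= -(sqr_sqrtr (nsq_ge0 f)).
rewrite -powR_mulrn ?sqrtr_ge0// -powRrM mulfV// powRr1 ?sqrtr_ge0//.
by rewrite powR_mulrn ?sqrtr_ge0// sqr_sqrtr ?nsq_ge0.
Qed.

Lemma L2norm_ge0 f : 0 <= L2norm f.
Proof. by rewrite L2normE sqrtr_ge0. Qed.

Lemma sqr_L2norm f : L2norm f ^+ 2 = nsq f.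
Proof. by rewrite L2normE sqr_sqrtr ?nsq_ge0. Qed.

Lemma L2innerE f g : L2inner f g = cint (fun x => f x * conjc (g x)).
Proof. by []. Qed.

Lemma L2inner_L1 f g : cL1 (fun x => f x * conjc (g x)).
Proof. by apply: L2M_L1; exact: L2valP. Qed.

Lemma L2inner_linear z f g h :
  L2inner (z *: f + g) h = z * L2inner f h + L2inner g h.
Proof.
rewrite !L2innerE -cintZ; last exact: L2inner_L1.
rewrite -cintD; [|by apply: cL1Z; exact: L2inner_L1|exact: L2inner_L1].
apply: cint_ae.
- by apply: cL1_mcpx; exact: L2inner_L1.
- by apply: cL1_mcpx; apply: cL1D; [apply: cL1Z|]; exact: L2inner_L1.
- apply: ae_imp2 (L2addE (z *: f) g) (L2scaleE z f) => x -> ->.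
  by rewrite mulrDl mulrA.
Qed.

Lemma L2innerJ f g : L2inner g f = conjc (L2inner f g).
Proof.
rewrite !L2innerE -cintJ; last exact: L2inner_L1.
by congr cint; apply/funext => x; apply: cplx_ext; rewrite !ReImE; ring.
Qed.

Lemma L2inner_self f : L2inner f f = (nsq f)%:C.
Proof.
rewrite L2innerE -cint_real; congr cint; apply/funext => x.
exact: normc_sqr_real.
Qed.

Lemma L2innerD f g h : L2inner (f + g) h = L2inner f h + L2inner g h.
Proof. by rewrite -[f in LHS]scale1r L2inner_linear mul1r. Qed.

Lemma L2inner0 h : L2inner 0 h = 0.
Proof. by have := L2innerD 0 0 h; rewrite addr0 => /eqP; rewrite -subr_eq0 opprD addrA subrr sub0r oppr_eq0 => /eqP. Qed.

Lemma L2innerZ z f h : L2inner (z *: f) h = z * L2inner f h.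
Proof. by rewrite -[z *: f]addr0 L2inner_linear L2inner0 addr0. Qed.

Lemma L2innerN f h : L2inner (- f) h = - L2inner f h.
Proof. by rewrite -scaleN1r L2innerZ mulN1r. Qed.

Lemma L2innerB f g h : L2inner (f - g) h = L2inner f h - L2inner g h.
Proof. by rewrite L2innerD L2innerN. Qed.

Lemma nsq_eq0 f : nsq f = 0 -> f = 0.
Proof.
move=> f0; apply: L2_eq.
have : (\int[mu]_x `|(normc (f x) ^+ 2)%:E| = 0)%E.
  rewrite -[RHS]/(0%:E) -f0 -N2_nsq; apply: eq_integral => x _ /=.
  by rewrite ger0_norm ?sqr_ge0.
have mE : measurable_fun [set: R] (fun x => (normc (f x) ^+ 2)%:E).
  by apply/measurable_EFinP; apply: measurable_N2; exact: L2_mcpx.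
move=> /(ae_eq_integral_abs mu measurableT mE).1.
apply: ae_imp2 L2zeroE => x -> /(_ Logic.I) /= [] /eqP.
by rewrite sqrf_eq0 => /eqP /normc0_eq0.
Qed.

Lemma L2norm_eq0 f : L2norm f = 0 -> f = 0.
Proof. by move=> f0; apply: nsq_eq0; rewrite -sqr_L2norm f0 expr0n. Qed.

Lemma nsqZ z f : nsq (z *: f) = normc z ^+ 2 * nsq f.
Proof.
(* The embedding of R into R[i] is injective, and there the claim is the algebra of [L2inner]. *)
have [+ _] : (nsq (z *: f))%:C = (normc z ^+ 2 * nsq f)%:C /\ True; last by case.
split=> //; rewrite -L2inner_self L2innerZ [L2inner f _]L2innerJ L2innerZ cJM -L2innerJ L2inner_self.
by rewrite mulrA normc_sqr_real -rmorphM.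
Qed.

Lemma L2normZ z f : L2norm (z *: f) = normc z * L2norm f.
Proof.
by rewrite !L2normE nsqZ sqrtrM ?sqr_ge0// sqrtr_sqr ger0_norm ?normc_ge0.
Qed.

Lemma L2norm_opp f : L2norm (- f) = L2norm f.
Proof. by rewrite -scaleN1r L2normZ cnormN Normc.normc1 mul1r. Qed.

Lemma L2norm_sub f g : L2norm (f - g) = L2norm (g - f).
Proof. by rewrite -L2norm_opp opprB. Qed.

Lemma nsqD f g : nsq (f + g) = nsq f + 2 * Re (L2inner f g) + nsq g.
Proof.
have [+ _] : (nsq (f + g))%:C = (nsq f + 2 * Re (L2inner f g) + nsq g)%:C /\ True; last by case.
split => //; rewrite -L2inner_self L2innerD [L2inner f (f + g)]L2innerJ [L2inner g (f + g)]L2innerJ !L2innerD.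
rewrite !cJD -!L2innerJ !L2inner_self [L2inner g f]L2innerJ.
by apply: cplx_ext; rewrite !ReImE /=; ring.
Qed.

Lemma L2_CS f g : normc (L2inner f g) <= L2norm f * L2norm g.
Proof.
have [g0|g0] := eqVneq (nsq g) 0.
  have -> : g = 0 by exact: nsq_eq0.
  rewrite L2innerJ L2inner0 cnormJ Normc.normc0 mulr_ge0// L2norm_ge0//.
have gp : 0 < nsq g by rewrite lt_neqAle eq_sym g0 nsq_ge0.
rewrite -(ler_pXn2r (n := 2)) ?nnegrE ?normc_ge0 ?mulr_ge0 ?L2norm_ge0//.
rewrite exprMn !sqr_L2norm.
(* The coefficient that minimises the norm of f + c g: the sum is f minus its projection on g. *)
pose c : R[i] := - L2inner f g * ((nsq g)^-1)%:C.
have := nsq_ge0 (f + c *: g); rewrite nsqD nsqZ L2innerJ L2innerZ.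
rewrite [L2inner g f]L2innerJ.
have -> : Re (conjc (c * conjc (L2inner f g))) = - (normc (L2inner f g) ^+ 2 / nsq g).
  by rewrite cReJ sqr_normcE /c !ReImE !ReImV; ring.
rewrite /c cnormM cnormN normc_real exprMn real_normK ?num_real// => H.
rewrite -ler_pdivrMr//; move: H.
have -> : normc (L2inner f g) ^+ 2 * (nsq g)^-1 ^+ 2 * nsq g = normc (L2inner f g) ^+ 2 / nsq g.
  by field.
lra.
Qed.

Lemma L2normD f g : L2norm (f + g) <= L2norm f + L2norm g.
Proof.
rewrite -(ler_pXn2r (n := 2)) ?nnegrE ?addr_ge0 ?L2norm_ge0//.
rewrite sqr_L2norm nsqD sqrrD !sqr_L2norm.
have := le_trans (le_trans (ler_norm _) (normc_Re _)) (L2_CS f g).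
lra.
Qed.

Lemma L2norm_dist f g h : L2norm (f - h) <= L2norm (f - g) + L2norm (g - h).
Proof. by apply: le_trans (L2normD _ _); rewrite addrA subrK. Qed.

Definition L2cvg (f_ : nat -> L2) f := L2norm (f_ n - f) @[n --> \oo] --> (0 : R).

Lemma L2cvg_unique (f_ : nat -> L2) f g : L2cvg f_ f -> L2cvg f_ g -> f = g.
Proof.
move=> cf cg; apply/eqP; rewrite -subr_eq0; apply/eqP; apply: L2norm_eq0.
apply/eqP; rewrite eq_le L2norm_ge0 andbT.
have H : (L2norm (f_ n - f) + L2norm (f_ n - g)) @[n --> \oo] --> (0 + 0 : R) by exact: cvgD.
rewrite addr0 in H.
apply: (ler_cvg_to _ H) => //; first exact: cvg_cst.
by apply: nearW => n; rewrite (L2norm_sub (f_ n) f); exact: L2norm_dist.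
Qed.

Lemma L2cvg_inner (f_ : nat -> L2) f g : L2cvg f_ f ->
  normc (L2inner (f_ n) g - L2inner f g) @[n --> \oo] --> (0 : R).
Proof.
move=> cf; have H : (L2norm (f_ n - f) * L2norm g) @[n --> \oo] --> (0 : R).
  by rewrite -(mul0r (L2norm g)); apply: cvgM => //; exact: cvg_cst.
apply: (squeeze_cvgr _ (cvg_cst 0) H); apply: nearW => n.
by rewrite normc_ge0 -L2innerB L2_CS.
Qed.

Lemma cvg_normc_unique (z_ : nat -> R[i]) z z' :
  normc (z_ n - z) @[n --> \oo] --> (0 : R) ->
  normc (z_ n - z') @[n --> \oo] --> (0 : R) -> z = z'.
Proof.
move=> c1 c2; apply/eqP; rewrite -subr_eq0; apply/eqP; apply: normc0_eq0.
apply/eqP; rewrite eq_le normc_ge0 andbT.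
have H : (normc (z_ n - z) + normc (z_ n - z')) @[n --> \oo] --> (0 + 0 : R) by exact: cvgD.
rewrite addr0 in H.
apply: (ler_cvg_to _ H) => //; first exact: cvg_cst.
apply: nearW => n; rewrite -(cnormN (z_ n - z)) opprB.
by apply: le_trans (normcD_le _ _); rewrite addrA subrK.
Qed.

Definition L2trunc (n : nat) f : L2 := L2class (ctrunc n f).

Lemma L2truncE n f : {ae mu, forall x, L2trunc n f x = ctrunc n f x}.
Proof. by apply: L2class_ae; apply: ctrunc_L2; exact: L2valP. Qed.

Lemma cvg_L2trunc f : L2cvg (L2trunc^~ f) f.
Proof.
have H := cvg_ctrunc (L2valP f).
rewrite /L2cvg -sqrtr0.
have -> : (fun n => L2norm (L2trunc n f - f)) =
    (fun n => Num.sqrt (\int[mu]_x (normc (f x - ctrunc n f x) ^+ 2))).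
  apply/funext => n; rewrite L2norm_sub L2normE; congr Num.sqrt; apply: Rint_ae.
  - by apply: measurable_N2; exact: L2_mcpx.
  - apply: measurable_N2; apply: mcpx_B; first exact: L2_mcpx.
    by apply: L2fun_mcpx; apply: ctrunc_L2; exact: L2valP.
  - by apply: ae_imp2 (L2subE f (L2trunc n f)) (L2truncE n f) => x -> ->.
exact: (cvg_comp _ _ H (@sqrt_continuous R 0)).
Qed.

End L2Space.

(** * Completeness of L2 *)

Section Completeness.
Context {R : realType}.
Local Notation mu := (leb R).
Local Notation L2 := (L2 R).
Implicit Types (f g h : L2) (z : R[i]).

Lemma measurable_EFin (v : R -> R) : measurable_fun [set: R] v ->
  measurable_fun [set: R] (fun x => (v x)%:E).
Proof. by move=> mv; apply/measurable_EFinP. Qed.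

Lemma cvg_expn2V : (2 ^- n : R) @[n --> \oo] --> (0 : R).
Proof.
rewrite (_ : (fun n : nat => _) = (fun n => (2^-1 : R) ^+ n)); last first.
  by apply/funext => n; rewrite exprVn.
by apply: cvg_expr; rewrite ger0_norm//; lra.
Qed.

Lemma cvg_dist0 (v : nat -> R) (l : R) :
  v n @[n --> \oo] --> l -> `|v n - l| @[n --> \oo] --> (0 : R).
Proof.
move=> /cvgrPdist_le vl; apply/cvgr0Pnorm_le => e e0.
by apply: filterS (vl e e0) => n; rewrite normr_id distrC.
Qed.

Lemma cvg_geometric_increments (v : nat -> R) (C : R) :
  (forall n, `|v n.+1 - v n| <= C * 2 ^- n) -> cvgn v.
Proof.
move=> vC.
have C0 : 0 <= C by have := le_trans (normr_ge0 _) (vC 0); rewrite expr0 invr1 mulr1.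
(* Adding the tail 2 C 2^-n of the series of bounds makes the sequence nonincreasing. *)
pose w n := v n + 2 * C * 2 ^- n.
have half n : (2 : R) ^- n.+1 = 2 ^- n / 2 by rewrite exprS invfM mulrC.
have dec : nonincreasing_seq w.
  apply/nonincreasing_seqP => n; rewrite /w half.
  have := ler_normlW (vC n); lra.
have lb n : v 0 - 2 * C <= v n - 2 * C * 2 ^- n.
  elim: n => [|n IH]; first by rewrite expr0 invr1 mulr1.
  apply: le_trans IH _; rewrite half.
  have := vC n; rewrite ler_norml => /andP[+ _]; lra.
have cw : cvgn w.
  apply: nonincreasing_is_cvgn => //; exists (v 0 - 2 * C) => _ [n _ <-].
  apply: le_trans (lb n) _; rewrite /w.
  have : 0 <= 2 * C * 2 ^- n by rewrite !mulr_ge0// invr_ge0 exprn_ge0.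
  lra.
have c2 : (2 * C * 2 ^- n) @[n --> \oo] --> (0 : R).
  by rewrite -[X in _ --> X](mulr0 (2 * C)); apply: cvgM; [exact: cvg_cst|exact: cvg_expn2V].
rewrite (_ : v = fun n => w n - 2 * C * 2 ^- n); last first.
  by apply/funext => n; rewrite /w addrK.
by apply: is_cvgB => //; apply/cvg_ex; exists 0.
Qed.

Lemma sum_expn4V_le N : \sum_(0 <= n < N) (4 ^- n : R) <= 2.
Proof.
suff : \sum_(0 <= n < N) (4 ^- n : R) <= 2 - 2 * 4 ^- N.
  by move=> /le_trans; apply; rewrite gerBl mulr_ge0// invr_ge0 exprn_ge0.
elim: N => [|N IH]; first by rewrite big_nil expr0 invr1; lra.
rewrite big_nat_recr//=.
have -> : (4 : R) ^- N.+1 = 4 ^- N / 4 by rewrite exprS invfM mulrC.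
have : (0 : R) < 4 ^- N by rewrite invr_gt0 exprn_gt0.
lra.
Qed.

(* The weights 4^n make the sum of the integrals finite while its finiteness at x
   gives increments O(2^-n) at x. *)
Section rapid_sequence.
Variable h : nat -> L2.
Hypothesis hC : forall n, L2norm (h n.+1 - h n) <= 4 ^- n.

Let a n (x : R) : R := 4 ^+ n * normc (h n.+1 x - h n x) ^+ 2.

Let ma n : measurable_fun [set: R] (a n).
Proof.
apply: measurable_funM => //; apply: measurable_N2; apply: mcpx_B; exact: L2_mcpx.
Qed.

Let a0 n x : 0 <= a n x.
Proof. by rewrite mulr_ge0 ?sqr_ge0 ?exprn_ge0. Qed.

Let S (x : R) : \bar R := (\sum_(n <oo) (a n x)%:E)%E.

Let mS : measurable_fun [set: R] S.
Proof.
apply: (@ge0_emeasurable_sum _ _ _ _ (fun n x => (a n x)%:E) xpredT) => //.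
- by move=> k x _ _; rewrite lee_fin.
- by move=> k _; apply/measurable_EFinP.
Qed.

Let S0 x : (0 <= S x)%E.
Proof. by apply: nneseries_ge0 => n _ _; rewrite lee_fin. Qed.

Let int_a n : (\int[mu]_x (a n x)%:E <= (4 ^- n)%:E)%E.
Proof.
have E : {ae mu, forall x, h n.+1 x - h n x = L2val (h n.+1 - h n) x}.
  by apply: ae_imp (L2subE (h n.+1) (h n)) => x ->.
rewrite /a; under eq_integral do rewrite EFinM.
have mN : measurable_complex (fun x => h n.+1 x - h n x).
  by apply: mcpx_B; exact: L2_mcpx.
rewrite ge0_integralZl//; [|apply: measurable_EFin; exact: measurable_N2
  |by move=> x _; rewrite lee_fin sqr_ge0].
rewrite -/(N2 (fun x => h n.+1 x - h n x)) (N2_ae _ _ E); last 2 first.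
- by apply: mcpx_B; exact: L2_mcpx.
- exact: L2_mcpx.
rewrite N2_nsq -EFinM lee_fin -sqr_L2norm.
apply: (@le_trans _ _ (4 ^+ n * (4 ^- n) ^+ 2)).
  by rewrite ler_wpM2l ?exprn_ge0// lerXn2r ?nnegrE ?L2norm_ge0 ?invr_ge0 ?exprn_ge0 ?hC.
by rewrite expr2 mulrA mulfV ?mul1r// expf_neq0// pnatr_eq0.
Qed.

Let S_fin : {ae mu, forall x, S x \is a fin_num}.
Proof.
have iS : mu.-integrable [set: R] S.
  apply/integrableP; split=> //.
  apply: (@le_lt_trans _ _ 2%:E); last by rewrite ltry.
  under eq_integral do rewrite gee0_abs//.
  rewrite /S integral_nneseries//; [|by move=> n; exact: measurable_EFin|by move=> n x _; rewrite lee_fin].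
  apply: lime_le.
    by apply: is_cvg_nneseries => n _ _; apply: integral_ge0 => x _; rewrite lee_fin.
  apply: nearW => N.
  apply: (@le_trans _ _ (\sum_(0 <= n < N) (4 ^- n)%:E)%E).
    by apply: lee_sum => n _; exact: int_a.
  by rewrite sumEFin lee_fin sum_expn4V_le.
by apply: ae_imp (integrable_ae measurableT iS) => x; apply.
Qed.

Let D : set R := [set x | S x \is a fin_num].

Let mD : measurable D.
Proof.
have := emeasurable_fin_num measurableT mS.
by rewrite setTI.
Qed.

Let increments x : D x -> exists C : R, forall n, normc (h n.+1 x - h n x) <= C * 2 ^- n.
Proof.
move=> Dx; exists (Num.sqrt (fine (S x))) => n.
have le : a n x <= fine (S x).
  rewrite -lee_fin fineK//.
  have := @nneseries_lim_ge R (fun n => (a n x)%:E) xpredT 0 n.+1.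
  have pos k : (0 <= (a k x)%:E)%E by rewrite lee_fin.
  move=> /(_ (fun k _ _ => pos k)); apply: le_trans.
  rewrite big_nat_recr//= leeDr//; apply: sume_ge0 => i _; exact: pos.
rewrite -(ler_pXn2r (n := 2)) ?nnegrE ?normc_ge0 ?mulr_ge0 ?sqrtr_ge0 ?invr_ge0 ?exprn_ge0//.
rewrite exprMn sqr_sqrtr ?fine_ge0// exprVn -exprM mulnC exprM.
have -> : (2 : R) ^+ 2 = 4 by rewrite expr2; lra.
by rewrite ler_pdivlMr ?exprn_gt0// mulrC.
Qed.

(** Applied to Re and Im. Setting the sequence to 0 off the measurable set D makes it converge
    everywhere, so that its limit is measurable. *)
Let component (p : R[i] -> R) : (forall z z', `|p z - p z'| <= normc (z - z')) ->
  (forall n, measurable_fun [set: R] (fun x => p (h n x))) ->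
  exists2 v : R -> R, measurable_fun [set: R] v &
   forall x, D x -> p (h n x) @[n --> \oo] --> v x.
Proof.
move=> pl mp.
pose G n x := if x \in D then p (h n x) else 0.
have mG n : measurable_fun [set: R] (G n).
  have := (measurable_restrictT (fun x => p (h n x)) mD).1 (measurable_funTS (mp n)).
  by congr measurable_fun; apply/funext => x; rewrite patchE.
have cG x : cvgn (G^~ x).
  rewrite /G; case: (boolP (x \in D)) => [/set_mem Dx|_]; last exact: is_cvg_cst.
  have [C HC] := increments Dx.
  apply: (@cvg_geometric_increments _ C) => n; exact: le_trans (pl _ _) (HC n).
exists (fun x => limn (G^~ x)).
  apply: (@measurable_fun_cvg _ _ _ _ G) => // x _; exact: cG.
move=> x Dx; have := cG x; rewrite /G.
by rewrite mem_set.
Qed.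

Lemma rapid_ae_limit : exists2 u : R -> R[i], measurable_complex u &
  {ae mu, forall x, normc (h n x - u x) @[n --> \oo] --> (0 : R)}.
Proof.
have [|n|v mv cv] := @component (@complex.Re R).
- by move=> z z'; rewrite -cReN -cReD; exact: normc_Re.
- by have [] := L2_mcpx (h n).
have [|n|w mw cw] := @component (@complex.Im R).
- by move=> z z'; rewrite -cImN -cImD; exact: normc_Im.
- by have [] := L2_mcpx (h n).
exists (fun x => v x +i* w x); first by split.
apply: ae_imp S_fin => x Dx.
have c1 : (`|Re (h n x) - v x| + `|Im (h n x) - w x|) @[n --> \oo] --> (0 : R).
  rewrite -[X in _ --> X]addr0; apply: cvgD.
    exact: cvg_dist0 (cv x Dx).
  exact: cvg_dist0 (cw x Dx).
apply: (squeeze_cvgr _ (cvg_cst 0) c1); apply: nearW => n.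
rewrite normc_ge0; apply: le_trans (normc_ReIm _) _.
by rewrite cReD cImD cReN cImN.
Qed.

End rapid_sequence.

Lemma L2_complete (f_ : nat -> L2) :
  (forall e, 0 < e -> exists N, forall m n, (N <= m)%N -> (N <= n)%N ->
     L2norm (f_ m - f_ n) <= e) ->
  exists f, L2cvg f_ f.
Proof.
move=> cau.
have /choice[k Hk] : forall n : nat, exists N, forall m m', (N <= m)%N -> (N <= m')%N ->
    L2norm (f_ m - f_ m') <= 4 ^- n.
  by move=> n; apply: cau; rewrite invr_gt0 exprn_gt0.
(* Partial sums make the extracted indices nondecreasing and keep them above [k n]. *)
pose K n := (\sum_(i < n.+1) k i)%N.
have kK n : (k n <= K n)%N by rewrite /K big_ord_recr /= leq_addl.
have KS n : (K n <= K n.+1)%N by rewrite /K [leqRHS]big_ord_recr /= leq_addr.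
have HK n m : (K n <= m)%N -> L2norm (f_ m - f_ (K n)) <= 4 ^- n.
  by move=> nm; apply: Hk => //; exact: leq_trans (kK n) nm.
have [u mu' cu] := @rapid_ae_limit (f_ \o K) (fun n => HK n _ (KS n)).
have Kmono n j : (K n <= K (j + n))%N.
  by elim: j => // j IH; rewrite addSn; exact: leq_trans IH (KS _).
(* Fatou's lemma in j: [f_ (K (j + n))] tends to u almost everywhere and stays within 4^-n + 4^-n of
   [f_ m], by passing through [f_ (K n)]. *)
have B n m : (K n <= m)%N -> (N2 (fun x => f_ m x - u x)%R <= ((4 ^- n *+ 2) ^+ 2)%:E)%E.
  move=> nm.
  apply: (@fatou_le _ (fun j x => normc (f_ m x - f_ (K (j + n)%N) x) ^+ 2)).
  - move=> j; apply: measurable_N2; by apply: mcpx_B; exact: L2_mcpx.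
  - by apply: measurable_N2; apply: mcpx_B => //; exact: L2_mcpx.
  - by move=> j x; exact: sqr_ge0.
  - apply: ae_imp cu => x cx.
    have cx' : normc ((f_ (K (j + n)%N)) x - u x) @[j --> \oo] --> (0 : R).
      by rewrite (@cvg_shiftn n _ (fun i => normc ((f_ \o K) i x - u x))).
    have H : normc (f_ m x - f_ (K (j + n)%N) x) @[j --> \oo] --> normc (f_ m x - u x).
      apply/cvgrPdist_le => e e0; move/cvgr0Pnorm_le: cx' => /(_ e e0).
      apply: filterS => j; rewrite ger0_norm ?normc_ge0//; apply: le_trans.
      rewrite ler_norml; have H1 := normcD_le (f_ m x - f_ (K (j + n)%N) x) (f_ (K (j + n)%N) x - u x).
      have H2 := normcD_le (f_ m x - u x) (u x - f_ (K (j + n)%N) x).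
      move: H1 H2; rewrite !subrKA -(cnormN (u x - _)) opprB => H1 H2.
      by apply/andP; split; lra.
    rewrite !expr2; exact: cvgM.
  - move=> j.
    have E : {ae mu, forall x, f_ m x - f_ (K (j + n)%N) x = L2val (f_ m - f_ (K (j + n)%N)) x}.
      by apply: ae_imp (L2subE (f_ m) (f_ (K (j + n)%N))) => x ->.
    rewrite -/(N2 (fun x => f_ m x - f_ (K (j + n)%N) x)) (N2_ae _ _ E); last 2 first.
    + by apply: mcpx_B; exact: L2_mcpx.
    + exact: L2_mcpx.
    rewrite N2_nsq lee_fin -sqr_L2norm.
    rewrite lerXn2r ?nnegrE ?L2norm_ge0 ?mulrn_wge0 ?invr_ge0 ?exprn_ge0//.
    apply: le_trans (L2norm_dist _ (f_ (K n)) _) _; rewrite mulr2n; apply: lerD.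
      exact: HK.
    by rewrite L2norm_sub; exact: HK.
have mfu m : measurable_complex (fun x => f_ m x - u x).
  by apply: mcpx_B => //; exact: L2_mcpx.
have u2 : u \in L2fun.
  have d2 : (fun x => f_ (K 0) x - u x) \in L2fun.
    apply/L2funP; split=> //; apply: le_lt_trans (B 0 _ (leqnn _)) _; exact: ltry.
  have [_ H] := @L2fun_submod_closed R.
  (* One term of the sequence minus its difference with u: both are square integrable. *)
  have uE : u = (-1) *: (fun x => f_ (K 0) x - u x) + L2val (f_ (K 0)).
    apply/funext => x.
    by rewrite -[RHS]/(-1 * (f_ (K 0) x - u x) + f_ (K 0) x); ring.
  by rewrite uE; exact: (H (-1) _ _ d2 (L2valP (f_ (K 0)))).
exists (L2class u); rewrite /L2cvg.
apply/cvgr0Pnorm_le => e e0.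
have /cvgr0Pnorm_le : (4 ^- n *+ 2 : R) @[n --> \oo] --> (0 : R).
  rewrite (_ : (fun n => _) = fun n => (2 ^- n * 2 ^- n) *+ 2); last first.
    apply/funext => n; congr (_ *+ 2); rewrite -invfM -exprMn; congr (_ ^- n); lra.
  rewrite -[X in _ --> X](mul0rn _ 2); apply: cvgMn.
  by rewrite -[X in _ --> X](mulr0 0); apply: cvgM; exact: cvg_expn2V.
move=> /(_ e e0) [N _ HN].
exists (K N) => // m /= Nm.
rewrite ger0_norm ?L2norm_ge0//.
have E : {ae mu, forall x, L2val (f_ m - L2class u) x = f_ m x - u x}.
  by apply: ae_imp2 (L2subE (f_ m) (L2class u)) (L2class_ae u2) => x -> ->.
have := B N m Nm; rewrite -(N2_ae _ _ E)//; last exact: L2_mcpx.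
rewrite N2_nsq lee_fin -sqr_L2norm.
rewrite ler_pXn2r ?nnegrE ?L2norm_ge0 ?mulrn_wge0 ?invr_ge0 ?exprn_ge0//.
move=> le; apply: le_trans le _; apply: le_trans (ler_norm _) _; exact: (HN N (leqnn N)).
Qed.

End Completeness.

(** * Extension of the Fourier transform to L2, and its adjoint *)

Section Plancherel.
Context {R : realType}.
Local Notation mu := (leb R).
Local Notation L2 := (L2 R).
Implicit Types (f g h : L2) (u v : R -> R[i]) (z : R[i]).

Lemma ae_and (P Q : R -> Prop) : {ae mu, forall x, P x} ->
  {ae mu, forall x, Q x} -> {ae mu, forall x, P x /\ Q x}.
Proof. by apply: ae_imp2. Qed.

Definition cc : R := (Num.sqrt (2 * pi))^-1.

Lemma twopi_gt0 : 0 < 2 * pi :> R.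
Proof. by rewrite mulr_gt0// pi_gt0. Qed.

Lemma cc_gt0 : 0 < cc.
Proof. by rewrite invr_gt0 sqrtr_gt0 twopi_gt0. Qed.

Lemma sqr_cc : cc ^+ 2 = (2 * pi)^-1.
Proof. by rewrite exprVn sqr_sqrtr// ltW// twopi_gt0. Qed.

Lemma cL1_ae u v : measurable_complex v -> {ae mu, forall x, u x = v x} ->
  cL1 u -> cL1 v.
Proof.
have H (p q : R -> R) : measurable_fun [set: R] q -> {ae mu, forall x, p x = q x} ->
    rL1 p -> rL1 q.
  move=> mq pq /[dup] /L1_measurable mp /integrableP[_ pi].
  apply/integrableP; split; first exact/measurable_EFinP.
  apply: le_lt_trans pi; rewrite le_eqVlt; apply/orP; left; apply/eqP.
  apply: ae_eq_integral => //.
  - by apply: measurable_EFin; exact: measurableT_comp.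
  - by apply: measurable_EFin; exact: measurableT_comp.
  - by apply: ae_imp pq => x /= ->.
move=> [vr vi] uv [ur ui]; split.
  by apply: H ur => //; apply: ae_imp uv => x ->.
by apply: H ui => //; apply: ae_imp uv => x ->.
Qed.

Lemma FT_ae u v xi : measurable_complex u -> measurable_complex v ->
  {ae mu, forall x, u x = v x} -> FT u xi = FT v xi.
Proof.
move=> mu' mv uv; apply: cint_ae.
- by apply: mcpx_M => //; exact: mcpx_expiMN.
- by apply: mcpx_M => //; exact: mcpx_expiMN.
- by apply: ae_imp uv => x ->.
Qed.

Lemma fourier_truncE n u xi : fourier_trunc n u xi = cc%:C * FT (ctrunc n u) xi.
Proof.
rewrite /fourier_trunc -/cc; congr (_ * _); apply: cplx_ext.
  rewrite /cintegral [LHS]/= Rintegral_mkcond Re_cint; apply: eq_Rintegral => x _.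
  rewrite patchE /ctrunc /chi indicE.
  by case: (_ \in _); rewrite ?mulr1// mulr0 mul0r.
rewrite /cintegral [LHS]/= Rintegral_mkcond Im_cint; apply: eq_Rintegral => x _.
rewrite patchE /ctrunc /chi indicE.
by case: (_ \in _); rewrite ?mulr1// mulr0 mul0r.
Qed.

(** Meant for f in both L1 and L2: Plancherel's inequality then excludes the default of
    [L2class]. *)
Definition F1 f : L2 := L2class (fun xi => cc%:C * FT f xi).

Lemma F1_L2 u : cL1 u -> u \in L2fun -> (fun xi => cc%:C * FT u xi) \in L2fun.
Proof.
move=> u1 u2; apply/L2funP; split.
  by apply: mcpx_M; [exact: mcpx_cst|exact: FT_mcpx].
rewrite /N2; under eq_integral do rewrite cnormM normc_real exprMn EFinM.
rewrite ge0_integralZl//; last 2 first.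
- by apply: measurable_EFin; apply: measurable_N2; exact: FT_mcpx.
- by move=> x _; rewrite lee_fin sqr_ge0.
apply: lte_mul_pinfty; rewrite ?lee_fin ?sqr_ge0//.
apply: le_lt_trans (N2_FT_le u1) _; rewrite N2_fin// -EFinM; exact: ltry.
Qed.

Lemma F1E f : cL1 f -> {ae mu, forall xi, F1 f xi = cc%:C * FT f xi}.
Proof. by move=> f1; apply: L2class_ae; apply: F1_L2 => //; exact: L2valP. Qed.

Lemma F1_norm f : cL1 f -> L2norm (F1 f) <= L2norm f.
Proof.
move=> f1; rewrite !L2normE ler_wsqrtr// -lee_fin -!N2_nsq.
rewrite (N2_ae _ _ (F1E f1)); last 2 first.
- exact: L2_mcpx.
- by apply: mcpx_M; [exact: mcpx_cst|exact: FT_mcpx].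
rewrite /N2; under eq_integral do rewrite cnormM normc_real exprMn EFinM.
rewrite ge0_integralZl//; last 2 first.
- by apply: measurable_EFin; apply: measurable_N2; exact: FT_mcpx.
- by move=> x _; rewrite lee_fin sqr_ge0.
rewrite real_normK ?num_real// sqr_cc.
apply: (@le_trans _ _ (((2 * pi)^-1)%:E * ((2 * pi)%:E * N2 f))%E).
  by rewrite lee_pmul2l ?lte_fin ?invr_gt0 ?twopi_gt0//; exact: N2_FT_le.
by rewrite muleA -EFinM mulVf ?mul1e// gt_eqF// twopi_gt0.
Qed.

Lemma FT_linear z u v xi : cL1 u -> cL1 v ->
  FT (fun x => z * u x + v x) xi = z * FT u xi + FT v xi.
Proof.
move=> u1 v1; rewrite /FT -cintZ; last exact: cL1_expi.
rewrite -cintD; [|by apply: cL1Z; exact: cL1_expi|exact: cL1_expi].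
by congr cint; apply/funext => x; rewrite mulrDl mulrA.
Qed.

Lemma L2linE z f g : {ae mu, forall x, L2val (z *: f + g) x = z * f x + g x}.
Proof. by apply: ae_imp2 (L2addE (z *: f) g) (L2scaleE z f) => x -> ->. Qed.

Lemma cL1_lin z f g : cL1 f -> cL1 g -> cL1 (L2val (z *: f + g)).
Proof.
move=> f1 g1; apply: (@cL1_ae (fun x => z * f x + g x)); first exact: L2_mcpx.
  by apply: ae_imp (L2linE z f g) => x ->.
by apply: cL1D => //; exact: cL1Z.
Qed.

Lemma F1_linear z f g : cL1 f -> cL1 g -> F1 (z *: f + g) = z *: F1 f + F1 g.
Proof.
move=> f1 g1; apply: L2_eq.
have E xi : FT (L2val (z *: f + g)) xi = z * FT f xi + FT g xi.
  rewrite -FT_linear//; apply: FT_ae; [exact: L2_mcpx| |exact: L2linE].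
  by apply: cL1_mcpx; apply: cL1D => //; exact: cL1Z.
have H := ae_imp3 _ (F1E (cL1_lin z f1 g1)) (L2linE z (F1 f) (F1 g)) (F1E f1).
apply: (ae_imp2 _ (F1E g1) (H (fun xi => L2val (F1 (z *: f + g)) xi =
   cc%:C * (z * FT f xi + FT g xi) /\
   L2val (z *: F1 f + F1 g) xi = z * (cc%:C * FT f xi) + F1 g xi) _)).
  by move=> xi g' [-> ->]; rewrite g'; ring.
by move=> xi -> -> ->; rewrite E.
Qed.

Lemma L2trunc_L1 n f : cL1 (L2trunc n f).
Proof.
apply: (@cL1_ae (ctrunc n f)); first exact: L2_mcpx.
  by apply: ae_imp (L2truncE n f) => x ->.
by apply: ctrunc_L1; exact: L2valP.
Qed.

Lemma L2trunc_linear n z f g :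
  L2trunc n (z *: f + g) = z *: L2trunc n f + L2trunc n g.
Proof.
apply: L2_eq.
have H := ae_imp3 _ (L2truncE n f) (L2linE z (L2trunc n f) (L2trunc n g)) (L2linE z f g).
apply: (ae_imp3 _ (L2truncE n (z *: f + g)) (L2truncE n g) (H (fun x =>
   L2val (z *: L2trunc n f + L2trunc n g) x = z * ctrunc n f x + L2trunc n g x /\
   L2val (z *: f + g) x = z * f x + g x) _)).
  by move=> x -> -> [-> E]; rewrite /ctrunc E; ring.
by move=> x -> -> ->.
Qed.

Lemma subZ1 f g : f - g = (-1) *: g + f.
Proof. by rewrite scaleN1r addrC. Qed.

Lemma F1B f g : cL1 f -> cL1 g -> F1 (f - g) = F1 f - F1 g.
Proof. by move=> f1 g1; rewrite !subZ1 F1_linear. Qed.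

Lemma cL1B f g : cL1 f -> cL1 g -> cL1 (L2val (f - g)).
Proof. by move=> f1 g1; rewrite subZ1; exact: cL1_lin. Qed.

(** Truncations of f lie in L1 and L2, so the truncated integrals of [is_fourier] are
    representatives of their images under [F1]; squared norms tend to 0 exactly when the norms
    do. *)
Lemma is_fourierP f g :
  is_fourier f g <-> L2cvg (fun n => F1 (L2trunc n f)) g.
Proof.
have E n : (\int[mu]_xi ((normc (fourier_trunc n f xi - g xi)) ^+ 2)%:E)%E =
    (L2norm (F1 (L2trunc n f) - g) ^+ 2)%:E.
  rewrite sqr_L2norm -N2_nsq; apply: N2_ae; last 1 first.
  - apply: ae_imp2 (L2subE (F1 (L2trunc n f)) g) (F1E (L2trunc_L1 n f)) => xi -> ->.
    rewrite fourier_truncE; congr (_ * _ - _); apply: FT_ae; last 1 first.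
    + by apply: ae_imp (L2truncE n f) => x ->.
    + by apply: L2fun_mcpx; apply: ctrunc_L2; exact: L2valP.
    + exact: L2_mcpx.
  - apply: mcpx_B; last exact: L2_mcpx.
    rewrite (_ : fourier_trunc n f = fun xi => cc%:C * FT (ctrunc n f) xi).
      apply: mcpx_M; [exact: mcpx_cst|apply: FT_mcpx].
      by apply: ctrunc_L1; exact: L2valP.
    by apply/funext => xi; rewrite fourier_truncE.
  - exact: L2_mcpx.
rewrite /is_fourier (_ : (fun n => _) = fun n => (L2norm (F1 (L2trunc n f) - g) ^+ 2)%:E); last first.
  by apply/funext => n; exact: E.
split=> [/fine_cvgP[_ /= H]|H].
  rewrite /L2cvg (_ : (fun n => _) = fun n => Num.sqrt (L2norm (F1 (L2trunc n f) - g) ^+ 2)).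
    by rewrite -sqrtr0; exact: (cvg_comp _ _ H (@sqrt_continuous R 0)).
  by apply/funext => n; rewrite sqrtr_sqr ger0_norm ?L2norm_ge0.
apply: cvg_EFin; first exact: nearW.
by rewrite -[X in _ --> X](mul0r 0) /comp /=; under eq_fun do rewrite expr2; exact: cvgM.
Qed.

Lemma L2cvg_cauchy (f_ : nat -> L2) f : L2cvg f_ f ->
  forall e, 0 < e -> exists N, forall m n, (N <= m)%N -> (N <= n)%N ->
     L2norm (f_ m - f_ n) <= e.
Proof.
move=> /cvgr0Pnorm_le cf e e0.
have [N _ HN] := cf (e / 2) (divr_gt0 e0 (ltr0n _ 2)).
exists N => m n Nm Nn; apply: le_trans (L2norm_dist _ f _) _.
rewrite [X in _ + X]L2norm_sub [leRHS]splitr; apply: lerD.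
  by apply: le_trans (ler_norm _) (HN m Nm).
by apply: le_trans (ler_norm _) (HN n Nn).
Qed.

(** [F1] does not increase norms, hence maps the truncations of f to a Cauchy sequence. Therefore
    [fourier] never takes the default of [xget]. *)
Lemma fourier_exists f : exists g, is_fourier f g.
Proof.
suff [g Hg] : exists g, L2cvg (fun n => F1 (L2trunc n f)) g.
  by exists g; apply/is_fourierP.
apply: L2_complete => e e0; have [N HN] := L2cvg_cauchy (cvg_L2trunc f) e0.
exists N => m n Nm Nn; rewrite -F1B; try exact: L2trunc_L1.
by apply: le_trans (F1_norm _) (HN m n Nm Nn); apply: cL1B; exact: L2trunc_L1.
Qed.

Lemma cvg_fourier f : L2cvg (fun n => F1 (L2trunc n f)) (fourier f).
Proof.
by apply/is_fourierP; have [g Hg] := fourier_exists f; exact: (xgetPex 0 (ex_intro _ g Hg)).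
Qed.

Lemma L2cvg_of_le (f_ : nat -> L2) f (b : nat -> R) :
  (forall n, L2norm (f_ n - f) <= b n) -> b n @[n --> \oo] --> (0 : R) -> L2cvg f_ f.
Proof.
move=> le cb; apply: (squeeze_cvgr _ (cvg_cst 0) cb); apply: nearW => n.
by rewrite L2norm_ge0 le.
Qed.

Lemma L2cvg_lin z (f_ g_ : nat -> L2) f g : L2cvg f_ f -> L2cvg g_ g ->
  L2cvg (fun n => z *: f_ n + g_ n) (z *: f + g).
Proof.
move=> cf cg; apply: (@L2cvg_of_le _ _ (fun n => normc z * L2norm (f_ n - f) + L2norm (g_ n - g))).
  by move=> n; rewrite opprD addrACA -scalerBr -L2normZ; exact: L2normD.
rewrite -[X in _ --> X](addr0 0) -[X in _ --> X + _](mulr0 (normc z)).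
by apply: cvgD => //; apply: cvgM => //; exact: cvg_cst.
Qed.

Lemma fourier_linear z f g : fourier (z *: f + g) = z *: fourier f + fourier g.
Proof.
apply: (L2cvg_unique (cvg_fourier _)).
rewrite (_ : (fun n => _) = (fun n => z *: F1 (L2trunc n f) + F1 (L2trunc n g))); last first.
  by apply/funext => n; rewrite L2trunc_linear F1_linear//; exact: L2trunc_L1.
by apply: L2cvg_lin; exact: cvg_fourier.
Qed.

Lemma fourierB f g : fourier (f - g) = fourier f - fourier g.
Proof. by rewrite !subZ1 fourier_linear. Qed.

Lemma L2cvg_norm_le (f_ : nat -> L2) f (M : R) : L2cvg f_ f ->
  (forall n, L2norm (f_ n) <= M) -> L2norm f <= M.
Proof.
move=> cf le.
have H : (M + L2norm (f_ n - f)) @[n --> \oo] --> M.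
  by rewrite -[X in _ --> X]addr0; apply: cvgD => //; exact: cvg_cst.
apply: (ler_cvg_to (cvg_cst _) H); apply: nearW => n.
have := L2norm_dist f (f_ n) 0; rewrite !subr0 L2norm_sub => /le_trans; apply.
by rewrite addrC lerD2r.
Qed.

Lemma L2trunc_norm n f : L2norm (L2trunc n f) <= L2norm f.
Proof.
rewrite !L2normE ler_wsqrtr// -lee_fin -!N2_nsq (N2_ae _ _ (L2truncE n f)); last 2 first.
- exact: L2_mcpx.
- by apply: L2fun_mcpx; apply: ctrunc_L2; exact: L2valP.
apply: N2_le; last 1 first.
- by move=> x; rewrite cnormM ler_piMr ?normc_ge0 ?normc_chi_le1.
- by apply: L2fun_mcpx; apply: ctrunc_L2; exact: L2valP.
- exact: L2_mcpx.
Qed.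

Lemma fourier_norm_le f : L2norm (fourier f) <= L2norm f.
Proof.
apply: L2cvg_norm_le (cvg_fourier f) _ => n.
exact: le_trans (F1_norm (L2trunc_L1 n f)) (L2trunc_norm n f).
Qed.

Lemma fourier_F1 f : cL1 f -> fourier f = F1 f.
Proof.
move=> f1; apply: (L2cvg_unique (cvg_fourier f)).
apply: (L2cvg_of_le _ (cvg_L2trunc f)) => n.
rewrite -F1B//; last exact: L2trunc_L1.
by apply: F1_norm; apply: cL1B => //; exact: L2trunc_L1.
Qed.

Lemma fourierE f : cL1 f -> {ae mu, forall xi, fourier f xi = cc%:C * FT f xi}.
Proof. by move=> f1; rewrite fourier_F1//; exact: F1E. Qed.

(** The Lipschitz condition, rather than bounded linearity, also covers the antilinear
    conjugation. *)
Definition lipschitz_L2 (S : L2 -> L2) := exists C : R,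
  forall f g, L2norm (S f - S g) <= C * L2norm (f - g).

Lemma L2cvg_lipschitz S (f_ : nat -> L2) f : lipschitz_L2 S -> L2cvg f_ f ->
  L2cvg (fun n => S (f_ n)) (S f).
Proof.
move=> [C HC] cf; apply: (L2cvg_of_le (fun n => HC (f_ n) f)).
by rewrite -[X in _ --> X](mulr0 C); apply: cvgM => //; exact: cvg_cst.
Qed.

(** Truncations make L1 dense in L2: identities between continuous operators need checking only
    where the transform is an integral. *)
Lemma lipschitz_eq S U : lipschitz_L2 S -> lipschitz_L2 U ->
  (forall f, cL1 f -> S f = U f) -> forall f, S f = U f.
Proof.
move=> lS lU SU f; have c1 := L2cvg_lipschitz lS (cvg_L2trunc f).
apply: (L2cvg_unique c1).
rewrite (_ : (fun n => _) = (fun n => U (L2trunc n f))); last first.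
  by apply/funext => n; rewrite SU//; exact: L2trunc_L1.
exact: L2cvg_lipschitz lU (cvg_L2trunc f).
Qed.

Lemma lipschitz_comp S U : lipschitz_L2 S -> lipschitz_L2 U -> lipschitz_L2 (S \o U).
Proof.
move=> [C HC] [D HD]; exists (`|C| * D) => f g /=.
apply: le_trans (HC _ _) _; rewrite -mulrA.
apply: (@le_trans _ _ (`|C| * L2norm (U f - U g))).
  by rewrite ler_wpM2r ?L2norm_ge0// ler_norm.
by rewrite ler_wpM2l.
Qed.

Lemma lipschitz_fourier : lipschitz_L2 fourier.
Proof. by exists 1 => f g; rewrite mul1r -fourierB fourier_norm_le. Qed.

Definition L2conj f : L2 := L2class (fun x => conjc (f x)).

Lemma L2conjE f : {ae mu, forall x, L2conj f x = conjc (f x)}.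
Proof. by apply: L2class_ae; apply: L2_J; exact: L2valP. Qed.

Lemma L2conjK f : L2conj (L2conj f) = f.
Proof.
apply: L2_eq; apply: ae_imp2 (L2conjE (L2conj f)) (L2conjE f) => x -> ->.
exact: cJK.
Qed.

Lemma L2conjB f g : L2conj (f - g) = L2conj f - L2conj g.
Proof.
apply: L2_eq.
have H := ae_and (L2conjE f) (ae_and (L2conjE g) (L2subE f g)).
apply: ae_imp3 (L2conjE (f - g)) (L2subE (L2conj f) (L2conj g)) H.
by move=> x -> -> [-> [-> ->]]; rewrite cJB.
Qed.

Lemma L2conj_norm f : L2norm (L2conj f) = L2norm f.
Proof.
rewrite !L2normE; congr Num.sqrt; apply: Rint_ae.
- by apply: measurable_N2; exact: L2_mcpx.
- by apply: measurable_N2; exact: L2_mcpx.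
- by apply: ae_imp (L2conjE f) => x ->; rewrite cnormJ.
Qed.

Lemma lipschitz_conj : lipschitz_L2 L2conj.
Proof. by exists 1 => f g; rewrite mul1r -L2conjB L2conj_norm. Qed.

Lemma cL1_conj f : cL1 f -> cL1 (L2conj f).
Proof.
move=> f1; apply: (@cL1_ae (fun x => conjc (f x))); first exact: L2_mcpx.
  by apply: ae_imp (L2conjE f) => x ->.
exact: cL1J.
Qed.

(** Conjugating before and after changes the sign in the exponential: this is the inverse transform,
    first obtained as the adjoint. *)
Definition Fadj f : L2 := L2conj (fourier (L2conj f)).

Lemma lipschitz_Fadj : lipschitz_L2 Fadj.
Proof.
apply: (lipschitz_comp lipschitz_conj).
exact: (lipschitz_comp lipschitz_fourier lipschitz_conj).
Qed.

Lemma L2inner_ae f g u v : u \in L2fun -> v \in L2fun ->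
  {ae mu, forall x, f x = u x} -> {ae mu, forall x, g x = v x} ->
  L2inner f g = cint (fun x => u x * conjc (v x)).
Proof.
move=> u2 v2 fu gv; rewrite L2innerE; apply: cint_ae.
- by apply: cL1_mcpx; exact: L2inner_L1.
- by apply: cL1_mcpx; exact: L2M_L1.
- by apply: ae_imp2 fu gv => x -> ->.
Qed.

Lemma fourier_adjoint_L1 f g : cL1 f -> cL1 g ->
  L2inner (fourier f) g = L2inner f (Fadj g).
Proof.
move=> f1 g1.
rewrite (@L2inner_ae _ _ (fun xi => cc%:C * FT f xi) g); last 4 first.
- by apply: F1_L2 => //; exact: L2valP.
- exact: L2valP.
- exact: fourierE.
- exact: aeW.
have cg1 := cL1_conj g1.
rewrite (@L2inner_ae _ _ f (fun x => conjc (cc%:C * FT (L2conj g) x))); last 4 first.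
- exact: L2valP.
- by apply: L2_J; apply: F1_L2 => //; exact: L2valP.
- exact: aeW.
- apply: ae_imp2 (L2conjE (fourier (L2conj g))) (fourierE cg1) => x.
  by rewrite /Fadj => -> ->.
have gJ1 : cL1 (fun x => conjc (g x)) by exact: cL1J.
rewrite (_ : (fun x => cc%:C * FT f x * _) = (fun x => cc%:C * (FT f x * conjc (g x)))); last first.
  by apply/funext => x; rewrite mulrA.
rewrite cintZ; last exact: FT_L1M.
rewrite FT_mult//.
rewrite -cintZ; last first.
  by under eq_fun do rewrite mulrC; exact: FT_L1M.
congr cint; apply/funext => x; rewrite cJK mulrCA; congr (_ * (_ * _)).
apply: FT_ae; last 1 first.
- by apply: ae_imp (L2conjE g) => y ->.
- exact: cL1_mcpx.
- exact: L2_mcpx.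
Qed.

Lemma fourier_adjoint f g : L2inner (fourier f) g = L2inner f (Fadj g).
Proof.
(* Density is used once per argument: here for g' with f' integrable, and below for f. *)
have S1 f' g' : cL1 f' -> L2inner (fourier f') g' = L2inner f' (Fadj g').
  move=> f1; rewrite L2innerJ [RHS]L2innerJ; congr conjc.
  have c1 := L2cvg_inner (fourier f') (cvg_L2trunc g').
  have c2 := L2cvg_inner f' (L2cvg_lipschitz lipschitz_Fadj (cvg_L2trunc g')).
  apply: (cvg_normc_unique c1).
  rewrite (_ : (fun n => _) = (fun n =>
    normc (L2inner (Fadj (L2trunc n g')) f' - L2inner (Fadj g') f'))) //.
  apply/funext => n; congr (normc (_ - _)).
  rewrite [LHS]L2innerJ fourier_adjoint_L1//; last exact: L2trunc_L1.
  by rewrite -L2innerJ.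
have c1 := L2cvg_inner g (L2cvg_lipschitz lipschitz_fourier (cvg_L2trunc f)).
have c2 := L2cvg_inner (Fadj g) (cvg_L2trunc f).
apply: (cvg_normc_unique c1).
rewrite (_ : (fun n => _) = (fun n =>
    normc (L2inner (L2trunc n f) (Fadj g) - L2inner f (Fadj g)))) //.
by apply/funext => n; rewrite S1//; exact: L2trunc_L1.
Qed.

End Plancherel.

(** * Unitarity, translations and dilations *)

Section Unitarity.
Context {R : realType}.
Local Notation mu := (leb R).
Local Notation L2 := (L2 R).
Implicit Types (f g h : L2) (u v : R -> R[i]) (z : R[i]).

Definition L2chi (a b : R) : L2 := L2class (chi a b).

Lemma L2chiE a b : {ae mu, forall x, L2chi a b x = chi a b x}.
Proof. by apply: L2class_ae; exact: chi_L2. Qed.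

Lemma L2chi_L1 a b : cL1 (L2chi a b).
Proof.
apply: (@cL1_ae _ (chi a b)); [exact: L2_mcpx| |exact: cL1_chi].
by apply: ae_imp (L2chiE a b) => x ->.
Qed.

Lemma L2inner_chi f a b : L2inner f (L2chi a b) =
  (\int[mu]_(x in `[a, b]) Re (f x))%R +i* (\int[mu]_(x in `[a, b]) Im (f x))%R.
Proof.
rewrite (L2inner_ae (L2valP f) (chi_L2 a b) (aeW _ (fun=> erefl)) (L2chiE a b)).
apply: cplx_ext; rewrite !(Re_cint, Im_cint) [RHS]/= -Rint_indic.
  by apply: eq_Rintegral => x _; rewrite cReM cReJ cImJ !ReImV oppr0 mulr0 subr0.
by apply: eq_Rintegral => x _; rewrite cImM cReJ cImJ !ReImV oppr0 mulr0 add0r.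
Qed.

(** A square integrable function is locally integrable because |f| <= 1 + |f|^2, so vanishing
    integrals over intervals make it vanish almost everywhere. *)
Lemma L2_eq0_chi f : (forall a b, a < b -> L2inner f (L2chi a b) = 0) -> f = 0.
Proof.
move=> f0; apply: L2_eq.
have [mr mi] := L2_mcpx f.
have loc (p : R -> R) : measurable_fun [set: R] p -> (forall x, `|p x| <= normc (f x)) ->
    locally_integrable [set: R] p.
  move=> mp pf; split=> //; first exact: openT.
  move=> K _ cK; have mK : measurable K by exact: compact_measurable.
  apply: (@le_lt_trans _ _ (\int[mu]_(x in K) (1 + (normc (f x) ^+ 2)%:E))%E).
    apply: ge0_le_integral => //.
    - by apply: measurable_funTS; apply: measurable_EFin; exact: measurableT_comp.
    - apply: measurable_funTS; apply: emeasurable_funD => //.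
      by apply: measurable_EFin; apply: measurable_N2; exact: L2_mcpx.
    - move=> x _; rewrite -EFinD lee_fin; apply: le_trans (pf x) _.
      have amgm (a : R) : a <= 1 + a ^+ 2 by have := sqr_ge0 (a - 1); nra.
      exact: amgm.
  have mN : measurable_fun K (fun x => (normc (f x) ^+ 2)%:E).
    by apply: measurable_funTS; apply: measurable_EFin; apply: measurable_N2; exact: L2_mcpx.
  have p1 x : K x -> (0 <= (fun=> 1%E : \bar R) x)%E by [].
  have p2 x : K x -> (0 <= (normc (f x) ^+ 2)%:E)%E by move=> _; rewrite lee_fin sqr_ge0.
  have -> := ge0_integralD mu mK p1 (measurable_cst _) p2 mN.
  apply: lte_add_pinfty.
    by rewrite integral_cst// mul1e compact_finite_measure.
  apply: (@le_lt_trans _ _ (N2 f)); last by rewrite N2_nsq ltry.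
  apply: ge0_subset_integral => //.
    by apply: measurable_EFin; apply: measurable_N2; exact: L2_mcpx.
  by move=> x _; rewrite lee_fin sqr_ge0.
have hr := ae0_of_intervals (loc _ mr (fun x => normc_Re _)).
have hi := ae0_of_intervals (loc _ mi (fun x => normc_Im _)).
have {}hr : {ae mu, forall x, Re (f x) = 0}.
  by apply: hr => a b ab; have := f0 a b ab; rewrite L2inner_chi => -[].
have {}hi : {ae mu, forall x, Im (f x) = 0}.
  by apply: hi => a b ab; have := f0 a b ab; rewrite L2inner_chi => -[].
by apply: ae_imp3 hr hi L2zeroE => x rx ix ->; apply: cplx_ext.
Qed.

(** The damped pairing has two limits: the undamped one, by domination, as both transforms are
    square integrable; and 2 pi times the integral of f over [a, b], by [cvg_FT_chi]. The factor
    [cc ^+ 2] cancels 2 pi. *)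
Lemma fourier_inner_chi_L1 f a b : a < b -> cL1 f ->
  L2inner (fourier f) (fourier (L2chi a b)) = L2inner f (L2chi a b).
Proof.
move=> ab f1; have X1 := L2chi_L1 a b.
have Ff := F1_L2 f1 (L2valP f); have Fx := F1_L2 X1 (L2valP (L2chi a b)).
rewrite (L2inner_ae Ff Fx (fourierE f1) (fourierE X1)) L2inner_chi.
have FX xi : FT (L2chi a b) xi = FT (chi a b) xi.
  by apply: FT_ae; [exact: L2_mcpx|exact: mcpx_chi|exact: L2chiE].
have cc0 : (cc : R) != 0 by rewrite gt_eqF// cc_gt0.
have cL := L2M_L1 Ff Fx.
pose X := cint (fun x => FT f x * conjc (FT (chi a b) x)).
have L1X : cL1 (fun x => FT f x * conjc (FT (chi a b) x)).
  have := cL1Z ((cc ^-2)%:C) cL; congr cL1; apply/funext => x.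
  rewrite FX cJM conjc_real.
  have -> : (cc ^- 2)%:C = (cc%:C^-1 * cc%:C^-1 : R[i]).
    by rewrite -invfM -rmorphM -fmorphV.
  have c0 : cc%:C != 0 :> R[i] by rewrite -(rmorph0 (real_complex R)) (inj_eq (@complexI R)).
  by field.
transitivity ((cc ^+ 2)%:C * X).
  rewrite -cintZ//; congr cint; apply/funext => x.
  by rewrite FX cJM conjc_real rmorphXn /=; ring.
have [r1 i1] := cvg_FT_chi f1 ab.
pose u_ n (xi : R) := FT f xi * (conjc (FT (chi a b) xi) * (expabs (natinv n) xi)%:C).
have [r2 i2] : Re (cint (u_ n)) @[n --> \oo] --> Re X /\
    Im (cint (u_ n)) @[n --> \oo] --> Im X.
  apply: (@cint_dominated _ u_ _ (fun x => normc (FT f x * conjc (FT (chi a b) x)))).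
  - move=> n; rewrite /u_; under eq_fun do rewrite mulrA.
    apply: mcpx_M; first exact: cL1_mcpx.
    by apply: mcpx_real; exact: measurable_expabs.
  - exact: cL1_mcpx.
  - apply: aeW => x; set w := FT f x * _.
    have H : (normc w * `|expabs (natinv n) x - 1|) @[n --> \oo] --> (0 : R).
      rewrite -[X in _ --> X](mulr0 (normc w)); apply: cvgM; first exact: cvg_cst.
      by apply: cvg_dist0; exact: cvg_expabs_natinv.
    rewrite (_ : (fun n => _) = (fun n => normc w * `|expabs (natinv n) x - 1|))//.
    apply/funext => n; rewrite -normc_real -cnormM; congr normc.
    by rewrite /u_ mulrA -/w rmorphB mulrBr mulr1.
  - exact: L1_modulus.
  - move=> n x; rewrite /u_ mulrA cnormM normc_real ger0_norm ?expabs_ge0//.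
    by rewrite ler_piMr ?normc_ge0// expabs_le1// natinv_gt0.
have tp0 : 2 * pi != 0 :> R by rewrite gt_eqF// twopi_gt0.
rewrite sqr_cc; clearbody X; apply: cplx_ext; rewrite [RHS]/= !ReImE !ReImV.
  by rewrite (cvg_unique _ r2 r1)// mul0r subr0 mulKf.
by rewrite (cvg_unique _ i2 i1)// mul0r addr0 mulKf.
Qed.

Lemma fourier_inner_chi f a b : a < b ->
  L2inner (fourier f) (fourier (L2chi a b)) = L2inner f (L2chi a b).
Proof.
move=> ab; have c1 := L2cvg_inner (fourier (L2chi a b)) (L2cvg_lipschitz lipschitz_fourier (cvg_L2trunc f)).
have c2 := L2cvg_inner (L2chi a b) (cvg_L2trunc f).
apply: (cvg_normc_unique c1).
rewrite (_ : (fun n => _) = (fun n =>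
    normc (L2inner (L2trunc n f) (L2chi a b) - L2inner f (L2chi a b)))) //.
by apply/funext => n; rewrite fourier_inner_chi_L1//; exact: L2trunc_L1.
Qed.

(** Parseval's identity against indicators of intervals is enough, since these separate L2. *)
Lemma fourierK f : Fadj (fourier f) = f.
Proof.
apply/eqP; rewrite -subr_eq0; apply/eqP; apply: L2_eq0_chi => a b ab.
rewrite L2innerB; apply/eqP; rewrite subr_eq0; apply/eqP.
by rewrite L2innerJ -fourier_adjoint -L2innerJ fourier_inner_chi.
Qed.

(** Conjugating the identity Fadj o fourier = id exchanges the two factors, which yields
    surjectivity. *)
Lemma Fadj_fourierK f : fourier (Fadj f) = f.
Proof.
have := fourierK (L2conj f); rewrite /Fadj => H.
by rewrite -[LHS]L2conjK H L2conjK.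
Qed.

Lemma fourier_inner f g : L2inner (fourier f) (fourier g) = L2inner f g.
Proof. by rewrite fourier_adjoint fourierK. Qed.

Lemma fourier_norm f : L2norm (fourier f) = L2norm f.
Proof.
rewrite !L2normE; congr Num.sqrt; apply: complexI.
by rewrite -!L2inner_self fourier_inner.
Qed.

Lemma fourier_inj : injective (@fourier R).
Proof. exact: (can_inj fourierK). Qed.

Definition L2mul (m : R -> R[i]) f : L2 := L2class (fun x => m x * f x).

Section mul.
Variable m : R -> R[i].
Hypotheses (mm : measurable_complex m) (m1 : forall x, normc (m x) <= 1).

Lemma L2mulE f : {ae mu, forall x, L2mul m f x = m x * f x}.
Proof. by apply: L2class_ae; apply: L2_unimod => //; exact: L2valP. Qed.

Lemma L2mulB f g : L2mul m (f - g) = L2mul m f - L2mul m g.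
Proof.
apply: L2_eq; have H := ae_and (L2mulE f) (ae_and (L2mulE g) (L2subE f g)).
apply: ae_imp3 (L2mulE (f - g)) (L2subE (L2mul m f) (L2mul m g)) H.
by move=> x -> -> [-> [-> ->]]; rewrite mulrBr.
Qed.

Lemma L2mul_norm f : L2norm (L2mul m f) <= L2norm f.
Proof.
have mf := L2fun_mcpx (L2_unimod (L2valP f) mm m1).
rewrite !L2normE ler_wsqrtr// -lee_fin -!N2_nsq (N2_ae _ mf (L2mulE f)); last exact: L2_mcpx.
apply: N2_le => //; first exact: L2_mcpx.
by move=> x; rewrite cnormM ler_piMl// normc_ge0.
Qed.

Lemma lipschitz_mul : lipschitz_L2 (L2mul m).
Proof. by exists 1 => f g; rewrite mul1r -L2mulB L2mul_norm. Qed.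
End mul.

(** The common form of translations and dilations; for a != 0 the default of [L2class] is not
    reached. *)
Definition L2aff (a b : R) f : L2 := L2class (fun x => f (a * x + b)).

Section affine.
Variables a b : R.
Hypothesis a0 : a != 0.

Lemma mcpx_affine u : measurable_complex u -> measurable_complex (fun x => u (a * x + b)).
Proof.
move=> [ur ui]; split; first exact: (measurable_affine _ _ ur).
exact: (measurable_affine _ _ ui).
Qed.

Lemma N2_affine u : measurable_complex u ->
  N2 (fun x => u (a * x + b)) = ((`|a|^-1)%:E * N2 u)%E.
Proof.
move=> mu'; rewrite /N2 (@ge0_integral_affine _ a b a0 (fun x => (normc (u x) ^+ 2)%:E)).
- by rewrite muleA -EFinM mulVf ?normr_eq0// mul1e.
- by apply: measurable_EFin; exact: measurable_N2.
- by move=> x; rewrite lee_fin sqr_ge0.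
Qed.

Lemma affine_L2 f : (fun x => f (a * x + b)) \in L2fun.
Proof.
apply/L2funP; split; first by apply: mcpx_affine; exact: L2_mcpx.
by rewrite N2_affine ?N2_nsq -?EFinM ?ltry//; exact: L2_mcpx.
Qed.

Lemma L2affE f : {ae mu, forall x, L2aff a b f x = f (a * x + b)}.
Proof. by apply: L2class_ae; exact: affine_L2. Qed.

Lemma L2aff_linear z f g : L2aff a b (z *: f + g) = z *: L2aff a b f + L2aff a b g.
Proof.
apply: L2_eq.
have H := ae_and (L2affE f) (ae_and (L2affE g) (ae_affine b a0 (L2linE z f g))).
apply: ae_imp3 (L2affE (z *: f + g)) (L2linE z (L2aff a b f) (L2aff a b g)) H.
by move=> x -> -> [-> [-> ->]].
Qed.

Lemma nsq_aff f : nsq (L2aff a b f) = `|a|^-1 * nsq f.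
Proof.
apply: EFin_inj; rewrite EFinM -!N2_nsq -N2_affine; last exact: L2_mcpx.
apply: N2_ae; [exact: L2_mcpx|apply: mcpx_affine; exact: L2_mcpx|exact: L2affE].
Qed.

Lemma lipschitz_aff : lipschitz_L2 (L2aff a b).
Proof.
exists (Num.sqrt `|a|^-1) => f g.
rewrite [f - g]subZ1 [_ - _]subZ1 -L2aff_linear !L2normE nsq_aff.
by rewrite sqrtrM// invr_ge0.
Qed.

Lemma cL1_affine u : cL1 u -> cL1 (fun x => u (a * x + b)).
Proof. by move=> [ur ui]; split; [exact: (L1_affine b a0 ur)|exact: (L1_affine b a0 ui)]. Qed.

Lemma cint_affine u : cL1 u -> cint u = `|a|%:C * cint (fun x => u (a * x + b)).
Proof.
move=> [ur ui]; apply: cplx_ext; rewrite !ReImE !ReImV !(Re_cint, Im_cint).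
  by rewrite mul0r subr0; exact: Rint_affine.
by rewrite mul0r addr0; exact: Rint_affine.
Qed.

End affine.

Lemma translateE a f : translate a f = L2aff 1 (- a) f.
Proof. by congr L2class; apply/funext => x; rewrite mul1r. Qed.

Lemma dilateE (l : R) f : l != 0 -> dilate l f = (`|l|^-1)%:C *: L2aff l^-1 0 f.
Proof.
move=> l0; have li : l^-1 != 0 by rewrite invr_eq0.
have E : (fun x => (`|l|^-1)%:C * f (x / l)) \in L2fun.
  have [z0 H] := @L2fun_submod_closed R.
  have -> : (fun x => (`|l|^-1)%:C * f (x / l)) =
      (`|l|^-1)%:C *: (fun x => f (l^-1 * x + 0)) + (0 : R -> R[i]).
    apply/funext => x; rewrite -[RHS]/((`|l|^-1)%:C * f (l^-1 * x + 0) + 0).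
    by rewrite !addr0 [l^-1 * x]mulrC.
  exact: H _ _ _ (affine_L2 0 li f) z0.
apply: L2_eq; apply: ae_imp3 (L2class_ae E) (L2scaleE (`|l|^-1)%:C (L2aff l^-1 0 f)) (L2affE 0 li f).
by move=> x -> -> ->; rewrite addr0 [l^-1 * x]mulrC.
Qed.

Lemma normc_expi_le1 (t : R) : normc (expi t) <= 1.
Proof. by rewrite normc_expi. Qed.

Lemma cL1_aff a b f : a != 0 -> cL1 f -> cL1 (L2aff a b f).
Proof.
move=> a0 f1; apply: (@cL1_ae _ (fun x => f (a * x + b))); first exact: L2_mcpx.
  by apply: ae_imp (L2affE b a0 f) => x ->.
exact: cL1_affine.
Qed.

Lemma FT_translate a u xi : cL1 u ->
  FT (fun x => u (1 * x + - a)) xi = expi (- (a * xi)) * FT u xi.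
Proof.
move=> u1; have e1 := cL1_expi xi u1; have z1 := cL1Z (expi (- (a * xi))) e1.
rewrite /FT -(cintZ _ e1) (cint_affine (- a) (oner_neq0 R) z1) normr1 mul1r.
congr cint; apply/funext => x.
rewrite mulrCA -expiD; congr (_ * expi _); ring.
Qed.

Lemma FT_scale a u xi : a != 0 -> cL1 u ->
  FT (fun x => u (a * x + 0)) xi = (`|a|^-1)%:C * FT u (a^-1 * xi).
Proof.
move=> a0 u1; have e1 := cL1_expi (a^-1 * xi) u1.
rewrite /FT (cint_affine 0 a0 e1) mulrA -rmorphM mulVf ?normr_eq0// mul1r.
congr cint; apply/funext => x.
by congr (_ * expi _); rewrite !addr0; field.
Qed.

Lemma fourier_translate a f :
  fourier (translate a f) = L2mul (fun xi => expi (- (a * xi))) (fourier f).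
Proof.
have mp := mcpx_expiMN a; have n1 (xi : R) := normc_expi_le1 (- (a * xi)).
have one0 : (1 : R) != 0 := oner_neq0 R.
rewrite translateE; move: f; apply: lipschitz_eq.
- exact: lipschitz_comp lipschitz_fourier (lipschitz_aff _ one0).
- exact: lipschitz_comp (lipschitz_mul mp n1) lipschitz_fourier.
move=> f f1; apply: L2_eq.
apply: ae_imp3 (fourierE (cL1_aff (- a) one0 f1)) (L2mulE mp n1 (fourier f)) (fourierE f1).
move=> xi E1 E2 E3; rewrite E1 E2 E3.
rewrite (FT_ae xi (L2_mcpx _) (mcpx_affine 1 (- a) (L2_mcpx f)) (L2affE (- a) one0 f)).
by rewrite FT_translate// mulrCA.
Qed.

Lemma fourier_aff a f : a != 0 ->
  fourier (L2aff a 0 f) = (`|a|^-1)%:C *: L2aff a^-1 0 (fourier f).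
Proof.
move=> a0; have ai : a^-1 != 0 by rewrite invr_eq0.
move: f; apply: lipschitz_eq.
- exact: lipschitz_comp lipschitz_fourier (lipschitz_aff _ a0).
- apply: (@lipschitz_comp _ (fun f => (`|a|^-1)%:C *: f)).
    exists (normc (`|a|^-1)%:C) => f g.
    by rewrite -scalerBr L2normZ.
  exact: lipschitz_comp (lipschitz_aff _ ai) lipschitz_fourier.
move=> f f1; apply: L2_eq.
have H := ae_and (L2affE 0 ai (fourier f)) (ae_affine 0 ai (fourierE f1)).
apply: ae_imp3 (fourierE (cL1_aff 0 a0 f1)) (L2scaleE (`|a|^-1)%:C (L2aff a^-1 0 (fourier f))) H.
move=> xi E1 E2 [E3 E4]; rewrite E1 E2 E3 E4.
rewrite (FT_ae xi (L2_mcpx _) (mcpx_affine a 0 (L2_mcpx f)) (L2affE 0 a0 f)).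
by rewrite FT_scale// addr0 mulrCA.
Qed.

(** The factor 1 / |l| in [dilate] cancels the Jacobian, leaving a pure substitution: conjugating an
    operator by dilations will turn its multiplier m xi into m (l * xi). *)
Lemma fourier_dilate (l : R) f : l != 0 ->
  fourier (dilate l f) = L2aff l 0 (fourier f).
Proof.
move=> l0; have li : l^-1 != 0 by rewrite invr_eq0.
rewrite dilateE// -[_ *: _]addr0 fourier_linear.
have -> : fourier (0 : L2) = 0.
  by apply: L2norm_eq0; rewrite fourier_norm L2normE (_ : nsq 0 = 0) ?sqrtr0// -[0 in LHS](scale0r (0 : L2)) nsqZ Normc.normc0 expr0n mul0r.
rewrite addr0 fourier_aff// invrK scalerA -rmorphM normfV invrK mulVf ?normr_eq0//.
by rewrite scale1r.
Qed.

End Unitarity.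

(** * Fourier multipliers *)

(* Sealed copies of the Fourier transform and of its inverse: comparing two
   instances of the unsealed ones by conversion is prohibitively slow. *)
HB.lock Definition ft (R : realType) (f : L2 R) : L2 R := fourier f.
HB.lock Definition ftinv (R : realType) (f : L2 R) : L2 R := Fadj f.

Section SealedFourier.
Context {R : realType}.
Implicit Types (f g : L2 R).

Lemma ftE f : fourier f = ft f. Proof. by rewrite ft.unlock. Qed.

Lemma ftinvK f : ft (ftinv f) = f.
Proof. by rewrite ft.unlock ftinv.unlock Fadj_fourierK. Qed.

Lemma ft_inner f g : L2inner (ft f) (ft g) = L2inner f g.
Proof. by rewrite ft.unlock; exact: fourier_inner. Qed.

Lemma ft_norm f : L2norm (ft f) = L2norm f.
Proof. by rewrite ft.unlock; exact: fourier_norm. Qed.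

Lemma ft_inj : injective (@ft R).
Proof. by rewrite ft.unlock; exact: fourier_inj. Qed.

Lemma ftB f g : ft (f - g) = ft f - ft g.
Proof. by rewrite ft.unlock; exact: fourierB. Qed.

Lemma ft_translate a f :
  ft (translate a f) = L2mul (fun xi => expi (- (a * xi))) (ft f).
Proof. by rewrite ft.unlock; exact: fourier_translate. Qed.

Lemma ft_dilate (l : R) f : l != 0 -> ft (dilate l f) = L2aff l 0 (ft f).
Proof. by rewrite ft.unlock; exact: fourier_dilate. Qed.

End SealedFourier.

Section Multipliers.
Context {R : realType}.
Local Notation mu := (leb R).
Local Notation L2 := (L2 R).
Implicit Types (f g h : L2) (u v m : R -> R[i]) (z : R[i]) (A B : L2 -> L2).

Definition is_mult A m : Prop := measurable_complex m /\
  forall f, {ae mu, forall xi, ft (A f) xi = m xi * ft f xi}.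

(** A square integrable function without zeros: a multiplier is recovered from its action on it by
    division. *)
Definition bump (x : R) : R[i] := (expabs 1 x)%:C.

Lemma bump_neq0 x : bump x != 0.
Proof.
by rewrite /bump -(rmorph0 (real_complex R)) (inj_eq (@complexI R)) gt_eqF// expabs_gt0.
Qed.

Lemma bump_L2 : bump \in L2fun.
Proof.
have mb : measurable_complex bump by apply: mcpx_real; exact: measurable_expabs.
apply/L2funP; split=> //.
apply: (@le_lt_trans _ _ (\int[mu]_x (expabs 1 x)%:E)%E); last by rewrite integral_expabs ?ltry.
apply: ge0_le_integral => //.
- by move=> x _; rewrite lee_fin sqr_ge0.
- by apply: measurable_EFin; exact: measurable_N2.
- by apply: measurable_EFin; exact: measurable_expabs.
- move=> x _; rewrite lee_fin normc_real ger0_norm ?expabs_ge0// expr2.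
  by rewrite ler_piMl ?expabs_ge0// expabs_le1.
Qed.

Definition L2bump : L2 := L2class bump.

Lemma L2bumpE : {ae mu, forall x, L2bump x = bump x}.
Proof. by apply: L2class_ae; exact: bump_L2. Qed.

Lemma mult_unique A m m' : is_mult A m -> is_mult A m' ->
  {ae mu, forall xi, m xi = m' xi}.
Proof.
move=> [_ Am] [_ Am']; have := Am (ftinv L2bump); have := Am' (ftinv L2bump).
rewrite ftinvK => h' h; apply: ae_imp3 _ h' h L2bumpE => x -> + bE.
by rewrite bE => /(mulIf (bump_neq0 x)).
Qed.

Lemma mult_ext A m m' : is_mult A m -> measurable_complex m' ->
  {ae mu, forall xi, m xi = m' xi} -> is_mult A m'.
Proof.
move=> [_ Am] mm' mE; split; first exact: mm'.
by move=> f; apply: ae_imp2 _ (Am f) mE => x -> ->.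
Qed.

Lemma mult_inj A B m : is_mult A m -> is_mult B m -> A = B.
Proof.
move=> [_ Am] [_ Bm]; apply/funext => f; apply: ft_inj; apply: L2_eq.
by apply: ae_imp2 _ (Am f) (Bm f) => x -> ->.
Qed.

Lemma mult_comp A B m m' : is_mult A m -> is_mult B m' ->
  is_mult (A \o B) (fun xi => m xi * m' xi).
Proof.
move=> [mm Am] [mm' Bm]; split; first exact: mcpx_M.
by move=> f; apply: ae_imp2 _ (Am (B f)) (Bm f) => x /= -> ->; rewrite mulrA.
Qed.

Lemma mult_id : is_mult id (fun=> 1).
Proof. by split; [exact: mcpx_cst|move=> f; apply: aeW => x; rewrite mul1r]. Qed.

Lemma mult_dilate A m l : l != 0 -> is_mult A m ->
  is_mult (dilate_op A l) (fun xi => m (l * xi)).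
Proof.
move=> l0 [mm Am]; have li : l^-1 != 0 by rewrite invr_eq0.
split.
  have := mcpx_affine l 0 mm.
  by congr measurable_complex; apply/funext => x; rewrite addr0.
move=> f; rewrite /dilate_op /= ft_dilate//.
have H := ae_affine 0 l0 (Am (dilate l^-1 f)).
have H2 := ae_affine 0 l0 (L2affE 0 li (ft f)).
apply: ae_imp3 _ (L2affE 0 l0 (ft (A (dilate l^-1 f)))) H H2.
move=> x -> ->; rewrite ft_dilate// => ->.
by rewrite !addr0 mulKf.
Qed.

Lemma translateK a f : translate a (translate (- a) f) = f.
Proof.
have one0 : (1 : R) != 0 := oner_neq0 R.
rewrite !translateE opprK; apply: L2_eq.
apply: ae_imp2 _ (L2affE (- a) one0 (L2aff 1 a f)) (ae_affine (- a) one0 (L2affE a one0 f)).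
by move=> x -> ->; rewrite !mul1r subrK.
Qed.

Lemma L2inner_phase a u v f g : u \in L2fun -> v \in L2fun ->
  {ae mu, forall x, f x = u x} -> {ae mu, forall x, g x = v x} ->
  L2inner (L2mul (fun xi => expi (- (a * xi))) f) g =
  FT (fun x => u x * conjc (v x)) a.
Proof.
move=> u2 v2 fu gv.
have mp := @mcpx_expiMN R a; have n1 (xi : R) := normc_expi_le1 (- (a * xi)).
rewrite (L2inner_ae (L2_unimod u2 mp n1) v2 _ gv).
  by congr cint; apply/funext => x; rewrite -mulrA mulrC.
by apply: ae_imp2 _ (L2mulE mp n1 f) fu => x -> ->.
Qed.

(** As functions of a, the two inner products are the transforms of the integrable functions f *
    conj g and f' * conj g', and [FT] is injective. *)
Lemma ae_eq_of_phases f g f' g' :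
  (forall a, L2inner (L2mul (fun xi => expi (- (a * xi))) f) g =
             L2inner (L2mul (fun xi => expi (- (a * xi))) f') g') ->
  {ae mu, forall x, f x * conjc (g x) = f' x * conjc (g' x)}.
Proof.
move=> H; have u1 := L2inner_L1 f g; have v1 := L2inner_L1 f' g'.
pose w x := -1 * (f' x * conjc (g' x)) + f x * conjc (g x).
have w1 : cL1 w by apply: cL1D => //; exact: cL1Z.
have w0 a : FT w a = 0.
  rewrite /w FT_linear//.
  have := H a; rewrite (L2inner_phase a (L2valP f) (L2valP g) (aeW _ (fun=> erefl)) (aeW _ (fun=> erefl))).
  rewrite (L2inner_phase a (L2valP f') (L2valP g') (aeW _ (fun=> erefl)) (aeW _ (fun=> erefl))) => ->.
  by rewrite mulN1r addNr.
apply: ae_imp _ (FT_eq0 w1 w0) => x /eqP; rewrite /w mulN1r addrC subr_eq0.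
by move=> /eqP.
Qed.

(* If A b = ftinv L2bump, unitarity and commutation with translations give the
   two integrable functions [ft (A f) * conj bump] and [ft f * conj (ft b)] the
   same Fourier transform. They are therefore equal almost everywhere, so that
   the multiplier is [conj (ft b) / bump]. *)
Lemma mult_exists A : unitary A -> translation_invariant A ->
  exists m, is_mult A m /\ forall x, normc (m x) = 1.
Proof.
move=> [_ surjA isoA] tA; have [b Ab] := surjA (ftinv L2bump).
have comm a f : A (translate a f) = translate a (A f).
  by have /(congr1 (fun S => translate a (S f))) := tA a; rewrite /= translateK.
pose m1 x := conjc (ft b x) * ((expabs 1 x)^-1)%:C.
have mm1 : measurable_complex m1.
  apply: mcpx_M; first by apply: mcpx_J; exact: L2_mcpx.
  apply: mcpx_real; apply: continuous_measurable_fun => x.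
  by apply: cvgV; [rewrite gt_eqF// expabs_gt0|exact: continuous_expabs].
have Am1 : is_mult A m1.
  split=> // f.
  have H a : L2inner (L2mul (fun xi => expi (- (a * xi))) (ft (A f))) L2bump =
             L2inner (L2mul (fun xi => expi (- (a * xi))) (ft f)) (ft b).
    rewrite -!ft_translate -comm; transitivity (L2inner (A (translate a f)) (A b)).
      by rewrite Ab -[in RHS]ft_inner ftinvK.
    by rewrite isoA ft_inner.
  apply: ae_imp2 _ (ae_eq_of_phases H) L2bumpE => x E bE; move: E; rewrite bE => E.
  have e0 : expabs 1 x != 0 by rewrite gt_eqF// expabs_gt0.
  rewrite /m1 [RHS]mulrC mulrA -E /bump conjc_real -mulrA -rmorphM mulfV//.
  by rewrite rmorph1 mulr1.
have [_ Am] := Am1.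
(* [m1] is not yet known to be bounded, but its product with [bump] is the conjugate of [ft b]. *)
have m1b : (fun x => m1 x * bump x) \in L2fun.
  apply: (@L2_of_le _ _ (ft b)); [|exact: L2valP|].
    by apply: mcpx_M => //; exact: L2fun_mcpx bump_L2.
  move=> x; rewrite /m1 /bump -mulrA -rmorphM mulVf ?gt_eqF ?expabs_gt0//.
  by rewrite rmorph1 mulr1 cnormJ.
(* The isometry, tested on the indicator of [a, c] times [bump] against [bump], says that (|m1|^2 -
   1) |bump|^2 has integral 0 over [a, c]. *)
have n1 : {ae mu, forall x, normc (m1 x) = 1}.
  pose p x := normc (m1 x * bump x) ^+ 2 - normc (bump x) ^+ 2.
  have p1 : rL1 p by apply: L1B; [exact: L1_sqr m1b|exact: L1_sqr bump_L2].
  have p0 : {ae mu, forall x, p x = 0}.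
    apply: (ae0_of_intervals (L1_locally_integrable p1)) => a c ac.
    have mc := @mcpx_chi R a c; have nc := @normc_chi_le1 R a c.
    have cb2 := L2_unimod bump_L2 mc nc.
    have cmb2 := L2_unimod m1b mc nc.
    pose phi := L2mul (chi a c) L2bump.
    have phiE : {ae mu, forall x, phi x = chi a c x * bump x}.
      by apply: ae_imp2 _ (L2mulE mc nc L2bump) L2bumpE => x -> ->.
    have := isoA (ftinv phi) (ftinv L2bump).
    rewrite -ft_inner -[RHS]ft_inner !ftinvK.
    rewrite (L2inner_ae cb2 bump_L2 phiE L2bumpE).
    rewrite (L2inner_ae cmb2 m1b); last 2 first.
    - apply: ae_imp2 _ (Am (ftinv phi)) phiE => x ->.
      by rewrite ftinvK => ->; rewrite mulrCA.
    - apply: ae_imp2 _ (Am (ftinv L2bump)) L2bumpE => x ->.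
      by rewrite ftinvK => ->.
    move=> /(congr1 (@complex.Re R)); rewrite !Re_cint => E.
    rewrite -Rint_indic /p.
    transitivity (\int[mu]_x (Re (chi a c x * (m1 x * bump x) * conjc (m1 x * bump x)) -
        Re (chi a c x * bump x * conjc (bump x)))).
      apply: eq_Rintegral => x _.
      have K (w : R[i]) : Re (chi a c x * w * conjc w) =
          \1_(`[a, c]%classic) x * normc w ^+ 2.
        by rewrite -mulrA normc_sqr_real /chi -rmorphM.
      by rewrite !K; ring.
    have [L1a _] := L2M_L1 cmb2 m1b; have [L1b _] := L2M_L1 cb2 bump_L2.
    by rewrite RintegralB// E subrr.
  apply: ae_imp _ p0 => x /eqP; rewrite /p cnormM exprMn -{2}[normc (bump x) ^+ 2]mul1r -mulrBl.
  have b0 : normc (bump x) ^+ 2 != 0.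
    by rewrite sqrf_eq0; apply: contra (bump_neq0 x) => /eqP /normc0_eq0 ->.
  rewrite mulf_eq0 (negbTE b0) orbF subr_eq0 => /eqP E.
  apply/eqP; rewrite -(eqrXn2 (n := 2)) ?normc_ge0//; by rewrite E expr1n.
(* A change on a null set makes the modulus 1 everywhere. *)
pose m x := if normc (m1 x) == 1 then m1 x else 1.
have mb : measurable_fun [set: R] (fun x => normc (m1 x) == 1).
  apply: measurable_fun_eqr; last exact: measurable_cst.
  exact: measurable_modulus.
have mm : measurable_complex m.
  split.
    rewrite (_ : (fun x => _) = fun x => if normc (m1 x) == 1 then Re (m1 x) else 1).
      by apply: measurable_fun_ifT => //; case: mm1.
    by apply/funext => x; rewrite /m; case: ifP.
  rewrite (_ : (fun x => _) = fun x => if normc (m1 x) == 1 then Im (m1 x) else 0).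
    by apply: measurable_fun_ifT => //; case: mm1.
  by apply/funext => x; rewrite /m; case: ifP.
exists m; split.
  by apply: (mult_ext Am1) => //; apply: ae_imp _ n1 => x nx; rewrite /m nx eqxx.
by move=> x; rewrite /m; case: ifP => [/eqP//|_]; exact: Normc.normc1.
Qed.

Lemma mult_symmetric A m : is_mult A m -> symmetric_op A ->
  {ae mu, forall xi, m (- xi) = m xi}.
Proof.
move=> Am sA; have N1 : (-1 : R) != 0 by rewrite oppr_eq0 oner_neq0.
have := mult_dilate N1 Am; rewrite sA => Am'.
by apply: ae_imp _ (mult_unique Am' Am) => x; rewrite mulN1r.
Qed.

Lemma mult_semistable A m : is_mult A m -> semistable A ->
  exists a b : R, [/\ 0 < a, 0 < b,
    {ae mu, forall xi, m (a * xi) = m xi ^+ 2} &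
    {ae mu, forall xi, m (b * xi) = m xi ^+ 3}].
Proof.
move=> Am [a [b [a0 b0 Ea Eb]]]; exists a, b; split=> //.
- have := mult_dilate (lt0r_neq0 a0) Am; rewrite -Ea => Am'.
  by apply: ae_imp _ (mult_unique Am' (mult_comp Am Am)) => x ->; rewrite expr2.
- have := mult_dilate (lt0r_neq0 b0) Am; rewrite -Eb => Am'.
  have := mult_unique Am' (mult_comp (mult_comp Am Am) Am).
  by apply: ae_imp _ => x ->; rewrite 2!exprS expr1 mulrA.
Qed.

(* Tested on the frequencies where the multiplier moves by more than e. *)
Lemma mult_LUC A m : is_mult A m -> LUC_under_dilation A ->
  forall r e : R, 1 < r -> 0 < e -> exists2 d : R, 0 < d &
  forall l, 0 < l -> `|l - 1| < d ->
  {ae mu, forall xi, r^-1 <= `|xi| <= r -> normc (m (l * xi) - m xi) <= e}.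
Proof.
move=> Am luc r e r1 e0.
(* Continuity at the ratio 1. The finiteness of the operator norm near 1 is extracted too, since
   [fine] carries no information at +oo. *)
have /fine_cvgP[[d1 d10 fin1] /cvgr0Pnorm_lt H] := luc r r1 1 ltr01.
have [d2 d20 H2] := H e e0.
exists (Num.min d1 d2) => [|l l0]; first by rewrite lt_min; apply/andP.
rewrite lt_min distrC => /andP[ld1 ld2].
have F := fin1 l ld1; have := H2 l ld2; rewrite /= => E.
have {}E : (opnorm_on (band_limited r) (dilate_op A l \- dilate_op A 1)%R < e%:E)%E.
  rewrite -(fineK F) lte_fin; exact: le_lt_trans (ler_norm _) E.
have [mm _] := Am.
have Aml := mult_dilate (lt0r_neq0 l0) Am.
have Am1 := mult_dilate (oner_neq0 R) Am.
pose dm xi := m (l * xi) - m xi.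
have mdm : measurable_complex dm.
  by apply: mcpx_B => //; case: Aml.
pose D := [set xi : R | r^-1 <= `|xi| <= r /\ e < normc (dm xi)].
have mD : measurable D.
  rewrite (_ : D = (fun x : R => `|x|) @^-1` `[r^-1, r] `&` (modulus dm) @^-1` `]e, +oo[).
    apply: measurableI.
      rewrite -[X in measurable X]setTI.
      by apply: (@normr_measurable R setT).
    rewrite -[X in measurable X]setTI.
    by apply: (measurable_modulus mdm).
  by apply/seteqP; split => x /=; rewrite !in_itv/= andbT.
have r0 : 0 < r by apply: lt_trans r1.
suff D0 : mu D = 0.
  exists D; split => // xi /= /not_implyP[xr /negP]; rewrite -ltNge => lt.
  by split.
pose chD (x : R) : R[i] := (\1_D x)%:C.
have mchD : measurable_complex chD by apply: mcpx_real; exact: measurable_indic.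
have chD2 : chD \in L2fun.
  apply: (@L2_of_le _ _ (chi (- r) r)) => //; first exact: chi_L2.
  move=> x; rewrite /chD /chi !normc_real !indicE.
  case: (boolP (x \in D)) => [/set_mem [/andP[_ xr] _]|_]; last by rewrite normr0.
  by rewrite mem_set//= in_itv/= -ler_norml.
have nD : N2 chD = mu D.
  transitivity (\int[mu]_x (\1_D x)%:E)%E; last by rewrite integral_indic// setIT.
  apply: eq_integral => x _; rewrite /chD normc_real indicE.
  by case: (x \in D); rewrite ?normr1 ?normr0 ?expr1n ?expr0n.
pose phi := L2class chD.
have phiE : {ae mu, forall x, phi x = chD x} by exact: L2class_ae.
have nphi : mu D = (nsq phi)%:E.
  by rewrite -nD -N2_nsq (N2_ae _ _ phiE)//; exact: L2_mcpx.
apply/eqP; rewrite nphi; apply/eqP; congr EFin; apply/eqP/negPn/negP => n0.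
have np : 0 < nsq phi by rewrite lt_neqAle eq_sym n0 nsq_ge0.
have Np : 0 < L2norm phi by rewrite L2normE sqrtr_gt0.
pose c : R[i] := ((L2norm phi)^-1)%:C.
(* A unit vector whose transform is carried by D, hence by the band: it is admissible in the
   operator norm. *)
pose f := ftinv (c *: phi).
have Ff : ft f = c *: phi by exact: ftinvK.
have fE : {ae mu, forall x, ft f x = c * chD x}.
  by rewrite Ff; apply: ae_imp2 _ (L2scaleE c phi) phiE => x -> ->.
have nc : normc c * L2norm phi = 1.
  by rewrite normc_real ger0_norm ?invr_ge0 ?L2norm_ge0// mulVf// gt_eqF.
have nf : L2norm f = 1 by rewrite -ft_norm Ff L2normZ nc.
have bf : band_limited r f.
  apply: ae_imp _ fE => x; rewrite -ftE => -> xr; rewrite /chD indicE memNset ?mulr0// => -[/andP[h1 h2] _].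
  by case: xr; rewrite ltNge ?h1 ?h2.
pose g := dilate_op A l f - dilate_op A 1 f.
have gle : ((L2norm g)%:E <= opnorm_on (band_limited r) (dilate_op A l \- dilate_op A 1)%R)%E.
  by apply: ereal_sup_ubound => /=; exists f => //; split=> //; rewrite nf.
have gE : {ae mu, forall x, ft g x = dm x * (c * chD x)}.
  rewrite /g ftB.
  have H3 := ae_and (Aml.2 f) (ae_and (Am1.2 f) fE).
  apply: ae_imp2 _ (L2subE (ft (dilate_op A l f)) (ft (dilate_op A 1 f))) H3.
  by move=> x -> [-> [-> ->]]; rewrite mul1r mulrBl.
have : L2norm g < e by rewrite -lte_fin; exact: le_lt_trans gle E.
apply/negP; rewrite -leNgt -ft_norm.
(* Writing e as a norm allows a pointwise comparison: on D the difference of multipliers exceeds e,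
   so the norm of g is at least e. *)
have ec : e = L2norm ((e%:C * c) *: phi).
  by rewrite L2normZ cnormM -mulrA nc mulr1 normc_real gtr0_norm.
rewrite ec !L2normE ler_wsqrtr// -lee_fin -!N2_nsq.
have ecE : {ae mu, forall x, L2val ((e%:C * c) *: phi) x = e%:C * c * chD x}.
  by apply: ae_imp2 _ (L2scaleE (e%:C * c) phi) phiE => x -> ->.
have m3 : measurable_complex (fun x => e%:C * c * chD x) by apply: mcpx_M => //; exact: mcpx_cst.
have m4 : measurable_complex (fun x => dm x * (c * chD x)).
  by apply: mcpx_M => //; apply: mcpx_M => //; exact: mcpx_cst.
rewrite (N2_ae _ m3 ecE); last exact: L2_mcpx.
rewrite (N2_ae _ m4 gE); last exact: L2_mcpx.
apply: N2_le => // x; rewrite -mulrA !cnormM normc_real gtr0_norm//.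
rewrite /chD indicE; case: (boolP (x \in D)) => [/set_mem [_ lt]|_].
  by rewrite ler_wpM2r ?mulr_ge0 ?normc_ge0// ltW.
by rewrite Normc.normc0 !mulr0.
Qed.

End Multipliers.

(** * Continuity and shape of the multiplier *)

Section Periods.
Context {R : realType}.
Implicit Types (p f : R -> R) (s t : R).

Lemma continuous_addr_arg f (c : R) : continuous f -> continuous (fun t => f (t + c)).
Proof.
move=> cf t; apply: (@continuous_comp _ _ _ (fun t => t + c) f); last exact: cf.
by apply: cvgD; [exact: cvg_id|exact: cvg_cst].
Qed.

Lemma continuousP_eps f : continuous f ->
  forall x e, 0 < e -> exists2 d, 0 < d & forall y, `|x - y| < d -> `|f x - f y| < e.
Proof.
move=> cf x e e0; have /cvgrPdist_lt/(_ e e0) := cf x.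
by move=> [d /= d0 H]; exists d => // y yd; exact: H.
Qed.

Definition period p s := forall t, p (t + s) = p t.

Lemma periodD p s t : period p s -> period p t -> period p (s + t).
Proof. by move=> ps pt x; rewrite addrA pt ps. Qed.

Lemma periodN p s : period p s -> period p (- s).
Proof. by move=> ps x; rewrite -[in RHS](subrK s x) ps. Qed.

Lemma periodMz p s (k : int) : period p s -> period p (k%:~R * s).
Proof.
move=> ps; have Hn (n : nat) : period p (n%:R * s).
  elim: n => [|n IH]; first by move=> t; rewrite mul0r addr0.
  by rewrite -addn1 natrD mulrDl mul1r; exact: periodD.
case: k => n; first exact: Hn.
by rewrite NegzE mulrNz mulNr; apply: periodN; exact: Hn.
Qed.

Lemma floor_rem (x g : R) : 0 < g ->
  0 <= x - (Num.floor (x / g))%:~R * g < g.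
Proof.
move=> g0; rewrite subr_ge0 -ler_pdivlMr// ge_floor//= ltrBlDr.
have := floorD1_gt (x / g); rewrite ltr_pdivrMr// intrD mulrDl mul1r.
by rewrite addrC.
Qed.

(** Modulo a small period every t is congruent to a point close to 0. *)
Lemma small_periods_cst p : continuous p ->
  (forall e, 0 < e -> exists s, [/\ 0 < s, s < e & period p s]) ->
  forall t, p t = p 0.
Proof.
move=> cp H t; apply/eqP; rewrite -subr_eq0 -normr_eq0 eq_le normr_ge0 andbT.
apply/ler_addgt0Pl => e e0; rewrite addr0.
have [d d0 Hd] := continuousP_eps cp 0 e0.
have [s [s0 sd ps]] := H _ d0.
have /andP[r0 rs] := floor_rem t s0.
rewrite -(periodN (periodMz (Num.floor (t / s)) ps) t) distrC ltW// Hd//.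
by rewrite sub0r normrN ger0_norm// (lt_trans rs).
Qed.

(* Arbitrarily small periods would force p to be constant; hence there is a
   least positive period, and it generates all the others. *)
Lemma periods_cyclic p (s0 : R) : continuous p -> period p s0 -> s0 != 0 ->
  (exists t, p t != p 0) ->
  exists g, [/\ 0 < g, period p g &
    forall s, period p s -> exists k : int, s = k%:~R * g].
Proof.
move=> cp ps0 s0n [t0 pt0].
have [e e0 He] : exists2 e, 0 < e & forall s, 0 < s -> period p s -> e <= s.
  apply: contrapT => Hc; move/eqP: pt0; apply; apply: small_periods_cst => // e e0.
  apply: contrapT => Hn; apply: Hc; exists e => // s s_gt0 ps.
  by rewrite leNgt; apply/negP => se; apply: Hn; exists s.
pose P := [set s | 0 < s /\ period p s].
have Pn : P !=set0.
  exists `|s0|; split; first by rewrite normr_gt0.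
  by have [_|_] := ger0P s0 => //; exact: periodN.
have Pl : lbound P e by move=> s [? ?]; exact: He.
have hP : has_inf P by split => //; exists e.
have eg : e <= inf P by exact: lb_le_inf.
have g0 : 0 < inf P by exact: lt_le_trans eg.
have pg : period p (inf P).
  have [s [s_gt0 ps] sg] := inf_adherent e0 hP.
  have : inf P <= s by apply: ge_inf; [exists e|split].
  rewrite le_eqVlt => /orP[/eqP->//|gs].
  (* If the infimum were not attained, there would be two distinct periods between it and
     [inf P + e]; their difference would be a positive period smaller than e. *)
  have sP : 0 < s - inf P by rewrite subr_gt0.
  have [s' [s'0 ps'] ss'] := inf_adherent sP hP.
  have gs' : inf P <= s' by apply: ge_inf; [exists e|split].
  suff : e <= s - s' by move: sg ss' gs'; lra.
  by apply: He; [move: ss'; lra|apply: periodD => //; exact: periodN].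
exists (inf P); split => // s ps; exists (Num.floor (s / inf P)).
have /andP[r0 rg] := floor_rem s g0.
apply/eqP; rewrite -subr_eq0 eq_le r0 andbT leNgt; apply/negP => rp.
have : inf P <= s - (Num.floor (s / inf P))%:~R * inf P.
  apply: ge_inf; [by exists e|split=> //].
  by apply: periodD => //; apply: periodN; exact: periodMz.
by move: rg; lra.
Qed.

Lemma ln2_gt0 : 0 < ln 2%R :> R. Proof. by apply: ln_gt0; rewrite ltr1n. Qed.
Lemma ln3_gt0 : 0 < ln 3%R :> R. Proof. by apply: ln_gt0; rewrite ltr1n. Qed.

(** Exponentiating gives 3^|j| = 2^|k|; parity forces k = 0, and then j = 0. *)
Lemma ln2_ln3_indep (j k : int) : j%:~R * ln 3 = k%:~R * ln 2 :> R -> j = 0.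
Proof.
move=> H; have {}H : `|j|%:R * ln 3 = `|k|%:R * ln 2 :> R.
  rewrite !natr_absz !intr_norm.
  rewrite -[ln 3 in LHS](ger0_norm (ltW ln3_gt0)) -[ln 2 in RHS](ger0_norm (ltW ln2_gt0)).
  by rewrite -!normrM H.
have E : (3 ^ `|j|)%N = (2 ^ `|k|)%N.
  apply/eqP; rewrite -(eqr_nat R) !natrX; apply/eqP.
  apply: ln_inj; rewrite ?posrE ?exprn_gt0 ?ltr0n//.
  by rewrite !lnXn ?ltr0n// -[LHS]mulr_natl -[RHS]mulr_natl.
apply/eqP; rewrite -absz_eq0; apply/eqP.
case: (`|k|)%N E => [|k' E].
  by move/eqP; rewrite expn0 -[X in _ == X](expn0 3) eqn_exp2l// => /eqP.
by have := congr1 odd E; rewrite oddX orbT expnS oddM.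
Qed.

(* With alpha = ln 2 / A, the function [p t = f t * exp (- alpha t)] is bounded and
   A-periodic, which forces alpha * B = ln 3. Then A and B are incommensurable
   periods of p, so p is constant. *)
Lemma scaling_exponential f (A B : R) : continuous f ->
  (forall t, f (t + A) = 2 * f t) -> (forall t, f (t + B) = 3 * f t) ->
  exists al be, al != 0 /\ forall t, f t = be * expR (al * t).
Proof.
move=> cf fA fB.
have [[t0 ft0]|f0] := pselect (exists t, f t != 0); last first.
  exists 1, 0; split; first exact: oner_neq0.
  by move=> t; rewrite mul0r; apply/eqP/negP => /negP ft; apply: f0; exists t.
have A0 : A != 0.
  apply/eqP => A0; move: (fA t0) ft0; rewrite A0 addr0 => ft /eqP; apply.
  by lra.
pose al := ln 2 / A; pose p t := f t * expR (- (al * t)).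
have al0 : al != 0 by rewrite mulf_neq0 ?invr_neq0// gt_eqF// ln2_gt0.
have fp t : f t = p t * expR (al * t).
  by rewrite /p -mulrA -expRD addNr expR0 mulr1.
have pA : period p A.
  move=> t; rewrite /p fA mulrDr opprD expRD.
  have -> : expR (- (al * A)) = 2^-1 by rewrite /al divfK// expRN lnK// posrE ltr0n.
  by field.
pose ka := 3 * expR (- (al * B)).
have pB t : p (t + B) = ka * p t.
  by rewrite /p fB mulrDr opprD expRD /ka; ring.
have ka0 : 0 < ka by rewrite mulr_gt0 ?ltr0n ?expR_gt0.
have cp : continuous p.
  move=> t; apply: cvgM; first exact: cf.
  apply: (@continuous_comp _ _ _ (fun t => - (al * t)) expR); last exact: continuous_expR.
  by apply: cvgN; apply: cvgM; [exact: cvg_cst|exact: cvg_id].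
have pt0 : p t0 != 0 by rewrite /p mulf_neq0// gt_eqF// expR_gt0.
clearbody p.
have [M HM] : exists M, forall t, `|p t| <= M.
  have A'0 : 0 < `|A| by rewrite normr_gt0.
  have pA' : period p `|A| by have [_|_] := ger0P A => //; exact: periodN.
  have cn : {within `[0, `|A|], continuous (fun t => `|p t|)}.
    apply: continuous_subspaceT => t; apply: continuous_comp; first exact: cp.
    exact: norm_continuous.
  have [c _ Hc] := EVT_max (ltW A'0) cn.
  exists `|p c| => t.
  have /andP[r0 rs] := floor_rem t A'0.
  rewrite -(periodN (periodMz (Num.floor (t / `|A|)) pA') t); apply: Hc.
  by rewrite in_itv/= r0 ltW.
have pBn n t : p (t + n%:R * B) = ka ^+ n * p t.
  elim: n => [|n IH]; first by rewrite mul0r addr0 expr0 mul1r.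
  by rewrite -addn1 natrD mulrDl mul1r addrA pB IH addn1 exprS mulrA.
(* Boundedness of p excludes a factor other than 1: iterate forwards along B if ka > 1, backwards if
   ka < 1. *)
have grow (q : R) : 1 < q -> (forall n : nat, exists t, q ^+ n * `|p t0| <= `|p t|) -> False.
  move=> q1 H; have pp : 0 < `|p t0| by rewrite normr_gt0.
  have q1' : `|q^-1| < 1 by rewrite ger0_norm ?invr_ge0 ?invf_lt1//; lra.
  have /cvgrPdist_lt/(_ _ pp)[n _ /(_ n (leqnn n))] := cvg_geometric M q1'.
  rewrite /= sub0r normrN exprVn => Hn.
  have qn : 0 < q ^+ n by apply: exprn_gt0; lra.
  have {}Hn : M < q ^+ n * `|p t0|.
    apply: le_lt_trans (ler_norm _) _.
    by move: Hn; rewrite normrM normfV (ger0_norm (ltW qn)) ltr_pdivrMr// mulrC.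
  have [t Ht] := H n; by have := HM t; move: Ht Hn; lra.
have ka1 : ka = 1.
  apply/eqP; rewrite eq_le !leNgt; apply/andP; split; apply/negP => k1.
    apply: (grow _ k1) => n; exists (t0 + n%:R * B).
    by rewrite pBn normrM normrX (ger0_norm (ltW ka0)).
  have k1' : 1 < ka^-1 by rewrite invf_gt1.
  apply: (grow _ k1') => n; exists (t0 - n%:R * B).
  have := pBn n (t0 - n%:R * B); rewrite subrK => ->.
  by rewrite normrM normrX (ger0_norm (ltW ka0)) mulrA -exprMn mulVf ?gt_eqF// expr1n mul1r.
have {}pB : period p B by move=> t; rewrite pB ka1 mul1r.
have alB : al * B = ln 3.
  apply: expR_inj; rewrite lnK ?posrE ?ltr0n//.
  move: ka1; rewrite /ka expRN => /(congr1 ( *%R^~ (expR (al * B)))).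
  by rewrite mul1r mulfVK ?gt_eqF ?expR_gt0.
have pc t : p t = p 0.
  apply: contrapT => /eqP pt.
  have [g [g0 pg Hg]] := periods_cyclic cp pA A0 (ex_intro _ t pt).
  have [j Aj] := Hg _ pA; have [k Bk] := Hg _ pB.
  (* From A = j g and B = k g, multiplying by al gives j ln 3 = k ln 2. *)
  have j0 : j = 0.
    apply: (@ln2_ln3_indep j k).
    have -> : ln 2 = al * A :> R by rewrite /al divfK.
    by rewrite -alB {1}Bk {1}Aj; ring.
  by move: A0; rewrite Aj j0 mul0r eqxx.
exists al, (p 0); split => // t.
by rewrite fp pc.
Qed.

End Periods.

(** * Lifting a map from the line to the circle *)

Section Lifting.
Context {R : realType}.
Implicit Types (f h p q : R -> R) (x y : R).

Lemma cos_eq1_small x : cos x = 1 -> `|x| <= 1 -> x = 0.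
Proof.
wlog x0 : x / 0 <= x => [H cx x1|cx x1].
  have [x0|x0] := lerP 0 x; first exact: H.
  by apply: oppr_inj; rewrite oppr0; apply: H; rewrite ?cosN ?normrN// oppr_ge0 ltW.
apply/eqP; rewrite eq_le x0 andbT leNgt; apply/negP => xp.
have pi1 : 1 <= pi :> R by rewrite (le_trans _ (pi_ge2 _))// ler1n.
rewrite ger0_norm// in x1.
have : cos x < cos 0 by rewrite ltr_cos// in_itv/= ?lexx ?x0 ?pi_ge0// (le_trans x1).
by rewrite cos0 cx ltxx.
Qed.

(** Otherwise the intermediate value theorem makes |f| take a value in ]0, 1], where the cosine is
    not 1. *)
Lemma cos_eq1_continuous f : continuous f -> (forall x, cos (f x) = 1) ->
  f 0 = 0 -> forall x, f x = 0.
Proof.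
move=> cf cos1 f0 x; apply: contrapT => /eqP fx0.
pose v := Num.min 1 `|f x|.
have v0 : 0 < v by rewrite lt_min ltr01 normr_gt0.
have cn : continuous (fun t => `|f t|).
  by move=> t; apply: continuous_comp; [exact: cf|exact: norm_continuous].
have vfx : v <= `|f x| by rewrite ge_min lexx orbT.
have [c fc] : exists c, `|f c| = v.
  have [x0|/ltW x0] := lerP 0 x.
    have [|c _ <-] := IVT (v := v) x0 (continuous_subspaceT cn); last by exists c.
    by rewrite f0 normr0 ge_min le_max (ltW v0) vfx orbT.
  have [|c _ <-] := IVT (v := v) x0 (continuous_subspaceT cn); last by exists c.
  by rewrite f0 normr0 ge_min le_max (ltW v0) vfx !orbT.
have : f c = 0 by apply: cos_eq1_small => //; rewrite fc ge_min lexx.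
by move=> fc0; move: fc v0; rewrite fc0 normr0 => <-; rewrite ltxx.
Qed.

(** The difference, shifted to vanish at 0, is continuous with cosine 1. Through this lemma
    equations modulo 2 pi become exact up to one constant. *)
Lemma expi_continuous_unique f h : continuous f -> continuous h ->
  (forall x, expi (f x) = expi (h x)) -> forall x, f x - h x = f 0 - h 0.
Proof.
move=> cf ch fh x; apply/eqP; rewrite -subr_eq0; apply/eqP.
have e1 y : expi (f y - h y) = 1 by rewrite expiD expiN fh -expiN -expiD subrr expi0.
apply: (@cos_eq1_continuous (fun x => (f x - h x) - (f 0 - h 0))); last by rewrite subrr.
  move=> y; apply: cvgB; last exact: cvg_cst.
  by apply: cvgB; [exact: cf|exact: ch].
move=> y; rewrite -Re_expi expiD expiN !e1.
by rewrite (_ : 1 * _ = 1)// mul1r conjc1.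
Qed.

Lemma polar_angle (a b : R) : a ^+ 2 + b ^+ 2 = 1 -> exists t, cos t = a /\ sin t = b.
Proof.
move=> ab; have a1 : -1 <= a <= 1 by apply/andP; split; nra.
have s2 : Num.sqrt (1 - a ^+ 2) = `|b| by rewrite -sqrtr_sqr; congr Num.sqrt; lra.
have [b0|b0] := lerP 0 b.
  by exists (acos a); rewrite acosK// sin_acos// s2 ger0_norm.
by exists (- acos a); rewrite cosN sinN acosK// sin_acos// s2 ltr0_norm// opprK.
Qed.

(** A single modulus on [-L, L] is what permits a subdivision into equal steps in [local_lift]. *)
Definition unif_on (L : R) f := forall e, 0 < e ->
  exists2 d, 0 < d & forall x y, `|x| <= L -> `|y| <= L -> `|x - y| < d ->
    `|f x - f y| <= e.

Lemma unif_on_continuous f : (forall L, unif_on L f) -> continuous f.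
Proof.
move=> uf x; apply/cvgrPdist_le => e e0.
have [d d0 Hd] := uf (`|x| + 1) e e0.
exists (Num.min d 1); first by rewrite /= lt_min d0 ltr01.
move=> y /=; rewrite lt_min => /andP[yd y1]; apply: Hd => //; first by lra.
have := ler_normD x (y - x); rewrite addrC subrK distrC; lra.
Qed.

(** The retraction of the line onto [-L, L]: composed with it, a lift over [-L, L] is continuous
    everywhere. *)
Definition clamp (L x : R) := Num.max (- L) (Num.min L x).

Lemma clampE (L x : R) : `|x| <= L -> clamp L x = x.
Proof. by rewrite ler_norml => /andP[h1 h2]; rewrite /clamp min_r// max_r. Qed.

Lemma clamp_le (L x : R) : 0 <= L -> `|clamp L x| <= L.
Proof.
move=> L0; rewrite ler_norml /clamp le_max lexx /= ge_max ge_min lexx /=.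
by rewrite andbT; lra.
Qed.

Lemma continuous_clamp (L : R) : continuous (clamp L).
Proof.
move=> x; apply: (@continuous_max _ _ (fun=> - L) (fun x => Num.min L x)); first exact: cvg_cst.
by apply: (@continuous_min _ _ (fun=> L) id); [exact: cvg_cst|exact: cvg_id].
Qed.

Section lift.
Variables (p q : R -> R).
Hypothesis pq1 : forall x, p x ^+ 2 + q x ^+ 2 = 1.
Hypothesis pU : forall L, unif_on L p.
Hypothesis qU : forall L, unif_on L q.
Variable a0 : R.
Hypothesis ca0 : cos a0 = p 0.
Hypothesis sa0 : sin a0 = q 0.

Let M x : R[i] := p x +i* q x.
(** The imaginary part of conj (M x) * M y, that is, the sine of the angle from M x to M y. *)
Let S x y := q y * p x - p y * q x.

(** Increments of at most 1/8 keep the sine of the angle below 1/4 in absolute value and its cosine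
    nonnegative, so that [asin] returns the angle itself. *)
Let expi_step x y : `|p y - p x| <= 8^-1 -> `|q y - q x| <= 8^-1 ->
  -1 < S x y < 1 /\ M y = M x * expi (asin (S x y)).
Proof.
move=> hp hq.
have bnd (u w : R) : u ^+ 2 + w ^+ 2 = 1 -> `|u| <= 1 by move=> ?; rewrite ler_norml; apply/andP; split; nra.
have p1 := bnd _ _ (pq1 x).
have q1 : `|q x| <= 1 by apply: (bnd _ (p x)); rewrite addrC.
have SE : S x y = (q y - q x) * p x - (p y - p x) * q x by rewrite /S; ring.
have Sn : `|S x y| <= 4^-1.
  rewrite SE; apply: le_trans (ler_normB _ _) _; rewrite !normrM.
  have := normr_ge0 (q y - q x); have := normr_ge0 (p y - p x).
  have := normr_ge0 (p x); have := normr_ge0 (q x).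
  move: hp hq p1 q1; nra.
have S1 : -1 < S x y < 1 by rewrite -ltr_norml; lra.
have S1' : -1 <= S x y <= 1 by move/andP: S1 => [? ?]; rewrite !ltW.
split=> //.
pose C := p y * p x + q y * q x.
have C0 : 0 <= C.
  have h1 : (p y - p x) ^+ 2 <= 1.
    by rewrite -(expr1n _ 2) -[leLHS]real_normK ?num_real// lerXn2r ?nnegrE//; lra.
  have h2 : (q y - q x) ^+ 2 <= 1.
    by rewrite -(expr1n _ 2) -[leLHS]real_normK ?num_real// lerXn2r ?nnegrE//; lra.
  by move: (pq1 x) (pq1 y); rewrite /C; nra.
have CE : cos (asin (S x y)) = C.
  rewrite cos_asin// -[RHS]ger0_norm// -sqrtr_sqr; congr Num.sqrt.
  have <- : (p x ^+ 2 + q x ^+ 2) * (p y ^+ 2 + q y ^+ 2) = 1 by rewrite !pq1 mulr1.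
  by rewrite /S /C; ring.
apply: cplx_ext; rewrite !ReImE !ReImV CE asinK ?in_itv//= /S /C.
  transitivity (p y * (p x ^+ 2 + q x ^+ 2)); first by rewrite pq1 mulr1.
  by ring.
transitivity (q y * (p x ^+ 2 + q x ^+ 2)); first by rewrite pq1 mulr1.
by ring.
Qed.

Let local_lift (n : nat) : exists th, [/\ continuous th, th 0 = a0 &
  forall x, expi (th x) = M (clamp n%:R x)].
Proof.
have [d1 d10 H1] := @pU n%:R 8^-1 ltac:(by rewrite invr_gt0 ltr0n).
have [d2 d20 H2] := @qU n%:R 8^-1 ltac:(by rewrite invr_gt0 ltr0n).
pose d := Num.min d1 d2.
have d0 : 0 < d by rewrite lt_min d10.
(* For |x| <= n, cutting [0, x] into N equal pieces gives steps shorter than d. *)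
pose N := (Num.truncn (n%:R / d)).+1.
have Nd : n%:R < N%:R * d by rewrite -ltr_pdivrMr//; exact: truncnS_gt.
pose c (x : R) := clamp n%:R x.
have cn x : `|c x| <= n%:R by apply: clamp_le; rewrite ler0n.
pose pt (i : nat) (x : R) := (i%:R / N%:R) * c x.
have N0 : 0 < N%:R :> R by rewrite ltr0n.
have pt_le i x : (i <= N)%N -> `|pt i x| <= n%:R.
  move=> iN; rewrite /pt normrM ger0_norm ?divr_ge0// -[leRHS]mul1r.
  by apply: ler_pM => //; rewrite ler_pdivrMr// mul1r ler_nat.
have pt_step i x : `|pt i.+1 x - pt i x| < d.
  rewrite /pt -mulrBl -mulrBl -natrB// subSnn mul1r normrM.
  by rewrite [`|_^-1|]ger0_norm ?invr_ge0 ?ler0n// mulrC ltr_pdivrMr// mulrC (le_lt_trans (cn x)).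
have step i x : (i < N)%N ->
    -1 < S (pt i x) (pt i.+1 x) < 1 /\
    M (pt i.+1 x) = M (pt i x) * expi (asin (S (pt i x) (pt i.+1 x))).
  move=> iN; have := pt_step i x; rewrite lt_min => /andP[? ?].
  by apply: expi_step; [apply: H1|apply: H2] => //; apply: pt_le => //; exact: ltnW.
have cpt i : continuous (pt i).
  by move=> x; apply: cvgM; [exact: cvg_cst|exact: continuous_clamp].
have cp : continuous p by exact: unif_on_continuous.
have cq : continuous q by exact: unif_on_continuous.
pose th (k : nat) x := a0 + \sum_(i < k) asin (S (pt i x) (pt i.+1 x)).
have thS k x : th k.+1 x = th k x + asin (S (pt k x) (pt k.+1 x)).
  by rewrite /th big_ord_recr /= addrA.
have th0 x : th 0%N x = a0 by rewrite /th big_ord0 addr0.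
have pt0 x : pt 0%N x = 0 by rewrite /pt !mul0r.
exists (th N); split.
- have : forall k, (k <= N)%N -> continuous (th k); last exact.
  elim=> [|k IH] kN.
    by rewrite (_ : th 0%N = cst a0); [move=> ?; exact: cvg_cst|apply/funext].
  rewrite (_ : th k.+1 = fun x => th k x + asin (S (pt k x) (pt k.+1 x))); last exact/funext.
  move=> x; apply: cvgD; first by apply: IH; exact: ltnW.
  apply: (@continuous_comp _ _ _ (fun x => S (pt k x) (pt k.+1 x)) asin); last first.
    by apply: continuous_asin; have [] := step k x kN.
  have cpp f j : continuous f -> f (pt j y) @[y --> x] --> f (pt j x).
    by move=> cf; apply: (@continuous_comp _ _ _ (pt j) f); [exact: cpt|exact: cf].
  by apply: cvgB; apply: cvgM; apply: cpp.
- have c0 : c 0 = 0 by rewrite /c clampE// normr0 ler0n.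
  rewrite /th big1 ?addr0// => i _.
  rewrite /pt c0 !mulr0 /S mulrC subrr.
  have := @sinK R 0; rewrite sin0 => -> //.
  by rewrite in_itv/= oppr_le0 !divr_ge0 ?pi_ge0.
- move=> x; have : forall k, (k <= N)%N -> expi (th k x) = M (pt k x).
    elim=> [|k IH] kN; first by rewrite th0 pt0; apply: cplx_ext; rewrite /= ?ca0 ?sa0.
    by rewrite thS expiD IH ?(ltnW kN)//; have [_ ->] := step k x kN.
  by move=> /(_ N (leqnn N)) ->; rewrite /pt divff ?mul1r ?gt_eqF.
Qed.

(* On [-n, n] the argument is a finite sum of arcsines along a fine subdivision of
   [0, x]; these lifts agree where they overlap. *)
Lemma continuous_lift : exists2 th, continuous th &
  forall x, cos (th x) = p x /\ sin (th x) = q x.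
Proof.
have [th Hth] := choice local_lift.
have agree (m n : nat) x : (m <= n)%N -> `|x| <= m%:R -> th n x = th m x.
  move=> mn xm; have [cm m0 Hm] := Hth m; have [cn n0 Hn] := Hth n.
  have cm0 : 0 <= m%:R :> R by rewrite ler0n.
  have E y : expi (th n (clamp m%:R y)) = expi (th m y).
    by rewrite Hn Hm [in LHS]clampE// (le_trans (clamp_le _ cm0))// ler_nat.
  have := @expi_continuous_unique (fun y => th n (clamp m%:R y)) (th m) _ cm E x.
  rewrite (clampE xm) clampE ?normr0// n0 m0 subrr => /(_ _)/eqP.
  rewrite subr_eq0 => H; apply/eqP; apply: H => y.
  by apply: (@continuous_comp _ _ _ (clamp m%:R) (th n)); [exact: continuous_clamp|exact: cn].
pose k x := (Num.truncn `|x|).+1.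
have kx x : `|x| < (k x)%:R by exact: truncnS_gt.
have E x (n : nat) : `|x| <= n%:R -> th (k x) x = th n x.
  move=> xn; have [kn|/ltnW nk] := leqP (k x) n; last exact: agree.
  by apply/esym; apply: agree => //; exact/ltW.
exists (fun x => th (k x) x) => [x|x]; last first.
  have [_ _ /(_ x)] := Hth (k x); rewrite clampE; last exact/ltW.
  by move=> H; split; [rewrite -Re_expi H|rewrite -Im_expi H].
have [cn _ _] := Hth (k x).
have H0 : `|x| <= (k x)%:R by exact/ltW.
apply/cvgrPdist_le => e e0; have /cvgrPdist_le/(_ e e0) := cn x.
(* In this neighbourhood of x one has |y| < k x, so the single lift [th (k x)] gives the value at y
   as well. *)
apply: filter_app; exists ((k x)%:R - `|x|); first by rewrite /= subr_gt0.
move=> y /= yx H; rewrite (E y (k x))//.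
by have := ler_normD x (y - x); rewrite addrC subrK distrC; lra.
Qed.

End lift.
End Lifting.

(** * A continuous version in the logarithmic variable *)

Section ContinuousVersion.
Context {R : realType}.
Local Notation mu := (leb R).
Implicit Types (f g : R -> R) (x y s t e d l r L : R) (D : set R).

Lemma Rint_ae_bound f (a b e : R) : rL1 f -> a <= b -> 0 <= e ->
  {ae mu, forall x, `|f x| <= e * \1_(`[a, b]%classic) x} ->
  `|\int[mu]_x f x| <= e * (b - a).
Proof.
move=> f1 ab e0 fe; apply: le_trans (le_normr_Rintegral _ f1) _ => //.
have i1 : rL1 (fun x => e * \1_(`[a, b]%classic) x).
  by apply: L1Z; exact: integrable_indic_itv.
have -> : e * (b - a) = \int[mu]_x (e * \1_(`[a, b]%classic) x).
  have mI : mu `[a, b]%classic = (b - a)%:E.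
    rewrite lebesgue_measure_itv/= lte_fin; case: ltgtP ab => // -> _.
    by rewrite subrr.
  by rewrite Rint_indic (Rintegral_cst mu)// -[b - a]/(fine (b - a)%:E) -mI.
have n1 := L1_norm f1.
apply: fine_le; do ?exact: integrable_fin_num.
apply: ae_ge0_le_integral => //.
- by apply: measurable_int n1.
- by move=> x _; rewrite lee_fin mulr_ge0.
- by apply: measurable_int i1.
- by apply: ae_imp fe => x H _; rewrite lee_fin.
Qed.

Section almost_dilation_continuous.
Variable f : R -> R.
Hypothesis mf : measurable_fun [set: R] f.
Hypothesis f1 : forall x, `|f x| <= 1.

Let fl : locally_integrable [set: R] f.
Proof. exact: bounded_locally_integrable f1. Qed.

Let L1_cut g (a b : R) : measurable_fun [set: R] g -> (forall x, `|g x| <= 1) ->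
  rL1 (fun x => g x * \1_(`[a, b]%classic) x).
Proof.
move=> mg g1; rewrite (_ : (fun x => _) = fun x => \1_(`[a, b]%classic) x * g x).
  by apply: L1M_bounded mg g1; exact: integrable_indic_itv.
by apply/funext => x; rewrite mulrC.
Qed.

(** Averages of f around x and around l * x, over intervals corresponding under the dilation,
    approximate f x and f (l * x). The substitution u -> l * u turns their difference into an
    average of f (l * u) - f u, which is bounded almost everywhere. Thus a bound whose null set
    depends on l reaches every pair of Lebesgue points. *)
Lemma lebesgue_pt_dilation x l e : 0 < x -> 0 < l -> 0 <= e ->
  lebesgue_pt f x -> lebesgue_pt f (l * x) ->
  (exists2 d, 0 < d &
    {ae mu, forall xi, x - d <= xi <= x + d -> `|f (l * xi) - f xi| <= e}) ->
  `|f (l * x) - f x| <= e.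
Proof.
move=> x0 l0 e0 fx fy [d d0 H].
apply/ler_addgt0Pr => e' e'0.
have e20 : 0 < e' / 2 by rewrite divr_gt0.
have [d1 d10 H1] := lebesgue_pt_average fl fx e20.
have [d2 d20 H2] := lebesgue_pt_average fl fy e20.
pose rho := Num.min d (Num.min d1 (d2 / l)) / 2.
have m0 : 0 < Num.min d (Num.min d1 (d2 / l)) by rewrite !lt_min d0 d10 divr_gt0.
have r0 : 0 < rho by rewrite divr_gt0.
have : rho < Num.min d (Num.min d1 (d2 / l)) by rewrite /rho; lra.
rewrite !lt_min => /and3P[rd rd1 rd2]; clearbody rho.
have {}H1 := H1 rho; rewrite r0 rd1 in H1; have {}H1 := H1 isT.
have lr : 0 < l * rho < d2 by rewrite mulr_gt0//= mulrC -ltr_pdivlMr.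
have {}H2 := H2 _ lr.
set I1 := \int[mu]_(y in `[x - rho, x + rho]) f y in H1.
set I2 := \int[mu]_(y in _) f y in H2.
have ln0 : l != 0 by rewrite gt_eqF.
have L1g : rL1 (fun u => f (l * u + 0) * \1_(`[x - rho, x + rho]%classic) u).
  by apply: L1_cut => //; exact: measurable_affine.
have L1f : rL1 (fun u => f u * \1_(`[x - rho, x + rho]%classic) u) by exact: L1_cut.
have E2 : I2 = l * \int[mu]_u (f (l * u + 0) * \1_(`[x - rho, x + rho]%classic) u).
  rewrite /I2 -Rint_indic (@Rint_affine R l 0 ln0); last exact: L1_cut.
  rewrite ger0_norm ?ltW//; congr (_ * _); apply: eq_Rintegral => u _; congr (_ * _).
  rewrite !indicE; congr ((_ : bool)%:R); apply/idP/idP; rewrite !inE /= !in_itv/= addr0.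
    by rewrite -mulrBr -mulrDr !ler_pM2l.
  by rewrite -mulrBr -mulrDr !ler_pM2l.
have E1 : I1 = \int[mu]_u (f u * \1_(`[x - rho, x + rho]%classic) u) by rewrite Rint_indic.
have K : `|I2 / l - I1| <= e * (2 * rho).
  rewrite E2 mulrAC divff// mul1r E1 -RintegralB//.
  have -> : 2 * rho = (x + rho) - (x - rho) by ring.
  apply: Rint_ae_bound => //; [exact: L1B|lra|].
  apply: ae_imp H => u Hu; rewrite indicE; case: (boolP (u \in _)) => [/set_mem/=|_].
    rewrite in_itv/= => /andP[u1 u2]; rewrite !mulr1 addr0; apply: Hu; apply/andP; lra.
  by rewrite !mulr0 subrr normr0.
have {}H2 : `|I2 / l - 2 * rho * f (l * x)| <= 2 * rho * (e' / 2).
  rewrite -(ler_pM2l l0); apply: le_trans (_ : _ <= 2 * (l * rho) * (e' / 2)) _; last lra.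
  rewrite -{1}[l](ger0_norm (ltW l0)) -normrM; apply: le_trans H2.
  by rewrite le_eqVlt; apply/orP; left; apply/eqP; congr (`|_|); field.
have T : `|2 * rho * (f (l * x) - f x)| <= 2 * rho * (e + e').
  have -> : 2 * rho * (f (l * x) - f x) =
      (I2 / l - I1) - (I2 / l - 2 * rho * f (l * x)) + (I1 - 2 * rho * f x) by ring.
  apply: le_trans (ler_normD _ _) _; apply: le_trans (lerD (ler_normB _ _) (lexx _)) _.
  by move: K H1 H2; lra.
by move: T; rewrite normrM (ger0_norm (_ : 0 <= 2 * rho)) ?ler_pM2l//; lra.
Qed.

Hypothesis luc : forall r e, 1 < r -> 0 < e -> exists2 d, 0 < d &
  forall l, 0 < l -> `|l - 1| < d ->
  {ae mu, forall xi, r^-1 <= `|xi| <= r -> `|f (l * xi) - f xi| <= e}.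

Lemma log_uniform (L e : R) : 0 < e -> exists2 d, 0 < d &
  forall s t, lebesgue_pt f (expR s) -> lebesgue_pt f (expR t) -> `|s| <= L ->
  `|t - s| < d -> `|f (expR t) - f (expR s)| <= e.
Proof.
(* The added 1 keeps exp s in the interior of the band when |s| <= L, so that a whole interval
   around it is available. *)
move=> e0; pose r := expR (`|L| + 1).
have r1 : 1 < r by rewrite expR_gt1 ltr_wpDl.
have [d d0 Hd] := luc r1 e0.
have [d' d'0 Hd'] := continuousP_eps (@continuous_expR R) 0 d0.
exists d' => // s t fs ft sL ts.
have E : expR t = expR (t - s) * expR s by rewrite -expRD subrK.
rewrite E; apply: lebesgue_pt_dilation; rewrite ?expR_gt0 ?(ltW e0) -?E//.
have sr : r^-1 < expR s < r.
  rewrite /r -expRN !ltr_expR; move: sL (ler_norm L); rewrite ler_norml; lra.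
have [s1 s2] := andP sr.
exists (Num.min (expR s - r^-1) (r - expR s)).
  by rewrite lt_min !subr_gt0.
have tl : `|expR (t - s) - 1| < d.
  by rewrite distrC -expR0 Hd'// sub0r normrN.
apply: ae_imp (Hd _ (expR_gt0 _) tl) => xi Hxi /andP[x1 x2]; apply: Hxi.
have m1 : Num.min (expR s - r^-1) (r - expR s) <= expR s - r^-1 by rewrite ge_min lexx.
have m2 : Num.min (expR s - r^-1) (r - expR s) <= r - expR s by rewrite ge_min lexx orbT.
have xi0 : r^-1 <= xi by lra.
rewrite ger0_norm; last by apply: le_trans xi0; rewrite invr_ge0 expR_ge0.
by rewrite xi0; lra.
Qed.

End almost_dilation_continuous.

Lemma ae_exists (P : R -> Prop) (a b : R) : {ae mu, forall x, P x} -> a < b ->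
  exists2 x, a < x < b & P x.
Proof.
move=> [N [mN N0 PN]] ab; apply: contrapT => H.
have : (mu `]a, b[%classic <= mu N)%E.
  apply: le_measure; rewrite ?inE//; move=> x /=; rewrite in_itv/= => xab.
  by apply: PN => Px; apply: H; exists x.
by rewrite N0 lebesgue_measure_itv/= lte_fin ab -EFinB lee_fin; lra.
Qed.

Definition rdense D := forall x e, 0 < e -> exists2 s, D s & `|x - s| < e.

(** The exponential maps an interval to one of positive measure, which a null set cannot cover. *)
Lemma ae_rdense (P : R -> Prop) : {ae mu, forall x, 0 < x -> P x} ->
  rdense [set t | P (expR t)].
Proof.
move=> aeP x e e0.
have [|y /andP[y1 y2] Py] := @ae_exists _ (expR (x - e)) (expR (x + e)) aeP.
  by rewrite ltr_expR; lra.
have y0 : 0 < y by apply: lt_trans y1; rewrite expR_gt0.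
have yE : expR (ln y) = y by rewrite lnK.
exists (ln y); first by rewrite /= yE; exact: Py.
by move: y1 y2; rewrite -{1 2}yE !ltr_expR => y1 y2; rewrite ltr_norml; lra.
Qed.

Lemma eq_on_rdense D f g : rdense D -> continuous f -> continuous g ->
  (forall t, D t -> f t = g t) -> forall t, f t = g t.
Proof.
move=> dD cf cg fg t; apply/eqP; rewrite -subr_eq0 -normr_eq0 eq_le normr_ge0 andbT.
apply/ler_addgt0Pr => e e0; rewrite add0r.
have e20 : 0 < e / 2 by rewrite divr_gt0.
have [d1 d10 H1] := continuousP_eps cf t e20.
have [d2 d20 H2] := continuousP_eps cg t e20.
have [|s Ds] := dD t (Num.min d1 d2); first by rewrite lt_min d10.
rewrite lt_min => /andP[s1 s2].
have -> : f t - g t = (f t - f s) - (g t - g s) by rewrite (fg s Ds); ring.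
apply: le_trans (ler_normB _ _) _.
by have := H1 _ s1; have := H2 _ s2; lra.
Qed.

(* The extension takes the value [liminf g] along D. *)
Lemma unif_extension D g : rdense D -> (forall t, `|g t| <= 1) ->
  (forall L e, 0 < e -> exists2 d, 0 < d & forall s t, D s -> D t -> `|s| <= L ->
     `|t - s| < d -> `|g t - g s| <= e) ->
  exists2 F, (forall L, unif_on L F) & forall t, D t -> F t = g t.
Proof.
move=> dD g1 ug.
pose V t := [set v | exists2 d, 0 < d & forall s, D s -> `|t - s| < d -> v <= g s].
pose F t := sup (V t).
have H L e : 0 < e -> exists2 d, 0 < d & forall t s, `|t| <= L -> D s ->
    `|t - s| < d -> `|g s - F t| <= e.
  move=> e0; have [d d0 Hd] := ug (L + 1) e e0.
  pose d' := Num.min (d / 2) 1.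
  have d'0 : 0 < d' by rewrite lt_min divr_gt0 ?ltr01.
  exists d'; first exact: d'0.
  move=> t s tL Ds; rewrite lt_min => /andP[ts ts1].
  have sL : `|s| <= L + 1.
    by have := ler_normD t (s - t); rewrite addrC subrK distrC; lra.
  have near_s u : D u -> `|t - u| < d / 2 -> `|g u - g s| <= e.
    move=> Du tu; apply: Hd => //.
    have -> : u - s = (t - s) - (t - u) by ring.
    by apply: le_lt_trans (ler_normB _ _) _; lra.
  have Vs : V t (g s - e).
    exists (d / 2); first by rewrite divr_gt0.
    by move=> u Du /(near_s u Du); rewrite ler_norml; lra.
  have ubV : ubound (V t) (g s + e).
    move=> v [d1 d10 Hv].
    have [|u Du] := dD t (Num.min d1 (d / 2)); first by rewrite lt_min d10 divr_gt0.
    rewrite lt_min => /andP[u1 u2].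
    by have := Hv u Du u1; have := near_s u Du u2; rewrite ler_norml; lra.
  have l1 : g s - e <= F t by apply: sup_upper_bound => //; split; [exists (g s - e)|exists (g s + e)].
  have l2 : F t <= g s + e by apply: ge_sup => //; exists (g s - e).
  by rewrite ler_norml; lra.
exists F => [L e e0|t Dt].
  have e20 : 0 < e / 2 by rewrite divr_gt0.
  have [d d0 Hd] := H L _ e20.
  exists (d / 2); first by rewrite divr_gt0.
  move=> x y xL yL xy.
  have [|s Ds ys] := dD y (d / 2); first by rewrite divr_gt0.
  have -> : F x - F y = (g s - F y) - (g s - F x) by ring.
  apply: le_trans (ler_normB _ _) _.
  have h1 : `|g s - F y| <= e / 2 by apply: Hd => //; lra.
  have h2 : `|g s - F x| <= e / 2.
    apply: Hd => //; have -> : x - s = (x - y) + (y - s) by ring.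
    by apply: le_lt_trans (ler_normD _ _) _; lra.
  by lra.
apply/eqP; rewrite -subr_eq0 -normr_eq0 eq_le normr_ge0 andbT.
apply/ler_addgt0Pr => e e0; rewrite add0r distrC.
have [d d0 Hd] := H `|t| e e0.
by apply: Hd => //; rewrite subrr normr0.
Qed.

End ContinuousVersion.

(** * The phase of the multiplier *)

Section PhaseOfMultiplier.
Context {R : realType}.
Local Notation mu := (leb R).

Lemma continuous_cos_comp (f : R -> R) : continuous f -> continuous (fun t => cos (f t)).
Proof.
by move=> cf t; apply: (@continuous_comp _ _ _ f cos); [exact: cf|exact: continuous_cos].
Qed.

Lemma continuous_sin_comp (f : R -> R) : continuous f -> continuous (fun t => sin (f t)).
Proof.
by move=> cf t; apply: (@continuous_comp _ _ _ f sin); [exact: cf|exact: continuous_sin].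
Qed.

Lemma expi_eq_on_rdense (D : set R) (f h : R -> R) : rdense D -> continuous f ->
  continuous h -> (forall t, D t -> expi (f t) = expi (h t)) ->
  forall t, expi (f t) = expi (h t).
Proof.
move=> dD cf ch fh t; apply: cplx_ext; rewrite !ReImV.
  apply: (eq_on_rdense dD (continuous_cos_comp cf) (continuous_cos_comp ch)) => s Ds.
  by rewrite -!Re_expi fh.
apply: (eq_on_rdense dD (continuous_sin_comp cf) (continuous_sin_comp ch)) => s Ds.
by rewrite -!Im_expi fh.
Qed.

Lemma expiMn (t : R) n : expi (n%:R * t) = expi t ^+ n.
Proof.
elim: n => [|n IH]; first by rewrite mul0r expr0 expi0.
by rewrite -addn1 natrD mulrDl mul1r expiD IH addn1 exprSr.
Qed.

Lemma continuous_scale (c : R) (f : R -> R) : continuous f -> continuous (fun t => c * f t).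
Proof. by move=> cf t; apply: cvgM; [exact: cvg_cst|exact: cf]. Qed.

Variable m : R -> R[i].
Hypothesis mm : measurable_complex m.
Hypothesis m1 : forall x, normc (m x) = 1.
Hypothesis luc : forall r e : R, 1 < r -> 0 < e -> exists2 d : R, 0 < d &
  forall l, 0 < l -> `|l - 1| < d ->
  {ae mu, forall xi, r^-1 <= `|xi| <= r -> normc (m (l * xi) - m xi) <= e}.

Let p x := Re (m x).
Let q x := Im (m x).
(** At these points the value of m is the limit of averages, hence determined by its class almost
    everywhere. *)
Let good xi := lebesgue_pt p xi /\ lebesgue_pt q xi.

Let p1 x : `|p x| <= 1. Proof. by rewrite -(m1 x); exact: normc_Re. Qed.
Let q1 x : `|q x| <= 1. Proof. by rewrite -(m1 x); exact: normc_Im. Qed.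

Let ae_good : {ae mu, forall xi, good xi}.
Proof.
have := lebesgue_differentiation (bounded_locally_integrable mm.1 p1).
have := lebesgue_differentiation (bounded_locally_integrable mm.2 q1).
by apply: ae_imp2 => x qx px; split.
Qed.

Let D := [set t : R | good (expR t)].

Let dense_D : rdense D.
Proof. by apply: ae_rdense; apply: ae_imp ae_good. Qed.

Let extension (f : R -> R) : (f = p \/ f = q) ->
  exists2 F : R -> R, (forall L, unif_on L F) & forall t, D t -> F t = f (expR t).
Proof.
move=> fpq; have mf : measurable_fun [set: R] f by case: fpq => ->; case: mm.
have f1 x : `|f x| <= 1 by case: fpq => ->.
have lf t : D t -> lebesgue_pt f (expR t) by case: fpq => -> [].
have lucf (r e : R) : 1 < r -> 0 < e -> exists2 d : R, 0 < d &
  forall l, 0 < l -> `|l - 1| < d ->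
  {ae mu, forall xi, r^-1 <= `|xi| <= r -> `|f (l * xi) - f xi| <= e}.
  move=> r1 e0; have [d d0 Hd] := luc r1 e0.
  exists d => // l l0 ld; apply: ae_imp (Hd l l0 ld) => xi H /H; apply: le_trans.
  case: fpq => ->; first by rewrite /p -cReN -cReD; exact: normc_Re.
  by rewrite /q -cImN -cImD; exact: normc_Im.
apply: (@unif_extension _ D (fun t => f (expR t)) dense_D) => [t|L e e0]; first exact: f1.
have [d d0 Hd] := log_uniform mf f1 lucf L e0.
exists d; first exact: d0.
by move=> s t Ds Dt sL ts; apply: Hd (lf _ Ds) (lf _ Dt) sL ts.
Qed.

Let lift : exists2 th : R -> R, continuous th & forall t, D t -> m (expR t) = expi (th t).
Proof.
have [P uP EP] := extension (or_introl erefl).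
have [Q uQ EQ] := extension (or_intror erefl).
have cP := unif_on_continuous uP; have cQ := unif_on_continuous uQ.
have PQ1 t : P t ^+ 2 + Q t ^+ 2 = 1.
  have cPQ : continuous (fun t => P t ^+ 2 + Q t ^+ 2).
    move=> x; rewrite (_ : (fun _ => _) = fun t => P t * P t + Q t * Q t).
      by apply: cvgD; apply: cvgM; (exact: cP || exact: cQ).
    by apply/funext.
  have c1 : continuous (fun _ : R => 1 : R) by move=> ?; exact: cvg_cst.
  apply: (eq_on_rdense dense_D cPQ c1) => {}t Dt.
  by rewrite EP// EQ// /p /q -sqr_normcE m1 expr1n.
have [a [ca sa]] := polar_angle (PQ1 0).
have [th cth Hth] := continuous_lift PQ1 uP uQ ca sa.
exists th => // t Dt; have [ct st] := Hth t.
by apply: cplx_ext; rewrite !ReImV ?ct ?st ?EP ?EQ.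
Qed.

(** The relation holds at exp t for a dense set of t such that exp t and a * exp t are both good
    points; continuity extends it to all t. *)
Let scaling (th : R -> R) (a : R) (k : nat) : continuous th ->
  (forall t, D t -> m (expR t) = expi (th t)) ->
  0 < a -> {ae mu, forall xi, m (a * xi) = m xi ^+ k} ->
  forall t, expi (th (t + ln a)) = expi (k%:R * th t).
Proof.
move=> cth Hth a0 Ha.
have a_ne : a != 0 by rewrite gt_eqF.
pose E xi := [/\ good xi, good (a * xi + 0) & m (a * xi) = m xi ^+ k].
have dE : rdense [set t | E (expR t)].
  apply: ae_rdense; apply: ae_imp3 ae_good (ae_affine 0 a_ne ae_good) Ha.
  by move=> x ? ? ? _; split.
have EE t : E (expR t) -> expi (th (t + ln a)) = expi (k%:R * th t).
  have at_ : expR (t + ln a) = a * expR t by rewrite expRD lnK// mulrC.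
  move=> [Dt]; rewrite addr0 -at_ => Dat Em.
  by rewrite expiMn -(Hth t Dt) -(Hth (t + ln a) Dat); exact: Em.
exact: expi_eq_on_rdense dE (continuous_addr_arg (c := ln a) cth)
  (continuous_scale (c := k%:R) cth) EE.
Qed.

Let phase_positive (a b : R) : 0 < a -> 0 < b ->
  {ae mu, forall xi, m (a * xi) = m xi ^+ 2} ->
  {ae mu, forall xi, m (b * xi) = m xi ^+ 3} ->
  exists al be : R, al != 0 /\
    {ae mu, forall xi, 0 < xi -> m xi = expi (be * xi `^ al)}.
Proof.
move=> a0 b0 Ha Hb; have [th cth Hth] := lift.
have H2 := scaling cth Hth a0 Ha; have H3 := scaling cth Hth b0 Hb.
have c2 := expi_continuous_unique (continuous_addr_arg (c := ln a) cth) (continuous_scale (c := 2) cth) H2.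
(* The constant defect of the equation for a. It is a multiple of 2 pi, so adding it to th keeps the
   lift, and it makes the equation exact. *)
pose c := th (0 + ln a) - 2 * th 0.
pose psi t := th t + c.
have c1 : expi c = 1 by rewrite /c expiD expiN H2 -expiN -expiD subrr expi0.
have epsi t : expi (psi t) = expi (th t) by rewrite /psi expiD c1 mulr1.
have cpsi : continuous psi by move=> t; apply: cvgD; [exact: cth|exact: cvg_cst].
have psi2 t : psi (t + ln a) = 2 * psi t by move: (c2 t); rewrite /psi /c; lra.
clearbody psi.
have H3' t : expi (psi (t + ln b)) = expi (3 * psi t).
  by rewrite epsi H3 !expiMn epsi.
have c3 := expi_continuous_unique (continuous_addr_arg (c := ln b) cpsi) (continuous_scale (c := 3) cpsi) H3'.
(* The defect for b is a constant k. Evaluating psi at t + ln a + ln b in two ways gives 2 k = k. *)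
have psi3 t : psi (t + ln b) = 3 * psi t.
  have K1 := c3 t; have := c3 (t + ln a).
  rewrite addrAC (psi2 (t + ln b)) (psi2 t); move: K1; lra.
have [al [be [al0 Hpsi]]] := scaling_exponential cpsi psi2 psi3.
exists al, be; split => //; apply: ae_imp ae_good => x gx x0.
have xE : expR (ln x) = x by rewrite lnK.
rewrite -{1}xE Hth /D /= ?xE// -epsi Hpsi; congr (expi (_ * _)).
by rewrite /powR gt_eqF.
Qed.

Lemma phase_of_multiplier (a b : R) : 0 < a -> 0 < b ->
  {ae mu, forall xi, m (a * xi) = m xi ^+ 2} ->
  {ae mu, forall xi, m (b * xi) = m xi ^+ 3} ->
  {ae mu, forall xi, m (- xi) = m xi} ->
  exists al be : R, al != 0 /\
    {ae mu, forall xi, m xi = expi (be * `|xi| `^ al)}.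
Proof.
move=> a0 b0 Ha Hb Hs; have [al [be [al0 H]]] := phase_positive a0 b0 Ha Hb.
exists al, be; split => //.
have N1 : (-1 : R) != 0 by rewrite oppr_eq0 oner_neq0.
have H' : {ae mu, forall x, 0 < - x -> m x = expi (be * (- x) `^ al)}.
  apply: ae_imp2 _ (ae_affine 0 N1 H) Hs => x.
  by rewrite mulN1r addr0 => Hx sx /Hx; rewrite sx.
apply: ae_imp3 _ H H' (ae_neq (0 : R)) => x Hp Hn x0.
have [xp|xn] := ltrP 0 x; first by rewrite ger0_norm ?Hp// ltW.
have xn' : x < 0 by rewrite lt_neqAle x0.
by rewrite ltr0_norm// Hn// oppr_gt0.
Qed.

End PhaseOfMultiplier.

(** * Groups of Schroedinger operators *)

Section MeasurableAdditive.
Context {R : realType}.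
Local Notation mu := (leb R).
Implicit Types (s t x K d : R).

Lemma completed_measurable_inner (A : set R) :
  (completed_algebra_gen mu).-sigma.-measurable A ->
  exists B N : set R, [/\ measurable B, mu.-negligible N & A = B `|` N].
Proof.
rewrite g_sigma_completed_algebra_genE => -[B mB [N nN] <-].
by exists B, N; split.
Qed.

(** C and its translate by - t lie in [-1/4, 5/4], of length 3/2, and each has measure above 3/4:
    they meet. *)
Lemma steinhaus (C : set R) t : measurable C -> C `<=` `[0, 1] ->
  (((3 / 4)%R)%:E < mu C)%E -> `|t| < 4^-1 -> exists2 x, C x & C (x + t).
Proof.
move=> mC C01 mu34 t4; apply: contrapT => H.
have one0 : (1 : R) != 0 by exact: oner_neq0.
pose D := (fun x => 1 * x + t) @^-1` C.
have mD : measurable D by exact: measurable_affine_preimage.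
have muD : mu D = mu C by rewrite (@leb_affine R 1 t one0 C mC) normr1 mul1e.
have CD0 : C `&` D = set0.
  by apply/seteqP; split => // x [Cx]; rewrite /D /= mul1r => Cxt; apply: H; exists x.
have CDJ (x : R) : (C `|` D) x -> - 4^-1 <= x <= 5 / 4.
  move: t4; rewrite ltr_norml => /andP[t1 t2] [/C01|/C01] /=; rewrite in_itv/=.
    by move=> /andP[x0 x1]; apply/andP; split; lra.
  by rewrite mul1r => /andP[x0 x1]; apply/andP; split; lra.
pose J := [set` `[- 4^-1 : R, 5 / 4]].
have : (mu (C `|` D) <= mu J)%E.
  apply: le_measure; rewrite ?inE; [exact: measurableU|exact: measurable_itv|].
  by move=> x /CDJ H'; rewrite /J /= in_itv.
have -> : mu (C `|` D) = (mu C + mu C)%E by rewrite -{2}muD; exact: measureU.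
have -> : mu J = ((3 / 2)%R)%:E.
  rewrite /J lebesgue_measure_itv/= lte_fin ifT; last by lra.
  by rewrite -EFinB; congr EFin; lra.
move=> le2.
have := lteD mu34 mu34; rewrite -EFinD => lt2.
by have := lt_le_trans lt2 le2; rewrite lte_fin; lra.
Qed.

Section additive.
Variable be : R -> R.
Hypothesis beD : forall s t, be (s + t) = be s + be t.

Lemma additive0 : be 0 = 0.
Proof. by have := beD 0 0; rewrite addr0; lra. Qed.

Lemma additiveN t : be (- t) = - be t.
Proof. by have := beD t (- t); rewrite subrr additive0; lra. Qed.

Lemma additiveMn n t : be (n%:R * t) = n%:R * be t.
Proof.
elim: n => [|n IH]; first by rewrite !mul0r additive0.
by rewrite -addn1 natrD !mulrDl !mul1r beD IH.
Qed.
End additive.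

(** Vanishing at 1 makes ga 1-periodic. Dividing [0, 1[ by n > 1 / d brings it into the range of the
    bound, so ga is bounded by n * K everywhere; the multiples of a nonzero value would be
    unbounded. *)
Lemma additive_bounded_eq0 (ga : R -> R) K d : (forall s t, ga (s + t) = ga s + ga t) ->
  0 < d -> (forall t, `|t| < d -> `|ga t| <= K) -> ga 1 = 0 -> forall t, ga t = 0.
Proof.
move=> gaD d0 gaK ga1.
pose n := (Num.truncn d^-1).+1.
have n0 : 0 < n%:R :> R by rewrite ltr0n.
have nd : n%:R^-1 < d by rewrite invf_plt ?posrE//; exact: truncnS_gt.
have gaz (k : int) : ga k%:~R = 0.
  case: k => k; first by rewrite -pmulrn -[k%:R]mulr1 additiveMn// ga1 mulr0.
  by rewrite NegzE mulrNz additiveN// -pmulrn -[_%:R]mulr1 additiveMn// ga1 mulr0 oppr0.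
have bnd t : `|ga t| <= n%:R * K.
  have /andP[r0 r1] := floor_rem t (@ltr01 R).
  set r := t - _ in r0 r1.
  have -> : ga t = ga r.
    by rewrite /r mulr1 gaD additiveN// gaz oppr0 addr0.
  have -> : r = n%:R * (r / n%:R) by field; rewrite gt_eqF.
  rewrite additiveMn// normrM ger0_norm ?ler0n// ler_pM2l//; apply: gaK.
  rewrite ger0_norm ?divr_ge0 ?ler0n//; apply: le_lt_trans nd.
  by rewrite -[leRHS]mul1r ler_pM2r ?invr_gt0// ltW.
move=> t; apply: contrapT => /eqP gt0.
have gp : 0 < `|ga t| by rewrite normr_gt0.
have := bnd ((Num.truncn (n%:R * K / `|ga t|)).+1%:R * t).
rewrite additiveMn// normrM ger0_norm ?ler0n// leNgt -ltr_pdivrMr//.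
by rewrite truncnS_gt.
Qed.

Local Notation L := (g_sigma_algebraType (completed_algebra_gen mu)).

(* Some set [|be| <= n] contains a Borel set of measure > 3/4 in [0, 1], so by
   Steinhaus [be] is bounded near 0. *)
Lemma additive_measurable_linear (be : R -> R) :
  (forall s t, be (s + t) = be s + be t) ->
  measurable_fun [set: L] (be : L -> R) -> forall t, be t = t * be 1.
Proof.
move=> beD mbe.
pose A (n : nat) := [set t : R | `|be t| <= n%:R].
have mA n : (completed_algebra_gen mu).-sigma.-measurable (A n).
  have -> : A n = be @^-1` `[- n%:R, n%:R].
    by apply/seteqP; split => t /=; rewrite in_itv/= -ler_norml.
  rewrite -[X in _ X]setTI; apply: mbe => //; exact: measurable_itv.
have /choice[B HB] n := completed_measurable_inner (mA n).
have /choice[N {}HB] := HB.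
have mB n : measurable (B n) by have [] := HB n.
have BA n : B n `<=` A n by have [_ _ ->] := HB n; exact: subsetUl.
pose F n := (\big[setU/set0]_(i < n.+1) B i) `&` `[0, 1].
have mF n : measurable (F n).
  by apply: measurableI => //; apply: bigsetU_measurable.
have ndF : nondecreasing_seq F.
  by move=> i j ij; apply/subsetPset; apply: setSI; exact: subset_bigsetU.
have UF : \bigcup_n F n = (\bigcup_n B n) `&` `[0, 1].
  by rewrite -setI_bigcupl bigcup_bigsetU_bigcup.
have mU : measurable (\bigcup_n F n) by exact: bigcup_measurable.
(* Each t lies in [A n] once |be t| <= n, so the sets [B n] cover [0, 1] up to the union of the null
   sets [N n]. *)
have mu1 : (1%:E <= mu (\bigcup_n F n))%E.
  have : mu.-negligible (\bigcup_n N n).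
    by apply: negligible_bigcup => n; have [] := HB n.
  move=> [Z [mZ Z0 NZ]].
  have <- : mu [set` `[0 : R, 1]] = 1%:E.
    by rewrite lebesgue_measure_itv/= lte_fin ltr01 sube0.
  apply: le_trans (_ : _ <= mu ((\bigcup_n F n) `|` Z))%E _.
    apply: le_measure; rewrite ?inE; [exact: measurable_itv|exact: measurableU|].
    move=> t t01; have : A (Num.truncn `|be t|).+1 t by apply: ltW; exact: truncnS_gt.
    have [_ _ ->] := HB (Num.truncn `|be t|).+1 => -[Bt|Nt]; last first.
      by right; apply: NZ; exists (Num.truncn `|be t|).+1.
    by left; rewrite UF; split => //; exists (Num.truncn `|be t|).+1.
  have : (mu ((\bigcup_n F n) `|` Z) <= mu (\bigcup_n F n) + mu Z)%E by exact: measureU2.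
  by rewrite Z0 adde0.
have [n Fn] : exists n, (((3 / 4)%R)%:E < mu (F n))%E.
  apply: contrapT => H.
  have cv : (mu \o F) n @[n --> \oo] --> mu (\bigcup_n F n) by exact: nondecreasing_cvg_mu.
  have : (limn (mu \o F) <= ((3 / 4)%R)%:E)%E.
    have icv : cvgn (mu \o F) by apply/cvg_ex; exists (mu (\bigcup_n F n)).
    apply: (lime_le icv); exists 0%N => // n _.
    by rewrite leNgt; apply/negP => h; apply: H; exists n.
  rewrite (cvg_lim _ cv)// => le34; have := le_trans mu1 le34.
  by rewrite lee_fin; lra.
have bF x : F n x -> `|be x| <= n.+1%:R.
  move=> [+ _]; rewrite -bigcup_mkord => -[i /= iN /BA]; rewrite /A /= => /le_trans; apply.
  by rewrite ler_nat ltnW.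
have F01 : F n `<=` `[0, 1] by move=> x [].
have bnd t : `|t| < 4^-1 -> `|be t| <= n.+1%:R + n.+1%:R.
  move=> t4; have [x Fx Fxt] := steinhaus (mF n) F01 Fn t4.
  have -> : be t = be (x + t) - be x by rewrite beD; ring.
  by apply: le_trans (ler_normB _ _) _; apply: lerD; exact: bF.
move=> t; apply/eqP; rewrite -subr_eq0; apply/eqP.
have d0 : 0 < 4^-1 :> R by rewrite invr_gt0 ltr0n.
(* Subtracting the candidate linear function gives an additive function that vanishes at 1 and is
   still bounded near 0. *)
apply: (@additive_bounded_eq0 (fun t => be t - t * be 1)
  (n.+1%:R + n.+1%:R + `|be 1|) 4^-1) => // [s u|s s4|]; last by rewrite mul1r subrr.
  by rewrite beD; ring.
apply: le_trans (ler_normB _ _) _; apply: lerD; first exact: bnd.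
rewrite normrM -[leRHS]mul1r ler_wpM2r// ltW// (lt_trans s4)//.
by rewrite invf_lt1 ?ltr1n.
Qed.

End MeasurableAdditive.

(** * Operators with a power phase *)

Section Phases.
Context {R : realType}.
Local Notation mu := (leb R).
Local Notation L2 := (L2 R).
Implicit Types (al be : R) (A B : L2 -> L2).

Definition phase al be (xi : R) : R[i] := expi (be * `|xi| `^ al).

Lemma measurable_abs_powR al be : measurable_fun [set: R] (fun xi : R => be * `|xi| `^ al).
Proof.
apply: measurable_funM => //.
apply: (measurableT_comp (measurable_powR al)).
by apply: continuous_measurable_fun; exact: norm_continuous.
Qed.

Lemma mcpx_phase al be : measurable_complex (phase al be).
Proof. by apply: mcpx_expi; exact: measurable_abs_powR. Qed.

Lemma phase0 al : phase al 0 = fun=> 1.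
Proof. by apply/funext => xi; rewrite /phase mul0r expi0. Qed.

Lemma phaseM al be be' xi : phase al be xi * phase al be' xi = phase al (be + be') xi.
Proof. by rewrite /phase -expiD mulrDl. Qed.

Lemma has_phaseP A al be : has_phase A al be <-> is_mult A (phase al be).
Proof.
split=> [hA|[_ hA] f].
  by split; [exact: mcpx_phase|move=> f; have := hA f; rewrite !ftE].
by rewrite !ftE; exact: hA.
Qed.

Lemma mult_phase_id A al : is_mult A (phase al 0) -> A = id.
Proof. by rewrite phase0 => /mult_inj; apply; exact: mult_id. Qed.

Lemma mult_phase_comp A B al be be' : is_mult A (phase al be) ->
  is_mult B (phase al be') -> is_mult (A \o B) (phase al (be + be')).
Proof.
move=> hA hB; apply: mult_ext (mult_comp hA hB) (mcpx_phase _ _) _.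
by apply: aeW => x; rewrite phaseM.
Qed.

Lemma mult_phase_dilate A al be l : 0 < l -> is_mult A (phase al be) ->
  is_mult (dilate_op A l) (phase al (be * l `^ al)).
Proof.
move=> l0 hA; apply: mult_ext (mult_dilate (lt0r_neq0 l0) hA) (mcpx_phase _ _) _.
apply: aeW => x; rewrite /phase normrM (ger0_norm (ltW l0)) powRM ?normr_ge0 ?(ltW l0)//.
by rewrite mulrA.
Qed.

Lemma phase_exists A : unitary A -> semistable A -> translation_invariant A ->
  symmetric_op A -> LUC_under_dilation A ->
  exists al be, al != 0 /\ is_mult A (phase al be).
Proof.
move=> uA sA tA yA lA; have [m [Am m1]] := mult_exists uA tA.
have [a [b [a0 b0 Ha Hb]]] := mult_semistable Am sA.
have [al [be [al0 H]]] := phase_of_multiplier Am.1 m1 (mult_LUC Am lA) a0 b0 Ha Hb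
  (mult_symmetric Am yA).
by exists al, be; split => //; exact: mult_ext Am (mcpx_phase _ _) H.
Qed.

Lemma continuous_expRM (c : R) : continuous (fun t : R => expR (c * t)).
Proof.
move=> t; apply: (@continuous_comp _ _ _ (fun t => c * t) expR); last exact: continuous_expR.
by apply: cvgM; [exact: cvg_cst|exact: cvg_id].
Qed.

(** At xi = exp t both sides are lifts of the same circle-valued function, so they differ by a
    constant, computed at t = 0. *)
Lemma phase_product_log al be al' be' al'' be'' :
  {ae mu, forall xi, phase al be xi * phase al' be' xi = phase al'' be'' xi} ->
  forall t : R, be * expR (al * t) + be' * expR (al' * t) - be'' * expR (al'' * t) =
    be + be' - be''.
Proof.
move=> H.
pose f t := be * expR (al * t) + be' * expR (al' * t).
pose h t := be'' * expR (al'' * t).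
have cf : continuous f.
  by move=> t; apply: cvgD; exact: (continuous_scale (@continuous_expRM _)).
have ch : continuous h by exact: (continuous_scale (@continuous_expRM _)).
pose P (xi : R) := phase al be xi * phase al' be' xi = phase al'' be'' xi.
have dP : rdense [set t | P (expR t)] by apply: ae_rdense; apply: ae_imp H.
have phE a b t : phase a b (expR t) = expi (b * expR (a * t)).
  by rewrite /phase ger0_norm ?expR_ge0// [a * t]mulrC expRM.
have fh : forall t, expi (f t) = expi (h t).
  by apply: (expi_eq_on_rdense dP) => // t; rewrite /= /P !phE -expiD.
move=> t; have := expi_continuous_unique cf ch fh t.
by rewrite /f /h !mulr0 expR0 !mulr1.
Qed.

(** [phase_product_log] with a trivial second factor, at t = 1, gives (be - be') (exp al - 1) =
    0. *)
Lemma phase_coef_inj al be be' : al != 0 ->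
  {ae mu, forall xi, phase al be xi = phase al be' xi} -> be = be'.
Proof.
move=> al0 H.
have := @phase_product_log al be al 0 al be' (ae_imp _ H).
move=> /(_ _ 1); rewrite mul0r addr0 addr0 mulr1.
have e1 : expR al != 1 by rewrite -expR0 (inj_eq (@expR_inj R)).
move=> K; have {}K : (be - be') * (expR al - 1) = 0.
  rewrite mulrBr mulr1 mulrBl; apply/eqP; rewrite subr_eq0; apply/eqP; apply: K.
  by move=> x ->; rewrite phaseM addr0.
by move/eqP: K; rewrite mulf_eq0 !subr_eq0 (negbTE e1) orbF => /eqP.
Qed.

(* The successive differences of the phases at xi = exp 0, ..., exp 3 give
   [b u^k + b' v^k = c w^k] for k = 0, 1, 2, whence [b b' (u - v)^2 = 0]. *)
Lemma phase_exponent_inj al be al' be' al'' be'' : al != 0 -> be != 0 ->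
  al' != 0 -> be' != 0 ->
  {ae mu, forall xi, phase al be xi * phase al' be' xi = phase al'' be'' xi} ->
  al = al'.
Proof.
move=> al0 be0 al'0 be'0 H; have K := phase_product_log H.
set u := expR al; set v := expR al'; set w := expR al''.
have expn (a : R) n : expR (a * n%:R) = expR a ^+ n by rewrite mulrC expRM_natl.
have := K 1; rewrite !mulr1 -/u -/v -/w => K1.
have := K 2%:R; rewrite !expn -/u -/v -/w => K2.
have := K 3%:R; rewrite !expn -/u -/v -/w => K3.
have u1 : u != 1 by rewrite -expR0 (inj_eq (@expR_inj R)).
have v1 : v != 1 by rewrite -expR0 (inj_eq (@expR_inj R)).
pose b := be * (u - 1); pose b' := be' * (v - 1); pose c := be'' * (w - 1).
have b0 : b != 0 by rewrite mulf_neq0 ?subr_eq0.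
have b'0 : b' != 0 by rewrite mulf_neq0 ?subr_eq0.
have E0 : b + b' = c by rewrite /b /b' /c; lra.
have E1 : b * u + b' * v = c * w by rewrite /b /b' /c; lra.
have E2 : b * u ^+ 2 + b' * v ^+ 2 = c * w ^+ 2 by rewrite /b /b' /c; lra.
have : b * b' * (u - v) ^+ 2 = 0.
  have -> : b * b' * (u - v) ^+ 2 =
    (b + b') * (b * u ^+ 2 + b' * v ^+ 2) - (b * u + b' * v) ^+ 2 by ring.
  by rewrite E0 E1 E2; ring.
move/eqP; rewrite mulf_eq0 mulf_eq0 (negbTE b0) (negbTE b'0) /= expf_eq0 /= subr_eq0.
by move=> /eqP; exact: expR_inj.
Qed.

(** The derivative of h |-> sin (x h) at 0, along h = 1 / (n + 1). It recovers a phase from sines of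
    its small multiples. *)
Lemma sin_scaled_cvg (x : R) : n.+1%:R * sin (x * n.+1%:R^-1) @[n --> \oo] --> x.
Proof.
have ds : is_derive (0 : R) (1 : R) (fun h : R => sin (x * h)) x.
  have := deriv_comp (is_derive_sin (x * 0)) (derivZ x (deriv_id 0)).
  by rewrite mulr0 cos0 mul1r mulr1.
have := @ex_derive _ _ _ _ _ _ _ ds; rewrite /derivable => cv.
have {}cv : (h^-1 *: (((fun h => sin (x * h)) \o shift 0) (h *: 1) - sin (x * 0)) @[h --> 0^'] --> x).
  have dv := @derive_val _ _ _ _ _ _ _ ds.
  by rewrite /derive in dv; rewrite dv in cv; exact: cv.
have hn : (n.+1%:R^-1 : R) @[n --> \oo] --> (0 : R)^'.
  move=> P [d /= d0 HP]; have /cvgrPdist_lt/(_ d d0)[N _ HN] := @cvg_harmonic R.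
  exists N => // n /= Nn; apply: HP; last by rewrite gt_eqF// invr_gt0.
  exact: HN.
pose G (h : R) : R := h^-1 *: (((fun h => sin (x * h)) \o shift 0) (h *: 1) - sin (x * 0)).
rewrite (_ : (fun n => _) = G \o (fun n => n.+1%:R^-1)); first exact: cvg_comp hn cv.
apply/funext => n; rewrite /G /= mulr0 sin0 subr0 addr0 invrK.
by congr (_ * sin (x * _)); exact/esym/mulr1.
Qed.

Lemma right_average_cvg (f : R -> R) (c : R) : measurable_fun [set: R] f ->
  (forall x, `|f x| <= 1) -> {for c, continuous f} ->
  n.+1%:R * \int[mu]_x (f x * \1_(`[c, c + n.+1%:R^-1]%classic) x) @[n --> \oo] --> f c.
Proof.
move=> mf f1 cf; apply/cvgrPdist_le => e e0.
have /cvgrPdist_le/(_ e e0)[d /= d0 Hd] := cf.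
have /cvgrPdist_lt/(_ d d0)[N _ HN] := @cvg_harmonic R.
exists N => // n /= Nn; set h := n.+1%:R^-1.
have h0 : 0 < h by rewrite invr_gt0.
have hd : h < d by have := HN n Nn; rewrite /= sub0r normrN gtr0_norm.
have i1 : mu.-integrable [set: R] (EFin \o (\1_(`[c, c + h]%classic) : R -> R)).
  exact: integrable_indic_itv.
have i2 : mu.-integrable [set: R] (EFin \o (fun x => f x * \1_(`[c, c + h]%classic) x)).
  rewrite (_ : (fun x => _) = fun x => \1_(`[c, c + h]%classic) x * f x).
    exact: L1M_bounded i1 mf f1.
  by apply/funext => x; rewrite mulrC.
have i3 := L1Z (f c) i1.
have If : \int[mu]_x (f c * \1_(`[c, c + h]%classic) x) = f c * h.
  have muI : mu [set` `[c, c + h]] = h%:E.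
    rewrite lebesgue_measure_itv/= lte_fin ltrDl h0 -EFinB; congr EFin; lra.
  by rewrite Rint_indic (Rintegral_cst mu)// -[h in RHS]/(fine h%:E) -muI.
have nh : n.+1%:R * h = 1 by rewrite /h divff// pnatr_eq0.
have -> : f c = n.+1%:R * (f c * h) by rewrite mulrCA nh mulr1.
rewrite -If -mulrBr -RintegralB// normrM ger0_norm ?ler0n//.
apply: (@le_trans _ _ (n.+1%:R * (e * h))); last by rewrite mulrCA nh mulr1.
apply: ler_wpM2l => //.
have -> : e * h = e * ((c + h) - c) by ring.
apply: Rint_ae_bound => //; [exact: L1B|by rewrite lerDl ltW|exact: ltW|].
apply: aeW => x; rewrite -mulrBl normrM indicE.
case: (boolP (x \in _)) => [/set_mem/=|_]; last by rewrite normr0 !mulr0.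
rewrite in_itv/= => /andP[x1 x2]; rewrite normr1 !mulr1; apply: Hd.
by rewrite /= distrC ger0_norm; lra.
Qed.

End Phases.

(** * The phases of a Schroedinger group *)

Section SchrodingerGroups.
Context {R : realType}.
Local Notation mu := (leb R).
Local Notation L2 := (L2 R).
Local Notation L := (g_sigma_algebraType (completed_algebra_gen mu)).
Variable T : R -> L2 -> L2.
Hypothesis hT : schrodinger_group T.

Lemma group_phase t : exists al be : R, al != 0 /\ is_mult (T t) (phase al be).
Proof.
by have [_ _ /(_ t)[uT sT tT yT lT]] := hT; exact: phase_exists.
Qed.

Lemma group_common_exponent : (exists t, T t <> id) ->
  exists al : R, exists2 be : R -> R, al != 0 & forall t, is_mult (T t) (phase al (be t)).
Proof.
have [[_ T0 TD] _ _] := hT; move=> [t0 Tt0].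
have [al [b0 [al0 H0]]] := group_phase t0.
have b0n : b0 != 0.
  by apply/eqP => b00; apply: Tt0; apply: (@mult_phase_id _ _ al); rewrite -b00.
have /choice[be Hbe] : forall t, exists b, is_mult (T t) (phase al b).
  move=> t; have [al1 [b1 [al10 H1]]] := group_phase t.
  (* A zero coefficient gives the identity whatever the exponent, so that [al] may be taken. *)
  have [b1z|b1n] := eqVneq b1 0.
    by exists 0; rewrite phase0 -(phase0 al1) -b1z.
  have [al2 [b2 [_ H2]]] := group_phase (t + t0).
  exists b1; suff -> : al = al1 by [].
  apply/esym; apply: (@phase_exponent_inj _ al1 b1 al b0 al2 b2) => //.
  by rewrite TD in H2; exact: mult_unique (mult_comp H1 H0) H2.
by exists al, be.
Qed.

Section linear_phase.
Variables (al : R) (be : R -> R).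
Hypothesis al0 : al != 0.
Hypothesis Hbe : forall t, is_mult (T t) (phase al (be t)).

Let beD s t : be (s + t) = be s + be t.
Proof.
have [[_ _ TD] _ _] := hT.
apply: (phase_coef_inj al0); have H := Hbe (s + t); rewrite TD in H.
exact: mult_unique H (mult_phase_comp (Hbe s) (Hbe t)).
Qed.

(** The transform is the indicator of a short interval to the right of c, so n.+1 times the inner
    product is an average of the multiplier near c: weak measurability in t passes to the value at
    c. *)
Let test (c : R) (n : nat) : L2 := ftinv (L2class (chi c (c + n.+1%:R^-1))).

Let Im_inner_test c n t : Im (L2inner (T t (test c n)) (test c n)) =
  \int[mu]_x (sin (be t * `|x| `^ al) * \1_(`[c, c + n.+1%:R^-1]%classic) x).
Proof.
set d := c + _.
have c2 : chi c d \in L2fun by exact: chi_L2.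
have u2 : (fun x => phase al (be t) x * chi c d x) \in L2fun.
  by apply: L2_unimod => // [|x]; [exact: mcpx_phase|rewrite normc_expi].
rewrite -ft_inner (@L2inner_ae _ _ _ _ _ u2 c2).
- rewrite Im_cint; apply: eq_Rintegral => x _.
  rewrite /chi /phase indicE; case: (x \in _); rewrite !ReImE !ReImV /=; ring.
- have [_ /(_ (test c n))] := Hbe t; rewrite /test ftinvK => H.
  by apply: ae_imp2 _ H (L2class_ae c2) => x -> ->.
- by rewrite /test ftinvK; exact: L2class_ae.
Qed.

Let measurable_be : measurable_fun [set: L] (be : L -> R).
Proof.
have [_ wT _] := hT.
(* The frequency at which |xi|^al equals 1 / (k + 1), so that the phase of T t there is be t / (k +
   1). *)
pose c (k : nat) : R := (k.+1%:R^-1) `^ al^-1.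
have cal k : c k `^ al = k.+1%:R^-1.
  by rewrite /c -powRrM mulVf// powRr1.
have c0 k : 0 < c k by rewrite powR_gt0.
pose h (k n : nat) (t : L) : R := n.+1%:R * Im (L2inner (T t (test (c k) n)) (test (c k) n)).
have mh k n : measurable_fun [set: L] (h k n).
  apply: measurable_funM; first exact: measurable_cst.
  by have [] := wT (test (c k) n) (test (c k) n).
pose g (k : nat) (t : L) : R := sin (be t * k.+1%:R^-1).
have mg k : measurable_fun [set: L] (g k).
  apply: (measurable_fun_cvg (mh k)) => t _.
  rewrite /g -(cal k) -{1}(ger0_norm (ltW (c0 k))).
  rewrite (_ : (h k)^~ t = fun n => n.+1%:R * \int[mu]_x (sin (be t * `|x| `^ al) *
     \1_(`[c k, c k + n.+1%:R^-1]%classic) x)).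
    apply: (@right_average_cvg _ (fun x => sin (be t * `|x| `^ al))).
    - apply: measurableT_comp; last exact: measurable_abs_powR.
      by apply: continuous_measurable_fun; exact: continuous_sin.
    - by move=> x; exact: sin_abs_le1.
    - have ck : 0 < `|c k| by rewrite normr_gt0 gt_eqF.
      have dp : {for `|c k|, continuous (fun y : R => y `^ al)}.
        apply: differentiable_continuous; apply/derivable1_diffP.
        by have [] := is_derive1_powR al ck.
      apply: (@continuous_comp _ _ _ (fun x : R => be t * `|x| `^ al) sin); last first.
        exact: continuous_sin.
      apply: cvgM; first exact: cvg_cst.
      have cn : {for c k, continuous (fun x : R => `|x|)} by exact: norm_continuous.
      exact: continuous_comp cn dp.
  by apply/funext => n; rewrite /h Im_inner_test.
apply: (measurable_fun_cvg (h := fun k (t : L) => k.+1%:R * g k t)) => [k|t _].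
  by apply: measurable_funM; [exact: measurable_cst|exact: mg].
exact: sin_scaled_cvg.
Qed.

Lemma group_linear_phase t : is_mult (T t) (phase al (t * be 1)).
Proof. by rewrite -(additive_measurable_linear beD measurable_be). Qed.

End linear_phase.

Lemma group_phases : (exists t, T t <> id) -> exists al be : R,
  [/\ al != 0, be != 0 & forall t, is_mult (T t) (phase al (t * be))].
Proof.
move=> Tn; have [al [be al0 Hbe]] := group_common_exponent Tn.
have H := group_linear_phase al0 Hbe; exists al, (be 1); split => //.
apply/eqP => b0; have [t Tt] := Tn; apply: Tt.
by apply: (@mult_phase_id _ _ al); have := H t; rewrite b0 mulr0.
Qed.

End SchrodingerGroups.

Local Close Scope complex_scope.
Local Close Scope classical_set_scope.
Unset Implicit Arguments.

Theorem corollary1p2 (R : realType) (T : R -> L2 R -> L2 R) (alpha : R)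
    (hT : schrodinger_group T) (hT1 : exists t : R, T t <> id)
    (halpha : alpha != 0) :
  [<-> group_of_order T alpha;
       forall t : R, 0 < t -> T t = dilate_op (T 1) (t `^ alpha^-1);
       exists t : R, [/\ 0 < t, t != 1 &
         T t = dilate_op (T 1) (t `^ alpha^-1)]].
Proof.
have [al [be [al0 be0 H]]] := group_phases hT hT1.
have T1 : T 1 <> id.
  move=> T1; have := H 1; rewrite T1 mul1r => H1.
  have Hid : is_mult id (phase al 0) by rewrite phase0; exact: mult_id.
  by move/eqP: be0; apply; apply: (phase_coef_inj al0); exact: mult_unique H1 Hid.
have D t : 0 < t -> is_mult (dilate_op (T 1) (t `^ alpha^-1)) (phase al (t `^ (al / alpha) * be)).
  move=> t0; have := mult_phase_dilate (powR_gt0 alpha^-1 t0) (H 1).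
  by rewrite mul1r -powRrM [alpha^-1 * al]mulrC [be * _]mulrC.
tfae.
- move=> [_ [a [b [a0 /has_phaseP Hab]]]]; case: asboolP => // _ alE t t0.
  have b0 : b != 0.
    by apply/eqP => b0; apply: T1; apply: (@mult_phase_id _ _ a); rewrite -b0.
  have aE : a = al.
    have H1 := H 1; rewrite mul1r in H1.
    (* Both phases describe T 1, so the first times the inverse of the second is the trivial phase,
       a product of the required form. *)
    apply: (@phase_exponent_inj _ a b al (- be) 1 0) => //; rewrite ?oppr_eq0//.
    apply: ae_imp _ (mult_unique Hab H1) => x ->.
    by rewrite phaseM subrr !phase0.
  have := D t t0; rewrite alE aE divff// powRr1 ?ltW// => Dt.
  exact: mult_inj (H t) Dt.
- move=> HT; exists 2; split; rewrite ?ltr0n//; last by apply: HT; rewrite ltr0n.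
  by rewrite -subr_eq0; apply/eqP; lra.
- move=> [t [t0 t1 Et]]; have [_ _ /(_ 1)[uT _ _ _ _]] := hT.
  have Dt := D t t0; rewrite -Et in Dt.
  (* Comparing coefficients yields t = t^(al / alpha); logarithms conclude, since ln t != 0 for t !=
     1. *)
  have /(phase_coef_inj al0)/(mulIf be0) tE := mult_unique (H t) Dt.
  have alE : al = alpha.
    have lt0 : ln t != 0 by rewrite ln_eq0.
    have : ln t = al / alpha * ln t by rewrite -ln_powR -tE.
    rewrite -{1}[ln t]mul1r => /(mulIf lt0) /esym/(congr1 ( *%R^~ alpha)).
    by rewrite mulfVK// mul1r.
  split=> //; exists al, be; split => //.
    by apply/has_phaseP; have := H 1; rewrite mul1r.
  by case: asboolP.
Qed.
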